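(* Let $\alpha:\Gamma\curvearrowright G$ be an action of a countable discrete group $\Gamma$ on a compact quantum group $G$ by quantum automorphisms, and let $\mathbb{G}$ be the crossed product quantum group. The following holds: \begin{enumerate} \item If $\widehat{\mathbb{G}}$ has property $(T)$, then $\Gamma$ has property $(T)$ and $\chi(G)^\alpha$ is finite. \item If $\widehat{\mathbb{G}}$ has property $(T)$ and $\alpha$ is compact, then $\widehat{G}$ and $\Gamma$ have property $(T)$. \item If $\widehat{G}$ has property $(T)$ and $\Gamma$ has property $(T)$, then $\widehat{\mathbb{G}}$ has property $(T)$. \end{enumerate}
   Context: For a compact quantum group $G$: $C_m(G)$ is the maximal C*-algebra (separable), $\Delta_G$ its comultiplication, $\varepsilon_G$ the counit on $C_m(G)$. $\mathrm{Aut}(G)=\{\alpha\in\mathrm{Aut}(C_m(G)):\Delta_G\circ\alpha=(\alpha\otimes\alpha)\circ\Delta_G\}$, with the topology of pointwise norm convergence; an action by quantum automorphisms is a group homomorphism $\alpha:\Gamma\to\mathrm{Aut}(G)$, and it is compact if the closure of its image in $\mathrm{Aut}(G)$ is compact. The crossed product quantum group $\mathbb{G}$ has $C_m(\mathbb{G})$ equal to the full crossed product of $C_m(G)$ by $\Gamma$, generated by a copy $\alpha(C_m(G))$ of $C_m(G)$ and unitaries $u_\gamma$ with $u_\gamma\alpha(a)u_\gamma^*=\alpha(\alpha_\gamma(a))$, with $\Delta_{\mathbb{G}}(u_\gamma)=u_\gamma\otimes u_\gamma$, $\Delta_{\mathbb{G}}\circ\alpha=(\alpha\otimes\alpha)\circ\Delta_G$;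 its counit satisfies $\varepsilon_{\mathbb{G}}(u_\gamma\alpha(a))=\varepsilon_G(a)$. $\widehat G$ has property $(T)$ if every representation $\pi:C_m(G)\to\mathcal B(H)$ admitting unit vectors $\xi_n\in H$ with $\|\pi(x)\xi_n-\varepsilon_G(x)\xi_n\|\to0$ for all $x\in C_m(G)$ admits a nonzero $\xi\in H$ with $\pi(x)\xi=\varepsilon_G(x)\xi$ for all $x\in C_m(G)$ (same for $\widehat{\mathbb{G}}$). $\chi(G)$ is the compact group of characters of $C_m(G)$ (product $gh=(g\otimes h)\circ\Delta_G$, weak* topology), and $\chi(G)^\alpha=\{\chi\in\chi(G):\chi\circ\alpha_\gamma=\chi\ \forall\gamma\in\Gamma\}$. *)

(* Defs.v *)
From HB Require Import structures.
From mathcomp Require Import all_boot all_order all_algebra.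
From mathcomp Require Import complex.
From mathcomp Require Import all_classical all_reals all_analysis.
Set Implicit Arguments.
Unset Strict Implicit.
Unset Printing Implicit Defensive.
Import Order.TTheory GRing.Theory Num.Theory.
Import numFieldNormedType.Exports.
Local Open Scope classical_set_scope.
Local Open Scope ring_scope.

(* Unital C*-algebras.  The multiplication is a field of the mixin, and not an
   inherited ring structure, because the hierarchies of rings and of normed
   modules admit no new join besides the number fields. *)
HB.mixin Record isCStarAlgebra (R : realType) A
    of CompleteNormedModule R[i] A := {
  cone : A;
  cmul : A -> A -> A;
  star : A -> A;
  cmulA : forall x y z, cmul x (cmul y z) = cmul (cmul x y) z;
  cmul1l : forall x, cmul cone x = x;
  cmul1r : forall x, cmul x cone = x;
  cmulDl : forall x y z, cmul (x + y) z = cmul x z + cmul y z;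
  cmulDr : forall x y z, cmul x (y + z) = cmul x y + cmul x z;
  cmulZl : forall (c : R[i]) x y, cmul (c *: x) y = c *: cmul x y;
  cmulZr : forall (c : R[i]) x y, cmul x (c *: y) = c *: cmul x y;
  cone_neq0 : cone != 0;
  starD : forall x y, star (x + y) = star x + star y;
  starZ : forall (c : R[i]) x, star (c *: x) = c^* *: star x;
  starM : forall x y, star (cmul x y) = cmul (star y) (star x);
  starK : forall x, star (star x) = x;
  cstar_normM : forall x y : A, `|cmul x y| <= `|x| * `|y|;
  cstar_norm : forall x : A, `|cmul (star x) x| = `|x| ^+ 2
}.

#[short(type="cstarAlgType")]
HB.structure Definition CStarAlgebra (R : realType) :=
  {A of CompleteNormedModule R[i] A & isCStarAlgebra R A}.

Arguments cone {R s}.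
Arguments cmul {R s}.
Arguments star {R s}.

Notation "x ** y" := (cmul x y) (at level 40, left associativity) : ring_scope.

(* The inner product is linear in its first argument. *)
HB.mixin Record isHilbert (R : realType) H of CompleteNormedModule R[i] H := {
  hdot : H -> H -> R[i];
  hdotDl : forall x y z, hdot (x + y) z = hdot x z + hdot y z;
  hdotZl : forall (c : R[i]) x y, hdot (c *: x) y = c * hdot x y;
  hdotC : forall x y, hdot y x = (hdot x y)^*;
  hdot_norm : forall x : H, hdot x x = `|x| ^+ 2
}.

#[short(type="hilbertType")]
HB.structure Definition Hilbert (R : realType) :=
  {H of CompleteNormedModule R[i] H & isHilbert R H}.

Section Algebra.
Variable R : realType.
Local Notation C := R[i].

Definition linear_span (V : lmodType C) (S : set V) : set V :=
  [set x | exists (n : nat) (c : 'I_n -> C) (v : 'I_n -> V),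
     (forall i, S (v i)) /\ x = \sum_(i < n) c i *: v i].

Definition star_hom (A B : cstarAlgType R) (f : A -> B) : Prop :=
  [/\ linear f, {morph f : x y / x ** y}, f cone = cone
    & {morph f : x / star x}].

Definition character (A : cstarAlgType R) (chi : A -> C) : Prop :=
  [/\ scalar chi, {morph chi : x y / x ** y >-> x * y}, chi cone = 1
    & forall x, chi (star x) = (chi x)^*].

(* [pi] restricts to a unital *-representation by bounded operators of the
   unital *-subalgebra [D] of [A]; its values outside [D] are irrelevant. *)
Definition star_rep_on (A : cstarAlgType R) (D : set A) (H : hilbertType R)
    (pi : A -> H -> H) : Prop :=
  [/\ forall a, D a -> linear (pi a) /\ continuous (pi a),
      forall (c : C) a b, D a -> D b ->
        forall x, pi (c *: a + b) x = c *: pi a x + pi b x,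
      forall a b, D a -> D b -> forall x, pi (a ** b) x = pi a (pi b x),
      forall x, pi cone x = x
    & forall a, D a -> forall x y, hdot (pi a x) y = hdot x (pi (star a) y)].

Definition representation (A : cstarAlgType R) (H : hilbertType R)
    (pi : A -> H -> H) : Prop := star_rep_on setT pi.

Definition faithful_rep (A : cstarAlgType R) (H : hilbertType R)
    (pi : A -> H -> H) : Prop :=
  representation pi /\ injective pi.

Definition hilbert_tensor (H K L : hilbertType R) (t : H -> K -> L) : Prop :=
  [/\ forall y, linear (t^~ y), forall x, linear (t x),
      forall x y x' y', hdot (t x y) (t x' y') = hdot x x' * hdot y y'
    & dense (linear_span [set z | exists x y, z = t x y])].

(* [T] is identified, through a faithful representation [sg], with the norm
   closure in B(H (x) K) of the algebraic tensor product of the images of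
   faithful representations of [A] and [B]. *)
Definition is_min_tensor (A B T : cstarAlgType R) (t : A -> B -> T) : Prop :=
  dense (linear_span [set z | exists a b, z = t a b]) /\
  exists (H K L : hilbertType R) (tH : H -> K -> L)
    (pi : A -> H -> H) (rho : B -> K -> K) (sg : T -> L -> L),
    [/\ hilbert_tensor tH, faithful_rep pi, faithful_rep rho, faithful_rep sg
      & forall a b x y, sg (t a b) (tH x y) = tH (pi a x) (rho b y)].

Record min_tensor (A B : cstarAlgType R) := MinTensor {
  tensor_alg :> cstarAlgType R;
  tens : A -> B -> tensor_alg;
  tensP : is_min_tensor tens
}.

(* [F] is the *-homomorphism f (x) g. *)
Definition tensor_hom (A B A' B' : cstarAlgType R)
    (T : min_tensor A B) (T' : min_tensor A' B')
    (f : A -> A') (g : B -> B') (F : T -> T') : Prop :=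
  star_hom F /\ forall a b, F (tens T a b) = tens T' (f a) (g b).

Section Coproduct.
Variables (A : cstarAlgType R) (A2 : min_tensor A A) (Delta : A -> A2).

(* (Delta (x) id) Delta = (id (x) Delta) Delta, where [s] identifies
   (A (x) A) (x) A with A (x) (A (x) A). *)
Definition coassociative : Prop :=
  exists (A21 : min_tensor A2 A) (A12 : min_tensor A A2)
    (DI : A2 -> A21) (ID : A2 -> A12) (s : A21 -> A12),
    [/\ tensor_hom Delta id DI, tensor_hom id Delta ID,
        star_hom s /\ bijective s,
        forall a b c,
          s (tens A21 (tens A2 a b) c) = tens A12 a (tens A2 b c)
      & forall a, s (DI (Delta a)) = ID (Delta a)].

(* Woronowicz's density (cancellation) conditions. *)
Definition cancellative : Prop :=
  dense (linear_span [set z | exists a b, z = Delta a ** tens A2 cone b]) /\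
  dense (linear_span [set z | exists a b, z = Delta a ** tens A2 b cone]).

Definition unitary_corep (n : nat) (u : 'M[A]_n) : Prop :=
  [/\ forall i j,
        \sum_(k < n) u i k ** star (u j k) = if i == j then cone else 0,
      forall i j,
        \sum_(k < n) star (u k i) ** u k j = if i == j then cone else 0
    & forall i j, Delta (u i j) = \sum_(k < n) tens A2 (u i k) (u k j)].

Definition Pol : set A :=
  linear_span [set a | exists (n : nat) (u : 'M[A]_n) (i j : 'I_n),
                         unitary_corep u /\ a = u i j].

(* [A] is the enveloping (universal) C*-algebra of [Pol]. *)
Definition maximal : Prop :=
  forall (H : hilbertType R) (pi : A -> H -> H), star_rep_on Pol pi ->
  exists2 pi' : A -> H -> H,
    representation pi' & forall a, Pol a -> pi' a = pi a.

(* (eps (x) id) Delta = id = (id (x) eps) Delta *)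
Definition is_counit (eps : A -> C) : Prop :=
  character eps /\
  exists El Er : A2 -> A,
    [/\ star_hom El /\ star_hom Er,
        forall a b, El (tens A2 a b) = eps a *: b,
        forall a b, Er (tens A2 a b) = eps b *: a,
        forall a, El (Delta a) = a
      & forall a, Er (Delta a) = a].

End Coproduct.

Definition separable (A : cstarAlgType R) : Prop :=
  exists D : set A, countable D /\ dense D.

(* A compact quantum group, presented by its maximal C*-algebra.  The counit
   is unique, and it exists for every maximal [Delta]; it is recorded here in
   order to give it a name. *)
Record compact_quantum_group := CompactQuantumGroup {
  Cm : cstarAlgType R;
  Cm2 : min_tensor Cm Cm;
  Delta : Cm -> Cm2;
  counit : Cm -> C;
  Cm_separable : separable Cm;
  Delta_hom : star_hom Delta;
  Delta_coassoc : coassociative Delta;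
  Delta_cancel : cancellative Delta;
  Cm_maximal : maximal Delta;
  counitP : is_counit Delta counit
}.

Implicit Types G : compact_quantum_group.

Definition almost_fixed (I : Type) (H : hilbertType R)
    (S : I -> H -> H) (chi : I -> C) : Prop :=
  exists xi : nat -> H, (forall n, `|xi n| = 1) /\
    forall i, (fun n => S i (xi n) - chi i *: xi n) @ \oo --> (0 : H).

Definition has_fixed (I : Type) (H : hilbertType R)
    (S : I -> H -> H) (chi : I -> C) : Prop :=
  exists2 xi : H, xi != 0 & forall i, S i xi = chi i *: xi.

Definition dual_property_T G : Prop :=
  forall (H : hilbertType R) (pi : Cm G -> H -> H),
    representation pi ->
    almost_fixed pi (@counit G) -> has_fixed pi (@counit G).

Section Group.
Variable Gam : groupType.

Definition unitary_rep (H : hilbertType R) (U : Gam -> H -> H) : Prop :=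
  [/\ forall g, linear (U g),
      forall g x y, hdot (U g x) (U g y) = hdot x y,
      forall x, U 1%g x = x
    & forall g h x, U (g * h)%g x = U g (U h x)].

Definition property_T : Prop :=
  forall (H : hilbertType R) (U : Gam -> H -> H),
    unitary_rep U ->
    almost_fixed U (fun=> 1) -> has_fixed U (fun=> 1).

(* Aut(G), inside the space of all self-maps of C_m(G) with the topology of
   pointwise norm convergence. *)
Definition Aut G : set {ptws Cm G -> Cm G} :=
  [set f | [/\ star_hom (f : Cm G -> Cm G), bijective f
    & exists F : Cm2 G -> Cm2 G,
        tensor_hom f f F /\ forall a, Delta (f a) = F (Delta a)]].

Definition quantum_action G (al : Gam -> Cm G -> Cm G) : Prop :=
  (forall g, Aut (al g)) /\ forall g h, al (g * h)%g = al g \o al h.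

Definition compact_action G (al : Gam -> Cm G -> Cm G) : Prop :=
  compact (closure [set f : {ptws Cm G -> Cm G} | exists g, f = al g]
           `&` @Aut G).

Definition fixed_characters G (al : Gam -> Cm G -> Cm G) : set (Cm G -> C) :=
  [set chi | character chi /\ forall g a, chi (al g a) = chi a].

Section CrossedProduct.
Variables (A : cstarAlgType R) (al : Gam -> A -> A) (B : cstarAlgType R).
Variables (iota : A -> B) (u : Gam -> B).

Definition full_crossed_product : Prop :=
  [/\ star_hom iota /\ injective iota,
      [/\ forall g, star (u g) ** u g = cone,
          forall g, u g ** star (u g) = cone,
          u 1%g = cone & forall g h, u (g * h)%g = u g ** u h],
      forall g a, u g ** iota a ** star (u g) = iota (al g a),
      dense (linear_span [set z | exists g a, z = u g ** iota a])
    & forall (H : hilbertType R) (pi : A -> H -> H) (U : Gam -> H -> H),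
        representation pi -> unitary_rep U ->
        (forall g a x, U g (pi a x) = pi (al g a) (U g x)) ->
        exists sg : B -> H -> H,
          [/\ representation sg, forall a, sg (iota a) = pi a
            & forall g, sg (u g) = U g]].

End CrossedProduct.

Definition crossed_product_quantum_group G (al : Gam -> Cm G -> Cm G)
    (GG : compact_quantum_group) : Prop :=
  exists (iota : Cm G -> Cm GG) (u : Gam -> Cm GG),
    [/\ full_crossed_product al iota u,
        forall g, Delta (u g) = tens (Cm2 GG) (u g) (u g)
      & exists F : Cm2 G -> Cm2 GG,
          tensor_hom iota iota F /\
          forall a, Delta (iota a) = F (Delta a)].

End Group.
End Algebra.

(* Main.v *)
(* Averages over groups are replaced by limit points and by spectral gaps.

   Let eps be the counit.  The kernel of eps in the separable algebra C_m(G) contains a total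
   sequence of self-adjoint contractions s_k; if h is a convex average of the s_k^2, halved, and
   e = (1 - h)^2, then in every representation the powers of e converge strongly to the
   projection onto the eps-fixed vectors.  By the GNS construction, applied to the direct sum of
   a sequence of (Gamma-invariant) states psi_n converging pointwise to eps, property (T) implies
   c |eps(a)|^2 <= psi_n(a^* a) for some n and some c > 0; with a = e^k this bounds
   psi_n(e^(2k)) below.

   (1) The group gets (T) by letting C_m(G) act through eps.  Infinitely many fixed characters
   would accumulate, and after a translation accumulate at eps; but c |eps|^2 <= |psi|^2 forces a
   character psi to be eps.  Products of characters exist on the minimal tensor product because a
   character is approximated by vector states in every faithful representation, and inverses exist
   because the characters form a compact cancellative semigroup.
   (2) Averaging the vector states of almost fixed vectors over Gamma, by Cesaro means of one
   averaging operator of full support, gives invariant states that still converge to eps.  The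
   resulting lower bound on the powers of e contradicts their convergence to 0, uniformly over the
   compact orbit of e by Dini's argument, unless there is a fixed vector.
   (3) The gap on C_m(G) makes almost fixed vectors close to the space of C_m(G)-fixed vectors,
   which is Gamma-invariant; there property (T) of Gamma applies. *)
Require Import Defs.
From HB Require Import structures.
From mathcomp Require Import all_boot all_order all_algebra.
From mathcomp Require Import complex.
From mathcomp Require Import all_classical all_reals all_analysis.
From mathcomp Require Import ring lra zify.
Set Implicit Arguments.
Unset Strict Implicit.
Unset Printing Implicit Defensive.
Import Order.TTheory GRing.Theory Num.Theory.
Import numFieldNormedType.Exports.
Local Open Scope classical_set_scope.
Local Open Scope ring_scope.

(** * Real-valued norms and limits over R[i] *)

(** One analytic tool carries the C*-theory: for self-adjoint [t] with [nm t <= 1], the limit [y] of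
    the iteration [y := (t + y^2)/2] gives the square root [1 - y] of [1 - t]. Positivity of a
    self-adjoint [r] is accordingly recorded as [nm (cone - r) <= 1], and the contractivity of
    representations, characters and homomorphisms comes from completing [s] by a square root of
    [1 - s^2]. Property (T) speaks of one representation with a sequence of almost fixed vectors,
    hence the direct sum of GNS spaces. It returns a single index [n] and a single constant [c],
    valid for all test elements; the powers of [e] are tested because a bound uniform in the power
    is what strong convergence to 0 contradicts. In (2) the obstacle is that the bound concerns
    averaged states: for each power it only produces some group element [g], depending on the power,
    whose translate is large on the vector [xi n]. Monotonicity in the power and compactness of the
    orbit exchange the two quantifiers. *)

Lemma near_ex2 I (F : set_system I) (FF : ProperFilter F) (P Q : I -> Prop) :
  (\forall i \near F, P i) -> (\forall i \near F, Q i) -> exists i, P i /\ Q i.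
Proof.
move=> h1 h2; have h : F (P `&` Q) by apply: filterI.
by have [i hi] := @filter_ex _ F FF _ h; exists i.
Qed.

Lemma ultra_fmap I J (F : set_system I) (f : I -> J) :
  UltraFilter F -> UltraFilter (f @ F).
Proof.
move=> FU; apply: Build_UltraFilter => G GP uFG.
rewrite predeqE => A; split=> [GA|/uFG//].
have [//|nA] := in_ultra_setVsetC (f @^-1` A) FU.
have nGA : G (~` A) by apply: uFG.
by have [i []] := near_ex2 GP (GA : \near G, A G) (nGA : \near G, (~` A) G).
Qed.

Section ComplexNorm.
Variable R : realType.
Local Notation C := R[i].

(** Norms over [R[i]] are elements of [R[i]]; [rc], [cabs] and [nm] carry them to and from [R],
    where the order is total and [lra] applies. *)
Definition rc (r : R) : C := Complex r 0.

Definition cabs (z : C) : R := complex.Re `|z|.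

Definition nm (V : normedModType C) (x : V) : R := complex.Re `|x|.

Lemma Cext (z w : C) : complex.Re z = complex.Re w ->
  complex.Im z = complex.Im w -> z = w.
Proof. by case: z w => [? ?] [? ?] /= -> ->. Qed.
Lemma ReD (z w : C) : complex.Re (z + w) = complex.Re z + complex.Re w.
Proof. by case: z w => [? ?] [? ?]. Qed.
Lemma ReN (z : C) : complex.Re (- z) = - complex.Re z.
Proof. by case: z => [? ?]. Qed.
Lemma ReB (z w : C) : complex.Re (z - w) = complex.Re z - complex.Re w.
Proof. by rewrite ReD ReN. Qed.
Lemma ImD (z w : C) : complex.Im (z + w) = complex.Im z + complex.Im w.
Proof. by case: z w => [? ?] [? ?]. Qed.
Lemma ReM (z w : C) : complex.Re (z * w) =
  complex.Re z * complex.Re w - complex.Im z * complex.Im w.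
Proof. by case: z w => [? ?] [? ?]. Qed.
Lemma ImM (z w : C) : complex.Im (z * w) =
  complex.Re z * complex.Im w + complex.Im z * complex.Re w.
Proof. by case: z w => [? ?] [? ?]. Qed.
Lemma Reconj (z : C) : complex.Re z^* = complex.Re z.
Proof. by case: z => [? ?]. Qed.
Lemma Imconj (z : C) : complex.Im z^* = - complex.Im z.
Proof. by case: z => [? ?]. Qed.
Lemma rcD r s : rc (r + s) = rc r + rc s.
Proof. by apply: Cext; rewrite ?ReD ?ImD //= addr0. Qed.
Lemma rcM r s : rc (r * s) = rc r * rc s.
Proof. by apply: Cext; rewrite ?ReM ?ImM /=; ring. Qed.
Lemma rcN r : rc (- r) = - rc r.
Proof. by apply: Cext => //=; rewrite oppr0. Qed.
Lemma rcX r n : rc (r ^+ n) = rc r ^+ n.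
Proof. by elim: n => // n IH; rewrite !exprS rcM IH. Qed.
Lemma rcI r s : rc r = rc s -> r = s. Proof. by case. Qed.
Lemma le_rc r s : (rc r <= rc s) = (r <= s).
Proof. by rewrite lecE /= eqxx. Qed.
Lemma lt_rc r s : (rc r < rc s) = (r < s).
Proof. by rewrite ltcE /= eqxx. Qed.
Lemma Re_rc r z : complex.Re (rc r * z) = r * complex.Re z.
Proof. by rewrite ReM /= mul0r subr0. Qed.
Lemma conj_rc r : (rc r)^* = rc r.
Proof. by apply: Cext => //=; rewrite oppr0. Qed.
Lemma conjM (z w : C) : (z * w)^* = z^* * w^*. Proof. exact: rmorphM. Qed.
Lemma conjD (z w : C) : (z + w)^* = z^* + w^*. Proof. exact: rmorphD. Qed.

Lemma ge0_ReK (z : C) : 0 <= z -> rc (complex.Re z) = z.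
Proof. by rewrite lecE /= => /andP[/eqP z0 _]; apply: Cext. Qed.

Lemma cabsE z : `|z| = rc (cabs z).
Proof. by rewrite /cabs ge0_ReK. Qed.

Lemma cabs_sqr z : cabs z ^+ 2 = complex.Re z ^+ 2 + complex.Im z ^+ 2.
Proof. by apply: rcI; rewrite rcX -cabsE -add_Re2_Im2. Qed.

Lemma cabs_ge0 z : 0 <= cabs z.
Proof. by rewrite -le_rc -cabsE normr_ge0. Qed.

Lemma cabsM z w : cabs (z * w) = cabs z * cabs w.
Proof. by apply: rcI; rewrite rcM -!cabsE normrM. Qed.

Lemma cabsD z w : cabs (z + w) <= cabs z + cabs w.
Proof. by rewrite -le_rc rcD -!cabsE ler_normD. Qed.

Lemma cabsN z : cabs (- z) = cabs z.
Proof. by rewrite /cabs normrN. Qed.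

Lemma cabs0 : cabs 0 = 0. Proof. by rewrite /cabs normr0. Qed.
Lemma cabs1 : cabs 1 = 1. Proof. by rewrite /cabs normr1. Qed.

Lemma cabs0_eq0 z : cabs z = 0 -> z = 0.
Proof. by move=> z0; apply/eqP; rewrite -normr_eq0 cabsE z0. Qed.

Lemma cabsR (r : R) : cabs (rc r) = `|r|.
Proof.
apply/eqP; rewrite -(@eqrXn2 _ 2) ?cabs_ge0 // cabs_sqr /= expr0n addr0.
by rewrite real_normK ?num_real.
Qed.

Lemma cabs_conj (z : C) : cabs z^* = cabs z.
Proof. by rewrite /cabs norm_conjC. Qed.

Lemma Re_le_cabs z : `|complex.Re z| <= cabs z.
Proof. by rewrite -le_rc -cabsE normc_ge_Re. Qed.

Lemma Re_le z : complex.Re z <= cabs z.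
Proof. exact: le_trans (ler_norm _) (Re_le_cabs z). Qed.

Lemma cabs_le z : cabs z <= `|complex.Re z| + `|complex.Im z|.
Proof.
rewrite -ler_sqr ?nnegrE ?cabs_ge0 ?addr_ge0 // cabs_sqr sqrrD.
rewrite -[_ ^+ 2]real_normK ?num_real // -[complex.Im z ^+ 2]real_normK ?num_real //.
by rewrite addrAC lerDl mulrn_wge0 // mulr_ge0.
Qed.

Lemma mulconj (z : C) : z * z^* = rc (cabs z ^+ 2).
Proof.
apply: Cext; rewrite ?ReM ?ImM Reconj Imconj /=; last by ring.
by rewrite cabs_sqr; ring.
Qed.

Section NM.
Variable V : normedModType C.
Implicit Types x y : V.

Lemma nmE x : `|x| = rc (nm x).
Proof. by rewrite /nm ge0_ReK. Qed.

Lemma nm_ge0 x : 0 <= nm x. Proof. by rewrite -le_rc -nmE normr_ge0. Qed.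
Lemma nm0 : nm (0 : V) = 0. Proof. by rewrite /nm normr0. Qed.
Lemma nmN x : nm (- x) = nm x. Proof. by rewrite /nm normrN. Qed.
Lemma nmD x y : nm (x + y) <= nm x + nm y.
Proof. by rewrite -le_rc rcD -!nmE ler_normD. Qed.
Lemma nmB x y : nm (x - y) <= nm x + nm y.
Proof. by rewrite -(nmN y) nmD. Qed.
Lemma nmZ c x : nm (c *: x) = cabs c * nm x.
Proof. by apply: rcI; rewrite rcM -nmE normrZ -nmE -cabsE. Qed.
Lemma nm_eq0 x : nm x = 0 -> x = 0.
Proof. by move=> x0; apply/eqP; rewrite -normr_eq0 nmE x0. Qed.
Lemma nm_gt0 x : x != 0 -> 0 < nm x.
Proof. by move=> x0; rewrite lt0r nm_ge0 andbT; apply: contra_neq x0 => /nm_eq0. Qed.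
Lemma nmC x y : nm (x - y) = nm (y - x). Proof. by rewrite /nm distrC. Qed.
Lemma nm_tri z x y : nm (x - y) <= nm (x - z) + nm (z - y).
Proof. by rewrite (_ : x - y = (x - z) + (z - y)) ?nmD // addrA subrK. Qed.
Lemma nm_subl x y : nm x - nm y <= nm (x - y).
Proof. by rewrite lerBlDr -{1}(subrK y x) nmD. Qed.
Lemma nmZr (r : R) x : 0 <= r -> nm (rc r *: x) = r * nm x.
Proof. by move=> r0; rewrite nmZ cabsR ger0_norm. Qed.
Lemma nm_eq1 x : `|x| = 1 <-> nm x = 1.
Proof. by rewrite nmE; split=> [[]//|->]. Qed.
Lemma nm_small x : (forall e, 0 < e -> nm x <= e) -> x = 0.
Proof.
move=> h; apply: nm_eq0; apply/eqP; rewrite eq_le nm_ge0 andbT.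
by apply/ler_addgt0Pr => e e0; rewrite add0r h.
Qed.
End NM.

(** Filter convergence with real tolerances; the same notion serves sequences, ultrafilters and
    products of filters. *)
Definition tends I (F : set_system I) (V : normedModType C) (u : I -> V) (l : V) :=
  forall e : R, 0 < e -> \forall i \near F, nm (u i - l) < e.

Section Tends.
Context {I : Type} {F : set_system I} {FF : Filter F}.
Implicit Types V W : normedModType C.

Lemma tendsE V (u : I -> V) l : tends F u l <-> u @ F --> l.
Proof.
split=> [h|/cvgrPdist_lt h].
  apply/cvgrPdist_lt => e e0.
  have e0' : 0 < complex.Re e by rewrite -lt_rc ge0_ReK ?ltW.
  apply: filterS (h _ e0') => i; rewrite nmC -lt_rc -nmE.
  by rewrite (ge0_ReK (ltW e0)).
move=> e e0; have e0' : 0 < rc e by rewrite lt_rc.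
by apply: filterS (h _ e0') => i; rewrite nmE nmC lt_rc.
Qed.

Lemma tends_cst V (l : V) : tends F (fun=> l) l.
Proof. by move=> e e0; apply: nearW => i; rewrite subrr nm0. Qed.

Lemma tends_near V (u v : I -> V) l :
  (\forall i \near F, u i = v i) -> tends F u l -> tends F v l.
Proof. by move=> uv h e /h; apply: filterS2 uv => i ->. Qed.

Lemma tends_eq V (u v : I -> V) l : tends F u l -> (forall i, u i = v i) -> tends F v l.
Proof. by move=> h /funext <-. Qed.

Lemma tends_lip V W (f : V -> W) (k : R) u l :
  (forall x y, nm (f x - f y) <= k * nm (x - y)) ->
  tends F u l -> tends F (f \o u) (f l).
Proof.
move=> fk h e e0; have k0 : 0 < `|k| + 1 by rewrite ltr_pwDr.
have /h := divr_gt0 e0 k0; apply: filterS => i.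
rewrite ltr_pdivlMr // => /= h1; apply: le_lt_trans (fk _ _) _.
apply: le_lt_trans h1; rewrite mulrC ler_wpM2l ?nm_ge0 //.
by rewrite (le_trans (ler_norm _)) // lerDl.
Qed.

Lemma tendsD V (u v : I -> V) l m :
  tends F u l -> tends F v m -> tends F (fun i => u i + v i) (l + m).
Proof.
move=> hu hv e e0; have e2 : 0 < e / 2 by rewrite divr_gt0.
apply: filterS2 (hu _ e2) (hv _ e2) => i h1 h2.
rewrite [X in _ < X](splitr e) opprD addrACA.
by rewrite (le_lt_trans (nmD _ _)) // ltrD.
Qed.

Lemma tendsZ V c (u : I -> V) l : tends F u l -> tends F (fun i => c *: u i) (c *: l).
Proof.
by apply: (tends_lip (f := fun x => c *: x) (k := cabs c)) => x y; rewrite -scalerBr nmZ.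
Qed.

Lemma tendsN V (u : I -> V) l : tends F u l -> tends F (fun i => - u i) (- l).
Proof. by move=> h; under eq_fun do rewrite -scaleN1r; rewrite -(scaleN1r l); exact: tendsZ. Qed.

Lemma tendsB V (u v : I -> V) l m :
  tends F u l -> tends F v m -> tends F (fun i => u i - v i) (l - m).
Proof. by move=> hu hv; apply: tendsD => //; apply: tendsN. Qed.

Lemma tends_sub0 V (u : I -> V) l : tends F u l <-> tends F (fun i => u i - l) 0.
Proof. by split=> h e /h; apply: filterS => i; rewrite subr0. Qed.

Lemma tends_squeeze V W (u : I -> V) (v : I -> W) (k : R) :
  (\forall i \near F, nm (u i) <= k * nm (v i)) -> tends F v 0 -> tends F u 0.
Proof.
move=> h hv e e0; have k0 : 0 < `|k| + 1 by rewrite ltr_pwDr.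
have /hv := divr_gt0 e0 k0; apply: filterS2 h => i h1.
rewrite !subr0 ltr_pdivlMr // => h2; apply: le_lt_trans h1 _; apply: le_lt_trans h2.
by rewrite mulrC ler_wpM2l ?nm_ge0 // (le_trans (ler_norm _)) // lerDl.
Qed.

End Tends.

Section TendsProper.
Context {I : Type} {F : set_system I} {FF : ProperFilter F}.
Implicit Types V W : normedModType C.

Lemma tends_uniq V (u : I -> V) l m : tends F u l -> tends F u m -> l = m.
Proof.
move=> hl hm; apply/eqP; rewrite -subr_eq0; apply/eqP/nm_small => e e0.
have e2 : 0 < e / 2 by rewrite divr_gt0.
have [i [h1 h2]] := near_ex2 FF (hl _ e2) (hm _ e2).
rewrite (le_trans (nm_tri (u i) _ _)) // [X in _ <= X](splitr e) ltW // ltrD //.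
by rewrite nmC.
Qed.

Lemma tends_le V (u : I -> V) l M :
  (\forall i \near F, nm (u i) <= M) -> tends F u l -> nm l <= M.
Proof.
move=> h hu; apply/ler_addgt0Pr => e e0.
have [i [h1 h2]] := near_ex2 FF h (hu _ e0).
have := nm_subl l (u i); rewrite nmC; lra.
Qed.

Lemma tends_ge V (u : I -> V) l M :
  (\forall i \near F, M <= nm (u i)) -> tends F u l -> M <= nm l.
Proof.
move=> h hu; apply/ler_addgt0Pr => e e0.
have [i [h1 h2]] := near_ex2 FF h (hu _ e0).
have := nm_subl (u i) l; lra.
Qed.

Lemma tends_Re_le (u : I -> C^o) l M :
  (\forall i \near F, complex.Re (u i) <= M) -> tends F u l -> complex.Re l <= M.
Proof.
move=> h hu; apply/ler_addgt0Pr => e e0.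
have [i [h1 h2]] := near_ex2 FF h (hu _ e0).
have := Re_le_cabs (u i - l); rewrite ReB ler_norml => /andP[h3 _].
have : cabs (u i - l) < e by []. lra.
Qed.

Lemma tends_Re_ge (u : I -> C^o) l M :
  (\forall i \near F, M <= complex.Re (u i)) -> tends F u l -> M <= complex.Re l.
Proof.
move=> h hu; apply/ler_addgt0Pr => e e0.
have [i [h1 h2]] := near_ex2 FF h (hu _ e0).
have := Re_le_cabs (u i - l); rewrite ReB ler_norml => /andP[_ h3].
have : cabs (u i - l) < e by []. lra.
Qed.

End TendsProper.

Lemma tends_comp I J (F : set_system I) (G : set_system J) (f : I -> J)
    (V : normedModType C) (u : J -> V) l :
  f @ F --> G -> tends G u l -> tends F (u \o f) l.
Proof. by move=> fG h e /h /fG. Qed.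

Lemma tends_sub I (F G : set_system I) (V : normedModType C) (u : I -> V) l :
  F `<=` G -> tends F u l -> tends G u l.
Proof. by move=> FG h e /h /FG. Qed.

Lemma tends_bilin I (F : set_system I) {FF : ProperFilter F}
    (U V W : normedModType C) (f : U -> V -> W) u v l m :
  (forall x x' y, f (x - x') y = f x y - f x' y) ->
  (forall x y y', f x (y - y') = f x y - f x y') ->
  (forall x y, nm (f x y) <= nm x * nm y) ->
  tends F u l -> tends F v m -> tends F (fun i => f (u i) (v i)) (f l m).
Proof.
move=> fl fr fb hu hv; apply/tends_sub0.
have -> : (fun i => f (u i) (v i) - f l m) =
  (fun i => f (u i - l) (v i) + f l (v i - m)).
  by apply/funext => i; rewrite fl fr addrA subrK.
rewrite -[0 in X in tends _ _ X](addr0 0); apply: tendsD.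
  have /tends_sub0 hu' := hu.
  apply: (tends_squeeze (k := nm m + 1)) hu'.
  apply: filterS (hv _ ltr01) => i hi; rewrite (le_trans (fb _ _)) // mulrC.
  by rewrite ler_wpM2r ?nm_ge0 //; have := nm_subl (v i) m; lra.
have /tends_sub0 hv' := hv.
by apply: (tends_squeeze (k := nm l)) hv'; apply: nearW => i; apply: fb.
Qed.

Lemma ultra_bounded_real I (F : set_system I) (FU : UltraFilter F) (u : I -> R) M :
  (forall i, `|u i| <= M) -> exists l : R, u @ F --> l.
Proof.
move=> h; have := @segment_compact R (- M) M; rewrite compact_ultra.
have U := ultra_fmap u FU.
move=> /(_ _ U) []; first by apply: nearW => i /=; rewrite in_itv /= -ler_norml.
by move=> l [_ ul]; exists l.
Qed.

(** Ultrafilters replace subsequences: a single one makes all bounded complex families over [I]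
    converge at once. *)
Lemma ultra_bounded I (F : set_system I) (FU : UltraFilter F) (u : I -> C^o) M :
  (forall i, cabs (u i) <= M) -> exists l, tends F u l.
Proof.
move=> h; have [a /cvgrPdist_lt ha] := ultra_bounded_real FU
  (fun i => le_trans (Re_le_cabs (u i)) (h i)).
have hi i : `|complex.Im (u i)| <= M.
  apply: le_trans (h i); rewrite -ler_sqr ?nnegrE ?cabs_ge0 // cabs_sqr.
  by rewrite real_normK ?num_real // lerDr sqr_ge0.
have [b /cvgrPdist_lt hb] := ultra_bounded_real FU hi.
exists (Complex a b) => e e0; have e2 : 0 < e / 2 by rewrite divr_gt0.
apply: filterS2 (ha _ e2) (hb _ e2) => i h1 h2.
rewrite [X in _ < X](splitr e); apply: le_lt_trans (cabs_le _) _.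
rewrite ltrD //; last by move: h2; rewrite distrC; case: (u i).
by move: h1; rewrite distrC; case: (u i).
Qed.

Definition cauchy_seq (V : normedModType C) (u : nat -> V) :=
  forall e : R, 0 < e -> exists N, forall m n, (N <= m)%N -> (N <= n)%N -> nm (u m - u n) < e.

Lemma near_ge (N : nat) : \forall n \near \oo, (N <= n)%N.
Proof. by exists N. Qed.

Lemma cauchy_tends_ultra (V : normedModType C) (u : nat -> V) (F : set_system nat)
  (FF : ProperFilter F) l : \oo `<=` F -> cauchy_seq u -> tends F u l -> tends \oo u l.
Proof.
move=> oF uc h e e0; have e2 : 0 < e / 2 by rewrite divr_gt0.
have [N hN] := uc _ e2; exists N => // n /= Nn.
have [m [h1 h2]] := near_ex2 FF (h _ e2) (oF _ (near_ge N)).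
rewrite (le_lt_trans (nm_tri (u m) _ _)) // [X in _ < X](splitr e) ltrD //.
exact: hN.
Qed.

Lemma complex_cauchy (u : nat -> C^o) : cauchy_seq u -> exists l, tends \oo u l.
Proof.
move=> uc; have [F [FU oF]] := ultraFilterLemma eventually_filter.
have [N hN] := uc _ ltr01.
(* Freezing the first [N] terms gives a bound at every index, as [ultra_bounded] requires; the
   ultrafilter refines [\oo] and does not see the change. *)
have hb n : cabs (u (maxn N n)) <= nm (u N) + 1.
  have := hN _ N (leq_maxl N n) (leqnn _).
  by have := nm_subl (u (maxn N n)) (u N); rewrite -[cabs _]/(nm (u _)); lra.
have [l hl] := ultra_bounded FU hb.
exists l; apply: (@cauchy_tends_ultra _ _ F) => //.
apply: tends_near hl; apply: oF; exists N => // n /= Nn.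
by rewrite (maxn_idPr Nn).
Qed.

Lemma complete_cauchy (V : completeNormedModType C) (u : nat -> V) :
  cauchy_seq u -> exists l, tends \oo u l.
Proof.
move=> uc; have : cvg (u @ \oo).
  apply: cauchy_cvg; apply/cauchy_ballP => e e0.
  have e0' : 0 < complex.Re e by rewrite -lt_rc ge0_ReK ?ltW.
  have [N hN] := uc _ e0'; near_simpl.
  exists ([set n | (N <= n)%N], [set n | (N <= n)%N]).
    by split; exists N.
  move=> [m n] [/= Nm Nn]; rewrite -ball_normE /=.
  by rewrite nmE -(ge0_ReK (ltW e0)) lt_rc hN.
by move=> /cvg_ex[l hl]; exists l; apply/tendsE.
Qed.

End ComplexNorm.

Lemma mono_cauchy (R : realType) (q : nat -> R) M :
  (forall n, q n <= q n.+1) -> (forall n, q n <= M) ->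
  forall e, 0 < e -> exists N, forall n, (N <= n)%N -> forall m, (N <= m)%N -> `|q m - q n| < e.
Proof.
move=> qS qM e e0.
have hs : has_sup (range q) by split; [exists (q 0); exists 0|exists M => _ [n _ <-]].
have qm : {homo q : m n / (m <= n)%N >-> m <= n} by apply: homo_leq => //; apply: le_trans.
have [_ [N _ <-] hN] := sup_adherent e0 hs; exists N => n Nn m Nm.
have ub k : q k <= sup (range q) by apply: sup_upper_bound => //; exists k.
have := ub n; have := ub m; have := qm _ _ Nn; have := qm _ _ Nm.
rewrite ltr_norml; lra.
Qed.

Section Linear.
Variable R : realType.
Local Notation C := R[i].
Variables (U V : lmodType C) (f : U -> V).
Hypothesis fL : linear f.
Lemma linD x y : f (x + y) = f x + f y.
Proof. by have := fL 1 x y; rewrite !scale1r. Qed.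
Lemma lin0 : f 0 = 0.
Proof. by have := fL (-1) 0 0; rewrite scaler0 addr0 scaleN1r addNr. Qed.
Lemma linZ c x : f (c *: x) = c *: f x.
Proof. by rewrite -[c *: x]addr0 fL lin0 addr0. Qed.
Lemma linN x : f (- x) = - f x.
Proof. by rewrite -scaleN1r linZ scaleN1r. Qed.
Lemma linB x y : f (x - y) = f x - f y.
Proof. by rewrite linD linN. Qed.
Lemma lin_sum n (c : 'I_n -> C) (v : 'I_n -> U) :
  f (\sum_(i < n) c i *: v i) = \sum_(i < n) c i *: f (v i).
Proof.
apply: (big_ind2 (fun a b => f a = b)); rewrite ?lin0 //.
  by move=> a _ b _ <- <-; rewrite linD.
by move=> i _; rewrite linZ.
Qed.
End Linear.

(** * Positive semidefinite Hermitian forms *)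

Section Forms.
Variable R : realType.
Local Notation C := R[i].

(** Degenerate forms are allowed, so that inner products and the forms of the GNS construction share
    one theory. *)
Record form (V : lmodType C) := Form {
  fm :> V -> V -> C;
  fmD : forall x y z, fm (x + y) z = fm x z + fm y z;
  fmZ : forall c x y, fm (c *: x) y = c * fm x y;
  fmC : forall x y, fm y x = (fm x y)^*;
  fm_ge0 : forall x, 0 <= complex.Re (fm x x)
}.

Section FormTheory.
Variables (V : lmodType C) (B : form V).

Lemma fm_lin z : linear (fun x => B x z : C^o).
Proof. by move=> c x y; rewrite fmD fmZ. Qed.
Lemma fm0l x : B 0 x = 0. Proof. exact: (lin0 (fm_lin x)). Qed.
Lemma fmNl x y : B (- x) y = - B x y. Proof. exact: (linN (fm_lin y)). Qed.
Lemma fmBl x y z : B (x - y) z = B x z - B y z. Proof. exact: (linB (fm_lin z)). Qed.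
Lemma fm0r x : B x 0 = 0. Proof. by rewrite fmC fm0l rmorph0. Qed.
Lemma fmDr x y z : B x (y + z) = B x y + B x z.
Proof. by rewrite fmC fmD conjD -!fmC. Qed.
Lemma fmNr x y : B x (- y) = - B x y.
Proof. by rewrite fmC fmNl rmorphN /= -fmC. Qed.
Lemma fmBr x y z : B x (y - z) = B x y - B x z.
Proof. by rewrite fmDr fmNr. Qed.
Lemma fmZr c x y : B x (c *: y) = c^* * B x y.
Proof. by rewrite fmC fmZ conjM -fmC. Qed.
Lemma fm_self x : B x x = rc (complex.Re (B x x)).
Proof. apply: Cext => //=; have := congr1 (@complex.Im _) (fmC B x x); rewrite Imconj; lra. Qed.

Lemma form_CS x y : cabs (B x y) ^+ 2 <= complex.Re (B x x) * complex.Re (B y y).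
Proof.
set c := B x y; set a := complex.Re (B x x); set b := complex.Re (B y y).
have key t : 0 <= a - 2 * t * cabs c ^+ 2 + t ^+ 2 * cabs c ^+ 2 * b.
  have := fm_ge0 B (x - (rc t * c) *: y).
  rewrite fmBl !fmBr !fmZ !fmZr conjM conj_rc -/c (fmC B x y) -/c (fm_self y) -/b.
  rewrite (_ : rc t * c * (rc t * c^* * rc b) = rc (t ^+ 2 * cabs c ^+ 2 * b)); last first.
    rewrite rcM (rcM (t ^+ 2)) -mulconj rcX; ring.
  rewrite (_ : rc t * c^* * c = rc (t * cabs c ^+ 2)); last by rewrite (rcM t) -mulconj; ring.
  rewrite (_ : rc t * c * c^* = rc (t * cabs c ^+ 2)); last by rewrite (rcM t) -mulconj; ring.
  by rewrite !ReB /= -/a; lra.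
have b0 : 0 <= b by exact: fm_ge0.
have [b1|bN] := ltP 0 b.
  (* The minimum of the quadratic in [t]. *)
  have := key b^-1.
  have -> : a - 2 * b^-1 * cabs c ^+ 2 + b^-1 ^+ 2 * cabs c ^+ 2 * b = a - cabs c ^+ 2 / b.
    by field; rewrite gt_eqF.
  by rewrite subr_ge0 ler_pdivrMr.
have bE : b = 0 by apply/eqP; rewrite eq_le b0 bN.
(* When [b = 0] the bound is affine in [t]; at this [t] it reads [0 <= - a - 2], unless [c = 0]. *)
rewrite bE mulr0; have := key ((a + 1) / (cabs c ^+ 2)); rewrite bE mulr0 addr0.
have [-> //|c0] := eqVneq (cabs c ^+ 2) 0.
rewrite -mulrA divfK //; have := fm_ge0 B x; rewrite -/a; lra.
Qed.
End FormTheory.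

Section Hilbert.
Variable H : hilbertType R.
Implicit Types x y : H.

Lemma hdot_nm x : hdot x x = rc (nm x ^+ 2).
Proof. by rewrite hdot_norm nmE rcX. Qed.

Lemma hdot_re_ge0 x : 0 <= complex.Re (hdot x x).
Proof. by rewrite hdot_nm /= sqr_ge0. Qed.

Definition hform : form H := Form (@hdotDl R H) (@hdotZl R H) (@hdotC R H) hdot_re_ge0.

Lemma hdot0l x : hdot 0 x = 0. Proof. exact: (fm0l hform). Qed.
Lemma hdot0r x : hdot x 0 = 0. Proof. exact: (fm0r hform). Qed.
Lemma hdotBl x y z : hdot (x - y) z = hdot x z - hdot y z. Proof. exact: (fmBl hform). Qed.
Lemma hdotBr x y z : hdot x (y - z) = hdot x y - hdot x z. Proof. exact: (fmBr hform). Qed.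
Lemma hdotZr c x y : hdot x (c *: y) = c^* * hdot x y. Proof. exact: (fmZr hform). Qed.
Lemma hdot_CS x y : cabs (hdot x y) <= nm x * nm y.
Proof.
rewrite -ler_sqr ?nnegrE ?cabs_ge0 ?mulr_ge0 ?nm_ge0 // exprMn.
by have := form_CS hform x y; rewrite /= !hdot_nm.
Qed.

End Hilbert.
End Forms.

(** * Norm estimates and square roots in C*-algebras *)

Section CStar.
Variable R : realType.
Local Notation C := R[i].
Variable A : cstarAlgType R.
Implicit Types x y z s t : A.

Lemma cmul_linl y : linear (fun x : A => x ** y).
Proof. by move=> c u v; rewrite cmulDl cmulZl. Qed.
Lemma cmul_linr x : linear (cmul x).
Proof. by move=> c u v; rewrite cmulDr cmulZr. Qed.
Lemma cmul0l y : (0 : A) ** y = 0. Proof. exact: (lin0 (cmul_linl y)). Qed.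
Lemma cmul0r y : y ** (0 : A) = 0. Proof. exact: (lin0 (cmul_linr y)). Qed.
Lemma cmulBl x y z : (x - y) ** z = x ** z - y ** z. Proof. exact: (linB (cmul_linl z)). Qed.
Lemma cmulBr x y z : z ** (x - y) = z ** x - z ** y. Proof. exact: (linB (cmul_linr z)). Qed.
Lemma star0 : star (0 : A) = 0.
Proof. by have := starZ 0 (0 : A); rewrite rmorph0 !scale0r. Qed.
Lemma starN x : star (- x) = - star x.
Proof. by rewrite -scaleN1r starZ rmorphN rmorph1 scaleN1r. Qed.
Lemma starB x y : star (x - y) = star x - star y.
Proof. by rewrite starD starN. Qed.
Lemma star1 : star (cone : A) = cone.
Proof. by rewrite -[star cone]cmul1l -{1}[cone]starK -starM cmul1l starK. Qed.

Lemma nmM x y : nm (x ** y) <= nm x * nm y.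
Proof. by rewrite -le_rc rcM -!nmE cstar_normM. Qed.
Lemma nm_starM x : nm (star x ** x) = nm x ^+ 2.
Proof. by apply: rcI; rewrite rcX -!nmE cstar_norm. Qed.
Lemma nm_star x : nm (star x) = nm x.
Proof.
have h y : nm y <= nm (star y).
  have [/eqP y0|y0] := boolP (nm y == 0); first by rewrite y0 nm_ge0.
  have yp : 0 < nm y by rewrite lt0r y0 nm_ge0.
  by rewrite -(ler_pM2r yp) -expr2 -nm_starM nmM.
by apply/eqP; rewrite eq_le h -{2}[x]starK h.
Qed.
Lemma nm1 : nm (cone : A) = 1.
Proof.
have := nm_starM (cone : A); rewrite star1 cmul1l expr2.
have n0 : nm (cone : A) != 0 by apply: contra_neq (@cone_neq0 R A); apply: nm_eq0.
by rewrite -{1}[nm cone]mulr1 => /(mulfI n0).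
Qed.
Lemma nm_selfsq s : star s = s -> nm (s ** s) = nm s ^+ 2.
Proof. by move=> h; rewrite -nm_starM h. Qed.

Lemma tends_cmul I (F : set_system I) {FF : ProperFilter F} (u v : I -> A) l m :
  tends F u l -> tends F v m -> tends F (fun i => u i ** v i) (l ** m).
Proof.
apply: (@tends_bilin _ _ _ _ A A A (@cmul R A)) => [x x' y|x y y'|].
- exact: cmulBl.
- exact: cmulBr.
- exact: nmM.
Qed.

Lemma tends_star I (F : set_system I) {FF : ProperFilter F} (u : I -> A) l :
  tends F u l -> tends F (fun i => star (u i)) (star l).
Proof. by apply: (tends_lip (k := 1)) => x y; rewrite -starB nm_star mul1r. Qed.

(* The iteration y := (t + y^2)/2 is majorised by the same iteration on numbers started from t = 1. *)
Fixpoint sqrt_iter t n : A :=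
  if n is n'.+1 then rc 2^-1 *: (t + sqrt_iter t n' ** sqrt_iter t n') else 0.

Fixpoint sqrt_bound n : R :=
  if n is n'.+1 then 2^-1 * (1 + sqrt_bound n' ^+ 2) else 0.

Lemma sqrt_bound_le1 n : 0 <= sqrt_bound n <= 1.
Proof. by elim: n => [|n /andP[h0 h1]] /=; [lra|]; nra. Qed.

Lemma sqrt_bound_mono n : sqrt_bound n <= sqrt_bound n.+1.
Proof.
elim: n => [|n IH]; first by rewrite /= expr0n /=; lra.
have q0 k : 0 <= sqrt_bound k by have /andP[] := sqrt_bound_le1 k.
have bS k : sqrt_bound k.+1 = 2^-1 * (1 + sqrt_bound k ^+ 2) by [].
by rewrite (bS n.+1) {1}(bS n) ler_pM2l ?invr_gt0 // lerD2l ler_sqr ?nnegrE.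
Qed.

Lemma sqrt_iter_comm t z n : t ** z = z ** t -> sqrt_iter t n ** z = z ** sqrt_iter t n.
Proof.
move=> tz; elim: n => [|n IH] /=; first by rewrite cmul0l cmul0r.
by rewrite cmulZl cmulZr cmulDl cmulDr tz -cmulA IH cmulA IH cmulA.
Qed.

(** Factoring [a^2 - b^2] as [(a - b)(a + b)], for commuting [a] and [b], copies the scalar identity
    for [p^2 - q^2], so one step preserves the domination of the increments. *)
Lemma sqrt_iter_step t a b p q : a ** b = b ** a -> nm a <= p -> nm b <= q ->
  nm (a - b) <= p - q ->
  nm (rc 2^-1 *: (t + a ** a) - rc 2^-1 *: (t + b ** b)) <=
    2^-1 * (1 + p ^+ 2) - 2^-1 * (1 + q ^+ 2).
Proof.
move=> ab ap bq abpq; rewrite -scalerBr opprD addrACA subrr add0r.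
have -> : a ** a - b ** b = (a - b) ** (a + b).
  by rewrite cmulBl !cmulDr ab opprD addrA addrK.
rewrite nmZr ?invr_ge0 // -mulrBr opprD addrACA subrr add0r ler_pM2l ?invr_gt0 //.
rewrite subr_sqr; apply: le_trans (nmM _ _) _; apply: ler_pM; rewrite ?nm_ge0 //.
by apply: le_trans (nmD _ _) _; apply: lerD.
Qed.

Lemma sqrt_iter_bound t n : nm t <= 1 -> nm (sqrt_iter t n) <= sqrt_bound n /\
  nm (sqrt_iter t n.+1 - sqrt_iter t n) <= sqrt_bound n.+1 - sqrt_bound n.
Proof.
move=> t1; have hb k : nm (sqrt_iter t k) <= sqrt_bound k.
  elim: k => [|k IH] /=; first by rewrite nm0.
  rewrite nmZr ?invr_ge0 // ler_pM2l ?invr_gt0 //.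
  apply: le_trans (nmD _ _) _; apply: lerD => //; apply: le_trans (nmM _ _) _.
  by rewrite expr2 ler_pM ?nm_ge0.
split; first exact: hb.
elim: n => [|n IH]; first by rewrite !subr0 hb.
apply: (@sqrt_iter_step t (sqrt_iter t n.+1) (sqrt_iter t n)
  (sqrt_bound n.+1) (sqrt_bound n)) => //.
by apply: (sqrt_iter_comm n.+1); rewrite sqrt_iter_comm.
Qed.

Lemma sqrt_iter_dist t m n : nm t <= 1 -> (n <= m)%N ->
  nm (sqrt_iter t m - sqrt_iter t n) <= sqrt_bound m - sqrt_bound n.
Proof.
move=> t1; elim: m => [|m IH]; first by rewrite leqn0 => /eqP ->; rewrite !subrr nm0.
rewrite leq_eqVlt => /predU1P[->|]; first by rewrite !subrr nm0.
rewrite ltnS => /IH h; have [_ h'] := sqrt_iter_bound m t1.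
rewrite (le_trans (nm_tri (sqrt_iter t m) _ _)) //; lra.
Qed.

(** The increments are dominated by those of a bounded monotone scalar iteration, so the iterates
    are Cauchy. The fixed-point equation is the recursion in the limit; the other clauses hold for
    the iterates and are closed. *)
Lemma sqrt_series t : star t = t -> nm t <= 1 -> exists y, [/\ star y = y, nm y <= 1,
  y = rc 2^-1 *: (t + y ** y) & forall z, t ** z = z ** t -> y ** z = z ** y].
Proof.
move=> ts t1.
have [y hy] : exists y, tends \oo (sqrt_iter t) y.
  apply: complete_cauchy => e e0.
  have b1 n : sqrt_bound n <= 1 by have /andP[] := sqrt_bound_le1 n.
  have [N hN] := mono_cauchy sqrt_bound_mono b1 e0; exists N => m n Nm Nn.
  wlog mn : m n Nm Nn / (n <= m)%N.
    move=> h; case/orP: (leq_total n m) => mn; first exact: h.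
    by rewrite nmC h.
  by apply: le_lt_trans (sqrt_iter_dist t1 mn) _; apply: le_lt_trans (ler_norm _) (hN _ _ _ _).
have iS n : star (sqrt_iter t n) = sqrt_iter t n.
  by elim: n => [|n IH] /=; rewrite ?star0 // starZ conj_rc starD starM ts IH.
exists y; split.
- by apply: tends_uniq (tends_star hy) _; under eq_fun do rewrite iS.
- apply: tends_le hy; apply: nearW => n; have [h _] := sqrt_iter_bound n t1.
  by rewrite (le_trans h) //; have /andP[] := sqrt_bound_le1 n.
- have hS : tends \oo (fun n => sqrt_iter t n.+1) y.
    by move=> e /hy [N _ hN]; exists N => // n Nn; apply: hN; rewrite /= ltnW.
  by apply: tends_uniq hS _; apply: tendsZ; apply: tendsD (tends_cst _) (tends_cmul hy hy).
- move=> z tz; apply: tends_uniq (tends_cmul hy (tends_cst z)) _.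
  under eq_fun do rewrite (sqrt_iter_comm _ tz).
  exact: tends_cmul (tends_cst z) hy.
Qed.

(** With [y = (t + y^2)/2], the square of [1 - y] is [1 - t]. The bound on [cone - w] records that
    [w] is positive; the last clause lets [w] commute with [s] when [t = s ** s]. *)
Lemma cstar_sqrt t : star t = t -> nm t <= 1 -> exists w, [/\ star w = w,
  w ** w = cone - t, nm (cone - w) <= 1 & forall z, t ** z = z ** t -> w ** z = z ** w].
Proof.
move=> ts t1; have [y [ys y1 yE yc]] := sqrt_series ts t1; exists (cone - y).
have y2 : y + y = t + y ** y.
  rewrite {1 2}yE -scalerDl -rcD (_ : 2^-1 + 2^-1 = 1 :> R) ?scale1r //; lra.
split.
- by rewrite starB star1 ys.
- have yy : y ** y = y + y - t by rewrite y2 addrAC subrr add0r.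
  by rewrite cmulBl !cmulBr !cmul1l cmul1r opprB yy (addrAC (y + y)) addrK addrA subrK.
- by rewrite opprB addrCA subrr addr0.
- by move=> z /yc yz; rewrite cmulBl cmulBr yz cmul1l cmul1r.
Qed.

(* [w] is [sqrt (1 - s^2)] and [s + i w] is unitary, whence [nm w <= 1]. *)
Lemma sa_unitary s : star s = s -> nm s <= 1 -> exists w, [/\ star w = w,
  w ** w = cone - s ** s, s ** w = w ** s, nm w <= 1 &
  star (s + 'i%C *: w) ** (s + 'i%C *: w) = cone].
Proof.
move=> ss s1; have [] := @cstar_sqrt (s ** s).
- by rewrite starM ss.
- by rewrite nm_selfsq // expr_le1 // nm_ge0.
move=> w [ws ww _ wc]; have sw : s ** w = w ** s by rewrite wc // cmulA.
have iconj : ('i%C : C)^* = - 'i%C by apply: Cext => //=; rewrite oppr0.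
have vv : star (s + 'i%C *: w) ** (s + 'i%C *: w) = cone.
  rewrite starD starZ iconj ss ws cmulDl !cmulDr !cmulZl !cmulZr scalerA.
  rewrite (_ : - 'i%C * 'i%C = 1 :> C); last by rewrite mulNr -expr2 sqr_i opprK.
  by rewrite scale1r sw scaleNr addrA addrK ww addrC subrK.
exists w; split=> //.
have v1 : nm (s + 'i%C *: w) <= 1.
  by rewrite -(@expr_le1 _ 2) ?nm_ge0 // -nm_starM vv nm1.
have wE : w = ('i%C * rc 2^-1) *: (star (s + 'i%C *: w) - (s + 'i%C *: w)).
  rewrite starD starZ iconj ss ws opprD addrACA subrr add0r scaleNr -opprD -scalerDl.
  rewrite scalerN scalerA -scaleNr (_ : - _ = 1 :> C) ?scale1r //.
  by apply: Cext; rewrite /=; lra.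
rewrite wE nmZ cabsM cabsR ger0_norm ?invr_ge0 // (_ : cabs 'i%C = 1); last first.
  by apply/eqP; rewrite -(@eqrXn2 _ 2) ?cabs_ge0 // cabs_sqr /=; apply/eqP; ring.
rewrite mul1r mulrC ler_pdivrMr // mul1r (le_trans (nmB _ _)) // nm_star.
by rewrite -[2%:R]/(1 + 1) lerD.
Qed.

(** A homomorphism sends the unitary [v] to a unitary, of norm 1, so it is contractive on
    self-adjoint contractions: the start of [hom_nm]. *)
Lemma sa_unitaryP s : star s = s -> nm s <= 1 -> exists v,
  [/\ star v ** v = cone, v ** star v = cone & s = rc 2^-1 *: (v + star v)].
Proof.
move=> ss s1; have [w [ws ww sw _ vv]] := sa_unitary ss s1.
have iconj : ('i%C : C)^* = - 'i%C by apply: Cext => //=; rewrite oppr0.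
exists (s + 'i%C *: w); split=> //; rewrite starD starZ iconj ss ws scaleNr.
  rewrite cmulBr !cmulDl !cmulZr !cmulZl -sw opprD addrA.
  rewrite [X in X + _](_ : _ = s ** s); last by rewrite addrK.
  by rewrite scalerA -expr2 sqr_i scaleN1r opprK ww addrC subrK.
by rewrite addrACA subrr addr0 scalerDr -scalerDl -rcD
  (_ : rc _ = 1) ?scale1r //; apply: Cext => /=; lra.
Qed.
End CStar.

(** * Representations, characters and homomorphisms of C*-algebras *)

Section Contractions.
Variable R : realType.
Local Notation C := R[i].

Lemma unit_scale (A : normedModType C) (a : A) : a != 0 ->
  exists b : A, nm b = 1 /\ a = rc (nm a) *: b.
Proof.
move=> /nm_gt0 a0; exists (rc (nm a)^-1 *: a).
by rewrite nmZr ?invr_ge0 ?nm_ge0 // mulVf ?gt_eqF // scalerA -rcM mulfV ?gt_eqF // scale1r.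
Qed.

(* [r] is [sqrt (s^2)]. *)
Lemma sa_bounds (A : cstarAlgType R) (s : A) : star s = s -> nm s <= 1 ->
  exists r, [/\ star r = r, r ** r = s ** s, nm (cone - r) <= 1 & r ** s = s ** r].
Proof.
move=> ss s1; have [w [ws ww _ w1 _]] := sa_unitary ss s1.
have [] := @cstar_sqrt R A (cone - s ** s).
- by rewrite starB star1 starM ss.
- by rewrite -ww nm_selfsq // expr_le1 // nm_ge0.
move=> r [rs rr r1 rc]; exists r; split=> //.
  by rewrite rr opprB addrC subrK.
by apply: rc; rewrite cmulBl cmulBr cmul1l cmul1r cmulA.
Qed.

Section Rep.
Variables (A : cstarAlgType R) (H : hilbertType R) (pi : A -> H -> H).
Hypothesis hpi : representation pi.

Lemma rep_lin a : linear (pi a). Proof. by have [/(_ a I)[]] := hpi. Qed.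
Lemma rep_linA x : linear (fun a => pi a x).
Proof. by move=> c a b; have [_ h _ _ _] := hpi; rewrite h. Qed.
Lemma repM a b x : pi (a ** b) x = pi a (pi b x).
Proof. by have [_ _ h _ _] := hpi; apply: h. Qed.
Lemma rep1 x : pi cone x = x. Proof. by have [_ _ _ h _] := hpi. Qed.
Lemma rep_adj a x y : hdot (pi a x) y = hdot x (pi (star a) y).
Proof. by have [_ _ _ _ h] := hpi; apply: h. Qed.
Lemma rep_sqr a x : hdot (pi (star a ** a) x) x = rc (nm (pi a x) ^+ 2).
Proof. by rewrite repM rep_adj starK hdot_nm. Qed.

(** With a self-adjoint [w] such that [w ** w = cone - s ** s], the difference
    [nm x ^+ 2 - nm (pi s x) ^+ 2] equals [nm (pi w x) ^+ 2]. *)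
Lemma rep_nm_sa s x : star s = s -> nm s <= 1 -> nm (pi s x) <= nm x.
Proof.
move=> ss s1; have [w [ws ww _ _ _]] := sa_unitary ss s1.
rewrite -ler_sqr ?nnegrE ?nm_ge0 // -subr_ge0.
have := rep_sqr w x; rewrite ws ww (linB (rep_linA x)) rep1 hdotBl hdot_nm.
have := rep_sqr s x; rewrite ss => -> /(congr1 (@complex.Re _)) /=.
by move=> ->; rewrite sqr_ge0.
Qed.

(** After scaling to norm 1, [nm (pi b x) ^+ 2] is [hdot (pi (star b ** b) x) x], and [star b ** b]
    is a self-adjoint contraction. *)
Lemma rep_nm a x : nm (pi a x) <= nm a * nm x.
Proof.
have [->|a0] := eqVneq a 0.
  by rewrite (lin0 (rep_linA x)) !nm0 mul0r.
have [b [b1 ->]] := unit_scale a0.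
rewrite (linZ (rep_linA x)) !nmZr ?nm_ge0 // b1 mulr1 ler_wpM2l ?nm_ge0 //.
rewrite -ler_sqr ?nnegrE ?nm_ge0 //.
have := rep_sqr b x => /(congr1 (@complex.Re _)) /= <-.
apply: le_trans (Re_le _) _; apply: le_trans (hdot_CS _ _) _.
rewrite expr2 ler_wpM2r ?nm_ge0 //; apply: rep_nm_sa.
  by rewrite starM starK.
by rewrite nm_starM b1 expr1n.
Qed.

Lemma rep_pos r x : nm (cone - r) <= 1 -> 0 <= complex.Re (hdot (pi r x) x).
Proof.
move=> r1; rewrite (_ : r = cone - (cone - r)); last by rewrite opprB addrC subrK.
rewrite (linB (rep_linA x)) rep1 hdotBl ReB hdot_nm /= subr_ge0.
apply: le_trans (Re_le _) _; apply: le_trans (hdot_CS _ _) _.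
rewrite expr2 ler_wpM2r ?nm_ge0 //; apply: le_trans (rep_nm _ _) _.
by rewrite ler_piMl ?nm_ge0.
Qed.

Lemma tends_rep I (F : set_system I) {FF : ProperFilter F} a (u : I -> H) l :
  tends F u l -> tends F (fun i => pi a (u i)) (pi a l).
Proof.
apply: (tends_lip (k := nm a)) => x y.
by rewrite -(linB (rep_lin a)) rep_nm.
Qed.

End Rep.

Section Char.
Variables (A : cstarAlgType R) (chi : A -> C).
Hypothesis hchi : character chi.

Lemma char_lin : linear (chi : A -> C^o). Proof. by have [] := hchi. Qed.
Lemma charD a b : chi (a + b) = chi a + chi b. Proof. exact: (linD char_lin). Qed.
Lemma charB a b : chi (a - b) = chi a - chi b. Proof. exact: (linB char_lin). Qed.
Lemma charZ c a : chi (c *: a) = c * chi a. Proof. exact: (linZ char_lin). Qed.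
Lemma char0 : chi 0 = 0. Proof. exact: (lin0 char_lin). Qed.
Lemma charM a b : chi (a ** b) = chi a * chi b. Proof. by have [_ ->] := hchi. Qed.
Lemma char1 : chi cone = 1. Proof. by have [] := hchi. Qed.
Lemma char_star a : chi (star a) = (chi a)^*. Proof. by have [_ _ _ ->] := hchi. Qed.
Lemma char_sa s : star s = s -> chi s = rc (complex.Re (chi s)).
Proof.
move=> ss; apply: Cext => //=.
by have := congr1 (@complex.Im _) (char_star s); rewrite ss Imconj; lra.
Qed.

(** On a self-adjoint contraction [s], the real numbers [chi s] and [chi w] have squares adding up
    to 1; the general case follows through [star b ** b]. *)
Lemma char_nm a : cabs (chi a) <= nm a.
Proof.
have hs s : star s = s -> nm s <= 1 -> cabs (chi s) <= 1.
  move=> ss s1; have [w [ws ww _ _ _]] := sa_unitary ss s1.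
  rewrite (char_sa ss) cabsR -(@expr_le1 _ 2) // real_normK ?num_real //.
  have := charM w w; rewrite ww charB char1 charM (char_sa ss) (char_sa ws).
  move=> /(congr1 (@complex.Re _)); rewrite ReB !ReM /=.
  have := sqr_ge0 (complex.Re (chi w)); rewrite !expr2; lra.
have [->|a0] := eqVneq a 0; first by rewrite char0 cabs0 nm0.
have [b [b1 ->]] := unit_scale a0.
rewrite charZ cabsM cabsR ger0_norm ?nm_ge0 // nmZr ?nm_ge0 // ler_wpM2l ?nm_ge0 //.
rewrite b1 -(@expr_le1 _ 2) ?cabs_ge0 // expr2 -{1}cabs_conj -cabsM -char_star -charM.
by apply: hs; rewrite ?nm_starM ?b1 ?expr1n // starM starK.
Qed.

Lemma char_dist a b : cabs (chi a - chi b) <= nm (a - b).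
Proof. by rewrite -charB char_nm. Qed.

Lemma tends_char I (F : set_system I) {FF : ProperFilter F} (u : I -> A) l :
  tends F u l -> tends F (fun i => chi (u i) : C^o) (chi l).
Proof. by apply: (tends_lip (f := (chi : A -> C^o)) (k := 1)) => x y; rewrite mul1r char_dist. Qed.

Lemma char_pos r : star r = r -> nm (cone - r) <= 1 -> 0 <= complex.Re (chi r).
Proof.
move=> rs r1; have := le_trans (char_nm _) r1; rewrite charB char1.
by move=> /(le_trans (Re_le _)); rewrite ReB /=; lra.
Qed.
End Char.

Section Hom.
Variables (A B : cstarAlgType R) (f : A -> B).
Hypothesis hf : star_hom f.

Lemma hom_lin : linear f. Proof. by have [] := hf. Qed.
Lemma homM a b : f (a ** b) = f a ** f b. Proof. by have [_ ->] := hf. Qed.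
Lemma hom1 : f cone = cone. Proof. by have [] := hf. Qed.
Lemma hom_star a : f (star a) = star (f a). Proof. by have [_ _ _ ->] := hf. Qed.

Lemma hom_nm a : nm (f a) <= nm a.
Proof.
have hs s : star s = s -> nm s <= 1 -> nm (f s) <= 1.
  move=> ss s1; have [v [v1 _ ->]] := sa_unitaryP ss s1.
  have fv1 : nm (f v) <= 1.
    by rewrite -(@expr_le1 _ 2) ?nm_ge0 // -nm_starM -hom_star -homM v1 hom1 nm1.
  rewrite (linZ hom_lin) nmZr ?invr_ge0 // (linD hom_lin) hom_star.
  by have := nmD (f v) (star (f v)); rewrite nm_star; lra.
have [->|a0] := eqVneq a 0; first by rewrite (lin0 hom_lin) !nm0.
have [b [b1 ->]] := unit_scale a0.
rewrite (linZ hom_lin) !nmZr ?nm_ge0 // ler_wpM2l ?nm_ge0 // b1.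
rewrite -(@expr_le1 _ 2) ?nm_ge0 // -nm_starM -hom_star -homM.
by apply: hs; rewrite ?nm_starM ?b1 ?expr1n // starM starK.
Qed.

Lemma hom_dist a b : nm (f a - f b) <= nm (a - b).
Proof. by rewrite -(linB hom_lin) hom_nm. Qed.

Lemma char_comp (chi : B -> C) : character chi -> character (chi \o f).
Proof.
move=> hc; split=> [c a b|a b||a] /=.
- by rewrite hom_lin charD // charZ.
- by rewrite homM charM.
- by rewrite hom1 char1.
- by rewrite hom_star char_star.
Qed.

Lemma rep_comp (H : hilbertType R) (pi : B -> H -> H) :
  representation pi -> representation (fun a => pi (f a)).
Proof.
move=> hp; have [h1 h2 h3 h4 h5] := hp; split=> [a _|c a b _ _ x|a b _ _ x|x|a _ x y].
- exact: h1.
- by rewrite hom_lin h2.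
- by rewrite homM h3.
- by rewrite hom1 h4.
- by rewrite hom_star h5.
Qed.
End Hom.

Lemma iso_nm (A B : cstarAlgType R) (f : A -> B) a : star_hom f -> bijective f ->
  nm (f a) = nm a.
Proof.
move=> hf [g fK gK]; have hg : star_hom g.
  split=> [c x y|x y||x]; apply: (can_inj fK).
  - by rewrite (hom_lin hf) !gK.
  - by rewrite (homM hf) !gK.
  - by rewrite gK (hom1 hf).
  - by rewrite (hom_star hf) !gK.
by apply/eqP; rewrite eq_le hom_nm //= -{1}[a]fK hom_nm.
Qed.

(** * Characters as limits of vector states in faithful representations *)

Section ApproxEigen.
Variables (A : cstarAlgType R) (chi : A -> C) (H : hilbertType R) (pi : A -> H -> H).
Hypotheses (hchi : character chi) (hpi : faithful_rep pi).

Let def a := a - chi a *: cone.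

Lemma char_def a : chi (def a) = 0.
Proof. by rewrite charB // charZ // char1 // mulr1 subrr. Qed.

Lemma rep_def a x : pi (def a) x = pi a x - chi a *: x.
Proof. by have [hr _] := hpi; rewrite (linB (rep_linA hr x)) (linZ (rep_linA hr x)) rep1. Qed.

(* If the infimum were d > 0, the negative part of h - d/2 would be killed by [pi] but not
   by [chi]. *)
Lemma approx_eigen (s : seq A) (e : R) : 0 < e ->
  exists x, nm x = 1 /\ forall a, a \in s -> nm (pi a x - chi a *: x) < e.
Proof.
move=> e0; apply: contrapT => hN; have [hr inj] := hpi.
pose h := \sum_(a <- s) star (def a) ** def a.
have hs : star h = h.
  rewrite /h; elim: (s) => [|a l IH]; first by rewrite big_nil star0.
  by rewrite big_cons starD IH starM starK.
have h0 : chi h = 0.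
  rewrite /h; elim: (s) => [|a l IH]; first by rewrite big_nil char0.
  by rewrite big_cons charD // IH charM // char_def mulr0 addr0.
have hdoth x : hdot (pi h x) x = rc (\sum_(a <- s) nm (pi a x - chi a *: x) ^+ 2).
  rewrite /h; elim: (s) => [|a l IH].
    by rewrite !big_nil (lin0 (rep_linA hr x)) hdot0l.
  rewrite !big_cons (linD (rep_linA hr x)) hdotDl IH rcD; congr (_ + _).
  by rewrite rep_sqr // rep_def.
have low x : e ^+ 2 * nm x ^+ 2 <= complex.Re (hdot (pi h x) x).
  have [->|x0] := eqVneq x 0.
    by rewrite nm0 expr0n mulr0 hdot0r.
  have [y [y1 xE]] := unit_scale x0.
  have : e ^+ 2 <= complex.Re (hdot (pi h y) y).
    have [[a [asx ha]]|hN'] := pselect (exists a, a \in s /\ e <= nm (pi a y - chi a *: y)).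
      rewrite hdoth /= (big_rem a) //=; apply: ler_wpDr.
        by rewrite sumr_ge0 // => b _; rewrite sqr_ge0.
      by rewrite ler_sqr ?nnegrE ?nm_ge0 // ltW.
    exfalso; apply: hN; exists y; split=> // a asx; rewrite ltNge; apply/negP => ha.
    by apply: hN'; exists a.
  move=> hy; rewrite [in leRHS]xE (linZ (rep_lin hr h)) hdotZl hdotZr conj_rc !Re_rc.
  by rewrite [leRHS]mulrA -expr2 mulrC; apply: ler_wpM2l; rewrite ?sqr_ge0.
(* Half of the lower bound [e ^+ 2], so that [k] is at least [d] in the representation while
   [chi k = - d]. *)
pose d : R := e ^+ 2 / 2.
have d0 : 0 < d by rewrite divr_gt0 // exprn_gt0.
pose k := h - rc d *: cone.
have chik : chi k = rc (- d) by rewrite charB // charZ // char1 // mulr1 h0 sub0r rcN.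
have ks : star k = k by rewrite starB hs starZ conj_rc star1.
have k0 : k != 0.
  apply/eqP => k0; move: chik; rewrite k0 char0 // => /(congr1 (@complex.Re _)) /=; lra.
have nk := nm_gt0 k0; have [b [b1 kb]] := unit_scale k0.
have bE : b = rc (nm k)^-1 *: k by rewrite {2}kb scalerA -rcM mulVf ?gt_eqF // scale1r.
have bs : star b = b by rewrite bE starZ conj_rc ks.
have b1' : nm b <= 1 by rewrite b1.
have [r [rs rr r1 rb]] := sa_bounds bs b1'.
have [p p0 pE] : exists2 p, 0 < p & p = (nm k)^-1 * d.
  by exists ((nm k)^-1 * d) => //; rewrite mulr_gt0 ?invr_gt0.
have bpos x : p * nm x ^+ 2 <= complex.Re (hdot (pi b x) x).
  rewrite bE (linZ (rep_linA hr x)) hdotZl Re_rc pE -mulrA ler_pM2l ?invr_gt0 //.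
  rewrite (linB (rep_linA hr x)) (linZ (rep_linA hr x)) rep1 // hdotBl hdotZl ReB Re_rc.
  by have := low x; rewrite hdot_nm /= /d; lra.
(* [r] is the absolute value of [b], and [r - b] twice its negative part. The product of [r + b] and
   [r - b] is 0 while [pi (r + b)] is bounded below by [p], so [pi] kills [r - b] and faithfulness
   gives [r = b]. *)
have z0 : r - b = 0.
  apply: inj; apply/funext => x; rewrite (lin0 (rep_linA hr x)).
  set y := pi (r - b) x; apply/nm_eq0/eqP; rewrite -sqrf_eq0; apply/eqP.
  have : pi (r + b) y = 0.
    by rewrite -repM // cmulDl !cmulBr rr rb addrA subrK subrr (lin0 (rep_linA hr x)).
  move=> /(congr1 (fun z => complex.Re (hdot z y))).
  rewrite hdot0l (linD (rep_linA hr y)) hdotDl ReD /=.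
  have := rep_pos hr y r1; have := bpos y; have := sqr_ge0 (nm y).
  move=> n0 hb hr0 hsum.
  by apply/eqP; rewrite eq_le n0 andbT -(pmulr_rle0 _ p0); lra.
have := char_pos hchi rs r1; rewrite (subr0_eq z0) bE charZ // chik -rcM /=.
by rewrite mulrN -pE; lra.
Qed.

(** Finite lists in [A] with a tolerance index a filter base, so a single filter serves all elements
    of an arbitrary [A] at once. *)
Lemma eigen_filter : exists F : set_system H, [/\ ProperFilter F,
  F [set x | nm x = 1] & forall a, tends F (fun x => pi a x - chi a *: x) 0].
Proof.
pose D := [set i : seq A * R | 0 < i.2].
pose B (i : seq A * R) :=
  [set x : H | nm x = 1 /\ forall a, a \in i.1 -> nm (pi a x - chi a *: x) < i.2].
have FB : ProperFilter (filter_from D B).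
  apply: filter_from_proper; last first.
    by move=> [s e] /= e0; have [x hx] := approx_eigen s e0; exists x.
  apply: filter_from_filter; first by exists ([::], 1); rewrite /D /=.
  move=> [s e] [t f] /= e0 f0; exists (s ++ t, Num.min e f).
    by rewrite /D /= lt_min e0 f0.
  move=> x [/= x1 hx]; split; split=> // a /= ha.
    by have := hx a; rewrite mem_cat ha lt_min => /(_ isT) /andP[].
  by have := hx a; rewrite mem_cat ha orbT lt_min => /(_ isT) /andP[].
exists (filter_from D B); split=> //.
  by exists ([::], 1) => [|x []//]; rewrite /D /=.
move=> a e e0; exists ([:: a], e) => // x [_ /= hx].
by rewrite subr0; apply: hx; rewrite mem_seq1.
Qed.

End ApproxEigen.
End Contractions.

Section Dense.
Variable R : realType.
Local Notation C := R[i].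

Lemma dense_nm (V : normedModType C) (S : set V) : dense S ->
  forall x (e : R), 0 < e -> exists y, S y /\ nm (x - y) < e.
Proof.
move=> dS x e e0; have e0' : 0 < rc e by rewrite lt_rc.
have [] := dS (ball x (rc e)).
- by exists x; apply: ballxx.
- exact: ball_open.
move=> y [xy Sy]; exists y; split=> //.
by move: xy; rewrite -ball_normE /= nmE lt_rc.
Qed.

Lemma dense_seq (V : normedModType C) (S : set V) : dense S ->
  forall x, exists u : nat -> V, (forall n, S (u n)) /\ tends \oo u x.
Proof.
move=> dS x.
have h n : exists y, S y /\ nm (x - y) < n.+1%:R^-1.
  by apply: dense_nm; rewrite ?invr_gt0.
have [u hu] := choice h; exists u; split=> [n|e e0]; first by have [] := hu n.
have [N _ hN] := @near_infty_natSinv_lt R (PosNum e0).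
exists N => // n Nn; rewrite nmC; have [_ h1] := hu n.
exact: lt_trans h1 (hN n Nn).
Qed.

Lemma lip_ext (V W : normedModType C) (S : set V) (f g : V -> W) (kf kg : R) :
  dense S -> (forall x y, nm (f x - f y) <= kf * nm (x - y)) ->
  (forall x y, nm (g x - g y) <= kg * nm (x - y)) ->
  (forall x, S x -> f x = g x) -> forall x, f x = g x.
Proof.
move=> dS hf hg fg x; have [u [uS ux]] := dense_seq dS x.
apply: (tends_uniq (tends_lip hf ux)).
have -> : f \o u = g \o u by apply/funext => n /=; apply: fg.
exact: tends_lip hg ux.
Qed.

Lemma lin_ext (V W : normedModType C) (S : set V) (f g : V -> W) (kf kg : R) :
  dense (linear_span S) -> linear f -> linear g ->
  (forall x, nm (f x) <= kf * nm x) -> (forall x, nm (g x) <= kg * nm x) ->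
  (forall x, S x -> f x = g x) -> forall x, f x = g x.
Proof.
move=> dS fl gl hf hg fg; apply: (lip_ext (kf := kf) (kg := kg) dS).
- by move=> x y; rewrite -(linB fl).
- by move=> x y; rewrite -(linB gl).
- move=> _ [n [c [v [Sv ->]]]]; rewrite (lin_sum fl) (lin_sum gl).
  by apply: eq_bigr => i _; rewrite fg.
Qed.

Lemma char_ext (A : cstarAlgType R) (S : set A) (chi mu : A -> C) :
  dense (linear_span S) -> character chi -> character mu ->
  (forall x, S x -> chi x = mu x) -> chi = mu.
Proof.
move=> dS hc hm h; apply/funext.
apply: (@lin_ext A C^o S chi mu 1 1 dS (char_lin hc) (char_lin hm)) => // x;
  rewrite mul1r; exact: char_nm.
Qed.

Lemma dot0_dense (H : hilbertType R) (S : set H) (v : H) :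
  dense (linear_span S) -> (forall x, S x -> hdot x v = 0) -> v = 0.
Proof.
move=> dS h.
have : forall x, hdot x v = 0.
  apply: (@lin_ext H C^o S (fun x => hdot x v) (fun=> 0) (nm v) 0 dS).
  - by move=> c x y; rewrite hdotDl hdotZl.
  - by move=> c x y; rewrite scaler0 addr0.
  - by move=> x; rewrite mulrC; exact: hdot_CS.
  - by move=> x; rewrite nm0 mul0r.
  - exact: h.
by move=> /(_ v); rewrite hdot_nm => /(@rcI R _ 0)/eqP; rewrite sqrf_eq0 => /eqP/nm_eq0.
Qed.

(** * Characters from approximate eigenvectors *)

Section ApproxChar.
Variables (T : cstarAlgType R) (L : hilbertType R) (sg : T -> L -> L).
Hypothesis hsg : representation sg.
Variables (I : Type) (F : set_system I) (FF : ProperFilter F) (zeta : I -> L).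
Hypothesis zeta1 : \forall i \near F, nm (zeta i) = 1.

Definition eigen z (l : C) := tends F (fun i => sg z (zeta i) - l *: zeta i) 0.

Lemma eigen_norm z l : eigen z l -> cabs l <= nm z.
Proof.
move=> h; apply/ler_addgt0Pr => e e0.
have [i [i1 h1]] := near_ex2 FF zeta1 (h _ e0).
have : nm (l *: zeta i) = cabs l by rewrite nmZ i1 mulr1.
have := rep_nm hsg z (zeta i); rewrite i1 mulr1.
move: h1; rewrite subr0 nmC; have := nm_subl (l *: zeta i) (sg z (zeta i)); lra.
Qed.

Lemma eigen_lin c z z' l l' : eigen z l -> eigen z' l' -> eigen (c *: z + z') (c * l + l').
Proof.
move=> h h'; pose proof (tendsD (tendsZ c h) h') as hh.
rewrite scaler0 addr0 in hh; apply: (tends_eq hh) => i.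
rewrite (rep_linA hsg (zeta i)) scalerDl opprD addrACA -scalerA scalerBr //.
Qed.

Lemma eigen_sub z z' l l' : eigen z l -> eigen z' l' -> eigen (z - z') (l - l').
Proof.
move=> h h'; have := eigen_lin (-1) h' h.
by rewrite scaleN1r mulN1r addrC [- l' + l]addrC.
Qed.

Lemma eigen_uniq z l l' : eigen z l -> eigen z l' -> l = l'.
Proof.
move=> h h'; have := eigen_norm (eigen_sub h h'); rewrite subrr nm0 => h0.
by apply/eqP; rewrite -subr_eq0; apply/eqP/cabs0_eq0/eqP; rewrite eq_le h0 cabs_ge0.
Qed.

Lemma eigen1 : eigen cone 1.
Proof.
apply: (tends_eq (tends_cst 0)) => i.
by rewrite rep1 // scale1r subrr.
Qed.

Lemma eigenM z z' l l' : eigen z l -> eigen z' l' -> eigen (z ** z') (l * l').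
Proof.
move=> h h'; pose proof (tendsD (tends_rep hsg z h') (tendsZ l' h)) as hh.
rewrite scaler0 addr0 (lin0 (rep_lin hsg z)) in hh; apply: (tends_eq hh) => i.
rewrite (linB (rep_lin hsg z)) (linZ (rep_lin hsg z)) repM // scalerBr scalerA.
by rewrite (mulrC l') addrA subrK.
Qed.

Lemma eigen_dot z l : eigen z l ->
  tends F (fun i => hdot (sg z (zeta i)) (zeta i) : C^o) l.
Proof.
move=> h e e0; apply: filterS2 zeta1 (h _ e0) => i i1; rewrite subr0.
apply: le_lt_trans.
have -> : hdot (sg z (zeta i)) (zeta i) - l = hdot (sg z (zeta i) - l *: zeta i) (zeta i).
  by rewrite hdotBl hdotZl hdot_nm i1 expr1n mulr1.
by apply: le_trans (hdot_CS _ _) _; rewrite i1 mulr1.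
Qed.

Lemma eigen_star z l m : eigen z l -> eigen (star z) m -> m = l^*.
Proof.
move=> /eigen_dot h /eigen_dot h'; apply: (tends_uniq h').
have hc : tends F (fun i => (hdot (sg z (zeta i)) (zeta i))^* : C^o) l^*.
  move=> e /h; apply: filterS => i; rewrite -[X in X -> _]/(is_true (cabs _ < e)).
  by rewrite -[X in _ -> X]/(is_true (cabs _ < e)) -rmorphB cabs_conj.
apply: (tends_eq hc) => i.
by rewrite rep_adj // -hdotC.
Qed.

Lemma eigen_span S : (forall z, S z -> exists l, eigen z l) ->
  forall z, linear_span S z -> exists l, eigen z l.
Proof.
move=> hS _ [n [c [v [Sv ->]]]].
apply: (big_ind (fun z => exists l, eigen z l)).
- exists 0; apply: (tends_eq (tends_cst 0)) => i.
  by rewrite (lin0 (rep_linA hsg _)) scale0r subrr.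
- move=> x y [l hl] [m hm]; exists (1 * l + m); rewrite -(scale1r x); exact: eigen_lin.
- move=> i _; have [l hl] := hS _ (Sv i); exists (c i * l + 0 * l).
  have := eigen_lin (c i) hl (eigen_sub hl hl).
  by rewrite !subrr mul0r addr0.
Qed.

(** Approximate eigenvalues are 1-Lipschitz in the operator by [eigen_norm], so those of the [u n]
    form a Cauchy sequence. *)
Lemma eigen_closed (u : nat -> T) z : (forall n, exists l, eigen (u n) l) ->
  tends \oo u z -> exists l, eigen z l.
Proof.
move=> hu uz; have [l hl] := choice hu.
have [m hm] : exists m, tends \oo (l : nat -> C^o) m.
  apply: complex_cauchy => e e0; have e2 : 0 < e / 2 by rewrite divr_gt0.
  have [N _ hN] := uz _ e2; exists N => p q Np Nq.
  apply: le_lt_trans (eigen_norm (eigen_sub (hl p) (hl q))) _.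
  rewrite (le_lt_trans (nm_tri z _ _)) // [X in _ < X](splitr e) ltrD //; first exact: hN.
  by rewrite nmC; apply: hN.
exists m => e e0; have e3 : 0 < e / 3 by rewrite divr_gt0.
have [n [h1 h2]] := near_ex2 _ (uz _ e3) (hm _ e3).
apply: filterS2 zeta1 (hl n _ e3) => i i1; rewrite !subr0 => h3.
have -> : sg z (zeta i) - m *: zeta i = sg (z - u n) (zeta i) +
   (sg (u n) (zeta i) - l n *: zeta i) + (l n - m) *: zeta i.
  by rewrite (linB (rep_linA hsg (zeta i))) scalerBl !addrA !subrK.
have := nmD (sg (z - u n) (zeta i) + (sg (u n) (zeta i) - l n *: zeta i)) ((l n - m) *: zeta i).
have := nmD (sg (z - u n) (zeta i)) (sg (u n) (zeta i) - l n *: zeta i).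
have := rep_nm hsg (z - u n) (zeta i); rewrite nmZ i1 !mulr1 nmC.
have : cabs (l n - m) < e / 3 by [].
lra.
Qed.

(** The elements with an approximate eigenvalue along [F] form a closed subspace, hence all of [T]
    once it contains a total set; sums, products and adjoints then pass to the eigenvalues. *)
Lemma approx_character S : dense (linear_span S) ->
  (forall z, S z -> exists l, eigen z l) ->
  exists om, character om /\ forall z, eigen z (om z).
Proof.
move=> dS hS.
have hall z : exists l, eigen z l.
  have [u [uS uz]] := dense_seq dS z; apply: eigen_closed uz => n.
  exact: eigen_span (uS n).
have [om hom] := choice hall; exists om; split=> //; split.
- by move=> c a b; apply: eigen_uniq (hom _) _; exact: eigen_lin.
- by move=> a b; apply: eigen_uniq (hom _) _; exact: eigenM.
- by apply: eigen_uniq (hom _) eigen1.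
- by move=> a; apply: eigen_star (hom _) (hom _).
Qed.

End ApproxChar.
End Dense.

(** * Characters of minimal tensor products *)

Section TensorData.
Variable R : realType.
Local Notation C := R[i].
Variables (A B T : cstarAlgType R) (t : A -> B -> T).
Variables (H K L : hilbertType R) (tH : H -> K -> L).
Variables (pi : A -> H -> H) (rho : B -> K -> K) (sg : T -> L -> L).
Hypotheses (htH : hilbert_tensor tH) (hpi : faithful_rep pi) (hrho : faithful_rep rho).
Hypotheses (hsg : faithful_rep sg).
Hypothesis hst : forall a b x y, sg (t a b) (tH x y) = tH (pi a x) (rho b y).

Let rpi := proj1 hpi.
Let rrho := proj1 hrho.
Let rsg := proj1 hsg.

Let tHl y : linear (fun x => tH x y). Proof. by have [h _ _ _] := htH; apply: h. Qed.
Let tHr x : linear (tH x). Proof. by have [_ h _ _] := htH; apply: h. Qed.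
Let tHdot x y x' y' : hdot (tH x y) (tH x' y') = hdot x x' * hdot y y'.
Proof. by have [_ _ h _] := htH. Qed.
Let tHdense : dense (linear_span [set z | exists x y, z = tH x y]).
Proof. by have [_ _ _ h] := htH. Qed.

Lemma hilbert_tensor_nm x y : nm (tH x y) = nm x * nm y.
Proof.
apply/eqP; rewrite -(@eqrXn2 _ 2) ?mulr_ge0 ?nm_ge0 // exprMn; apply/eqP/rcI.
by rewrite (rcM (nm x ^+ 2)) -!hdot_nm tHdot.
Qed.

(** [sg] is faithful and elementary tensors are total in [L]; the algebraic rules for [t] are then
    checked in [H] and [K]. *)
Lemma min_tensor_ext z z' : (forall x y, sg z (tH x y) = sg z' (tH x y)) -> z = z'.
Proof.
move=> h; have [_ inj] := hsg; apply: inj; apply/funext.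
apply: (lin_ext (kf := nm z) (kg := nm z') tHdense (rep_lin rsg z) (rep_lin rsg z')).
- exact: rep_nm.
- exact: rep_nm.
- by move=> _ [x [y ->]].
Qed.

Lemma min_tensor_linl b : linear (fun a => t a b).
Proof.
move=> c a a'; apply: min_tensor_ext => x y.
rewrite (rep_linA rsg) !hst (rep_linA rpi).
by rewrite (tHl (rho b y)).
Qed.

Lemma min_tensorM a b a' b' : t a b ** t a' b' = t (a ** a') (b ** b').
Proof. by apply: min_tensor_ext => x y; rewrite repM // !hst !repM. Qed.

Lemma min_tensor1 : t cone cone = cone.
Proof. by apply: min_tensor_ext => x y; rewrite hst !rep1. Qed.

Lemma min_tensor_star a b : star (t a b) = t (star a) (star b).
Proof.
apply: min_tensor_ext => x y; rewrite hst; apply/eqP; rewrite -subr_eq0; apply/eqP.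
apply: (dot0_dense tHdense) => _ [x' [y' ->]].
rewrite hdotBr -rep_adj // hst !tHdot.
by rewrite (rep_adj rpi) (rep_adj rrho) subrr.
Qed.

(** A product functional has to be bounded for the spatial norm. Tensors of approximate eigenvectors
    for [chi] and [mu] are approximate eigenvectors for all [t a b] along the product filter, and
    [approx_character] extends the eigenvalues to [T]. *)
Lemma min_tensor_char (dT : dense (linear_span [set z | exists a b, z = t a b]))
    (chi : A -> C) (mu : B -> C) : character chi -> character mu ->
  exists om : T -> C, character om /\ forall a b, om (t a b) = chi a * mu b.
Proof.
move=> hc hm.
have [F [FF F1 Fchi]] := eigen_filter hc hpi.
have [G [GF G1 Gmu]] := eigen_filter hm hrho.
pose zeta (p : H * K) := tH p.1 p.2.
have FGF : ProperFilter (filter_prod F G) by exact: filter_prod_proper.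
have hF : (fun p : H * K => p.1) @ filter_prod F G --> F by exact: cvg_fst.
have hG : (fun p : H * K => p.2) @ filter_prod F G --> G by exact: cvg_snd.
have F1' : \forall p \near filter_prod F G, nm p.1 = 1 := hF _ F1.
have G1' : \forall p \near filter_prod F G, nm p.2 = 1 := hG _ G1.
have z1 : \forall p \near filter_prod F G, nm (zeta p) = 1.
  by apply: filterS2 F1' G1' => p h1 h2; rewrite hilbert_tensor_nm h1 h2 mulr1.
have key a b : eigen sg (filter_prod F G) zeta (t a b) (chi a * mu b).
  have h1 := tends_comp hF (Fchi a); have h2 := tends_comp hG (Gmu b).
  have h3 : tends (filter_prod F G)
     (fun p => tH (pi a p.1 - chi a *: p.1) (rho b p.2)) 0.
    apply: (tends_squeeze (k := nm b)) h1; apply: filterS G1' => p p1.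
    rewrite hilbert_tensor_nm mulrC; apply: ler_wpM2r; rewrite ?nm_ge0 //.
    by have := rep_nm rrho b p.2; rewrite p1 mulr1.
  have h4 : tends (filter_prod F G)
     (fun p => tH p.1 (rho b p.2 - mu b *: p.2)) 0.
    apply: (tends_squeeze (k := 1)) h2; apply: filterS F1' => p p1.
    by rewrite hilbert_tensor_nm p1.
  (* The two summands add up to the defect of [tH x y] at the eigenvalue [chi a * mu b]: replace the
     first factor, then the second. *)
  have h5 : tends (filter_prod F G) (fun p => tH (pi a p.1 - chi a *: p.1) (rho b p.2) +
     chi a *: tH p.1 (rho b p.2 - mu b *: p.2)) 0.
    by rewrite -(addr0 0) -[X in _ + X](scaler0 _ (chi a)); apply: tendsD h3 (tendsZ _ h4).
  apply: (tends_eq h5) => -[x y] /=.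
  rewrite hst (linB (tHl _)) (linB (tHr _)) (linZ (tHl _)) (linZ (tHr _)).
  by rewrite scalerBr scalerA addrA subrK.
have keyS z : [set z | exists a b, z = t a b] z ->
    exists l, eigen sg (filter_prod F G) zeta z l.
  by move=> [a [b ->]]; exists (chi a * mu b).
have [om [hom homE]] := approx_character rsg FGF z1 dT keyS.
exists om; split=> // a b.
exact: (@eigen_uniq R T L sg rsg _ _ FGF zeta z1 (t a b) _ _ (homE _) (key a b)).
Qed.

End TensorData.

Section MinTensor.
Variable R : realType.
Local Notation C := R[i].
Variables (A B : cstarAlgType R) (T : min_tensor A B).

Lemma tens_linl b : linear (fun a => tens T a b).
Proof.
have [_ [H [K [L [tH [pi [rho [sg [h1 h2 h3 h4 h5]]]]]]]]] := tensP T.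
exact: (min_tensor_linl h1 h2 h4 h5).
Qed.
Lemma tensM a b a' b' : tens T a b ** tens T a' b' = tens T (a ** a') (b ** b').
Proof.
have [_ [H [K [L [tH [pi [rho [sg [h1 h2 h3 h4 h5]]]]]]]]] := tensP T.
exact: (min_tensorM h1 h2 h3 h4 h5).
Qed.
Lemma tens1 : tens T cone cone = cone.
Proof.
have [_ [H [K [L [tH [pi [rho [sg [h1 h2 h3 h4 h5]]]]]]]]] := tensP T.
exact: (min_tensor1 h1 h2 h3 h4 h5).
Qed.
Lemma tens_star a b : star (tens T a b) = tens T (star a) (star b).
Proof.
have [_ [H [K [L [tH [pi [rho [sg [h1 h2 h3 h4 h5]]]]]]]]] := tensP T.
exact: (min_tensor_star h1 h2 h3 h4 h5).
Qed.
Lemma tens_dense : dense (linear_span [set z | exists a b, z = tens T a b]).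
Proof. by have [h _] := tensP T. Qed.

Lemma tens_char_ex (chi : A -> C) (mu : B -> C) : character chi -> character mu ->
  exists om : T -> C, character om /\ forall a b, om (tens T a b) = chi a * mu b.
Proof.
have [d [H [K [L [tH [pi [rho [sg [h1 h2 h3 h4 h5]]]]]]]]] := tensP T.
exact: (min_tensor_char h1 h2 h3 h4 h5 d).
Qed.

Lemma tens_homl : star_hom (fun a => tens T a cone).
Proof.
split=> [c x y|x y||x]; first by rewrite (tens_linl cone).
- by rewrite tensM cmul1l.
- exact: tens1.
- by rewrite tens_star star1.
Qed.

Lemma tens_char_uniq (om om' : T -> C) : character om -> character om' ->
  (forall a b, om (tens T a b) = om' (tens T a b)) -> om = om'.
Proof. by move=> h h' e; apply: (char_ext tens_dense h h') => _ [a [b ->]]. Qed.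

(** Each [tens T a b] is the product of its two legs. In [cprodA] the first leg is itself a tensor
    product, on which the restriction is identified separately. *)
Lemma tens_char_uniqlr (om om' : T -> C) : character om -> character om' ->
  (forall a, om (tens T a cone) = om' (tens T a cone)) ->
  (forall b, om (tens T cone b) = om' (tens T cone b)) -> om = om'.
Proof.
move=> h h' el er; apply: tens_char_uniq => // a b.
by rewrite -(cmul1r a) -(cmul1l b) -tensM !charM // el er.
Qed.
End MinTensor.

(** Total, with the junk value 0 when no product character exists, so that products of characters
    are written without carrying proofs. *)
Definition tens_char (R : realType) (A B : cstarAlgType R) (T : min_tensor A B)
    (chi : A -> R[i]) (mu : B -> R[i]) : T -> R[i] :=
  if pselect (exists om : T -> R[i], character om /\
    forall a b, om (tens T a b) = chi a * mu b) is left h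
  then projT1 (cid h) else fun=> 0.
Arguments tens_char {R A B} T chi mu.

Section CharTensor.
Variable R : realType.
Local Notation C := R[i].
Variables (A B : cstarAlgType R) (T : min_tensor A B).

Section One.
Variables (chi : A -> C) (mu : B -> C).
Hypotheses (hc : character chi) (hm : character mu).

Let P : character (tens_char T chi mu) /\
  forall a b, tens_char T chi mu (tens T a b) = chi a * mu b.
Proof.
rewrite /tens_char; case: pselect => [h|[]]; last exact: tens_char_ex.
by case: cid.
Qed.

Lemma tens_char_char : character (tens_char T chi mu). Proof. by have [] := P. Qed.
Lemma tens_charE a b : tens_char T chi mu (tens T a b) = chi a * mu b.
Proof. by have [_] := P. Qed.
Lemma tens_char_eq om : character om ->
  (forall a b, om (tens T a b) = chi a * mu b) -> om = tens_char T chi mu.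
Proof.
move=> h hE; apply: tens_char_uniq => //; first exact: tens_char_char.
by move=> a b; rewrite hE tens_charE.
Qed.
End One.
End CharTensor.
Arguments tens_char_char {R A B} T {chi mu}.
Arguments tens_char_ex {R A B} T {chi mu}.
Arguments tens_dense {R A B} T.

(** * The group of characters *)

Section Limits.
Variable R : realType.
Local Notation C := R[i].

Lemma tends_lin_comb I (F : set_system I) {FF : ProperFilter F} (W : normedModType C) n
    (c : 'I_n -> C) (v : 'I_n -> I -> W) (l : 'I_n -> W) :
  (forall j, tends F (v j) (l j)) ->
  tends F (fun i => \sum_(j < n) c j *: v j i) (\sum_(j < n) c j *: l j).
Proof.
elim: n c v l => [|n IH] c v l h.
  by rewrite big_ord0; under eq_fun do rewrite big_ord0; exact: tends_cst.
rewrite big_ord_recl; under eq_fun do rewrite big_ord_recl.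
by apply: tendsD; [exact: tendsZ|apply: IH].
Qed.

(** Uniform boundedness by [k] lets an [e / 3] argument pass from the total set to its closed span;
    [|k| + 1] keeps the divisor positive. *)
Lemma tends_dense_lin I (F : set_system I) (FF : ProperFilter F) (V W : normedModType C)
    (S : set V) (f : I -> V -> W) (g : V -> W) (k : R) :
  dense (linear_span S) -> (forall i, linear (f i)) -> linear g ->
  (forall i x, nm (f i x) <= k * nm x) -> (forall x, nm (g x) <= k * nm x) ->
  (forall x, S x -> tends F (fun i => f i x) (g x)) ->
  forall x, tends F (fun i => f i x) (g x).
Proof.
move=> dS fl gl fk gk hS x e e0.
pose k1 := `|k| + 1; have k0 : 0 < k1 by rewrite ltr_pwDr.
have kk (y : V) : k * nm y <= k1 * nm y.
  by rewrite ler_wpM2r ?nm_ge0 // /k1; have := ler_norm k; lra.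
have e3 : 0 < e / 3 by rewrite divr_gt0.
have [y [Sy xy]] := dense_nm dS x (divr_gt0 e3 k0).
have hy : tends F (fun i => f i y) (g y).
  have [n [c [v [Sv ->]]]] := Sy; rewrite (lin_sum gl).
  under eq_fun do rewrite (lin_sum (fl _)).
  by apply: tends_lin_comb => j; apply: hS.
apply: filterS (hy _ e3) => i hi.
have h1 : nm (f i x - f i y) < e / 3.
  rewrite -(linB (fl i)); apply: le_lt_trans (fk _ _) _; apply: le_lt_trans (kk _) _.
  by rewrite mulrC -ltr_pdivlMr.
have h2 : nm (g y - g x) < e / 3.
  rewrite -(linB gl); apply: le_lt_trans (gk _) _; apply: le_lt_trans (kk _) _.
  by rewrite mulrC -ltr_pdivlMr // nmC.
have := nm_tri (f i y) (f i x) (g x); have := nm_tri (g y) (f i y) (g x); lra.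
Qed.
End Limits.

Section Ultra.
Variable R : realType.
Local Notation C := R[i].

Lemma tends_mulC I (F : set_system I) {FF : ProperFilter F} (u v : I -> C^o) (l m : C) :
  tends F u l -> tends F v m -> tends F (fun i => u i * v i : C^o) (l * m).
Proof.
apply: (@tends_bilin _ _ _ _ C^o C^o C^o (fun x y : C => x * y)) => [x x' y|x y y'|x y].
- by rewrite mulrBl.
- by rewrite mulrBr.
- by rewrite -[nm _]/(cabs (x * y)) cabsM.
Qed.

Lemma tends_conjC I (F : set_system I) {FF : ProperFilter F} (u : I -> C^o) (l : C) :
  tends F u l -> tends F (fun i => (u i)^* : C^o) l^*.
Proof.
move=> h e /h; apply: filterS => i; rewrite -[X in X -> _]/(is_true (cabs _ < e)).
by rewrite -[X in _ -> X]/(is_true (cabs _ < e)) -rmorphB cabs_conj.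
Qed.

Lemma ultra_functional I (U : set_system I) (UU : UltraFilter U) (V : normedModType C)
    (f : I -> V -> C) : (forall i a, cabs (f i a) <= nm a) ->
  exists g : V -> C, forall a, tends U (fun i => f i a : C^o) (g a).
Proof.
move=> h; have ex a : exists l : C, tends U (fun i => f i a : C^o) l.
  exact: (ultra_bounded UU (fun i => h i a)).
by have [g hg] := choice ex; exists g.
Qed.

Lemma char_limit I (F : set_system I) (FF : ProperFilter F) (A : cstarAlgType R)
    (f : I -> A -> C) (g : A -> C) : (forall i, character (f i)) ->
  (forall a, tends F (fun i => f i a : C^o) (g a)) -> character g.
Proof.
move=> hf hg; split=> [c a b|a b||a].
- apply: tends_uniq (hg _) _.
  by apply: (tends_eq (tendsD (tendsZ c (hg a)) (hg b))) => i; rewrite charD // charZ.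
- by apply: tends_uniq (hg _) _; apply: (tends_eq (tends_mulC (hg a) (hg b))) => i; rewrite charM.
- by apply: tends_uniq (hg _) _; apply: (tends_eq (tends_cst _)) => i; rewrite char1.
- by apply: tends_uniq (hg _) _; apply: (tends_eq (tends_conjC (hg a))) => i; rewrite char_star.
Qed.

(** Weak* compactness of the characters, stated without a topology on them: pointwise limits along
    an ultrafilter exist and the defining equations pass to them. *)
Lemma char_ultralim I (U : set_system I) (UU : UltraFilter U) (A : cstarAlgType R)
    (f : I -> A -> C) : (forall i, character (f i)) ->
  exists g : A -> C, character g /\ forall a, tends U (fun i => f i a : C^o) (g a).
Proof.
move=> hf; have [g hg] := ultra_functional UU (fun i => char_nm (hf i)).
by exists g; split=> //; apply: char_limit hf hg.
Qed.
End Ultra.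

Section CharProd.
Variable R : realType.
Local Notation C := R[i].
Implicit Types G : compact_quantum_group R.

Definition cprod G (chi mu : Cm G -> C) : Cm G -> C :=
  tens_char (Cm2 G) chi mu \o @Delta R G.

Lemma cprod_char G (chi mu : Cm G -> C) : character chi -> character mu ->
  character (cprod chi mu).
Proof. by move=> hc hm; apply: (char_comp (Delta_hom G)); exact: tens_char_char. Qed.

(** Both sides are a triple product character on an iterated coproduct; [s] identifies the two
    bracketings and [sD] the two coproducts. *)
Lemma cprodA G (chi mu nu : Cm G -> C) : character chi -> character mu -> character nu ->
  cprod chi (cprod mu nu) = cprod (cprod chi mu) nu.
Proof.
move=> hc hm hn.
have [A21 [A12 [DI [ID [s [[hDI DIE] [hID IDE] [hs _] sE sD]]]]]] := Delta_coassoc G.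
have hcm := tens_char_char (Cm2 G) hc hm; have hmn := tens_char_char (Cm2 G) hm hn.
have o1 := tens_char_char A21 hcm hn; have o2 := tens_char_char A12 hc hmn.
have os := char_comp hs o2.
have e12 : tens_char A21 (tens_char (Cm2 G) chi mu) nu =
    tens_char A12 chi (tens_char (Cm2 G) mu nu) \o s.
  symmetry; apply: tens_char_uniqlr => // [z|c].
    rewrite tens_charE // char1 // mulr1.
    suff ee : (fun z => tens_char A12 chi (tens_char (Cm2 G) mu nu) (s (tens A21 z cone))) =
      tens_char (Cm2 G) chi mu by exact: (congr1 (fun f => f z) ee).
    apply: tens_char_eq => //; first exact: (char_comp (tens_homl A21) os).
    by move=> a b; rewrite sE !tens_charE // char1 // mulr1.
  rewrite /= -tens1 sE !tens_charE // !char1 // !mul1r.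
  by [].
have e1 : tens_char (Cm2 G) (cprod chi mu) nu =
    tens_char A21 (tens_char (Cm2 G) chi mu) nu \o DI.
  symmetry; apply: tens_char_eq => //; first exact: cprod_char.
    exact: (char_comp hDI o1).
  by move=> a b; rewrite /= DIE tens_charE.
have e2 : tens_char (Cm2 G) chi (cprod mu nu) =
    tens_char A12 chi (tens_char (Cm2 G) mu nu) \o ID.
  symmetry; apply: tens_char_eq => //; first exact: cprod_char.
    exact: (char_comp hID o2).
  by move=> a b; rewrite /= IDE tens_charE.
by apply/funext => a; rewrite /cprod /= -/(cprod mu nu) -/(cprod chi mu) e1 e2 /= e12 /= sD.
Qed.

(** The two product characters agree on all [Delta a ** tens (Cm2 G) b cone], a total set by
    cancellation, hence everywhere; evaluation at [tens (Cm2 G) cone b] recovers [mu] and [nu]. *)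
Lemma cprod_inj G (chi mu nu : Cm G -> C) : character chi -> character mu -> character nu ->
  cprod chi mu = cprod chi nu -> mu = nu.
Proof.
move=> hc hm hn e; have [_ d] := Delta_cancel G.
have h : tens_char (Cm2 G) chi mu = tens_char (Cm2 G) chi nu.
  apply: (char_ext d); try exact: tens_char_char.
  move=> _ [a [b ->]]; rewrite !charM ?tens_charE //; try exact: tens_char_char.
  by have := congr1 (fun f => f a) e; rewrite /cprod /= => ->; rewrite !char1.
apply/funext => b; have := congr1 (fun f => f (tens (Cm2 G) cone b)) h.
by rewrite !tens_charE // char1 // !mul1r.
Qed.

Lemma cprod_injr G (chi mu nu : Cm G -> C) : character chi -> character mu -> character nu ->
  cprod mu chi = cprod nu chi -> mu = nu.
Proof.
move=> hc hm hn e; have [d _] := Delta_cancel G.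
have h : tens_char (Cm2 G) mu chi = tens_char (Cm2 G) nu chi.
  apply: (char_ext d); try exact: tens_char_char.
  move=> _ [a [b ->]]; rewrite !charM ?tens_charE //; try exact: tens_char_char.
  by have := congr1 (fun f => f a) e; rewrite /cprod /= => ->; rewrite !char1.
apply/funext => b; have := congr1 (fun f => f (tens (Cm2 G) b cone)) h.
by rewrite !tens_charE // char1 // !mulr1.
Qed.

Lemma counit_char G : character (@counit R G).
Proof. by have [] := counitP G. Qed.

Lemma cprod1l G (mu : Cm G -> C) : character mu -> cprod (@counit R G) mu = mu.
Proof.
move=> hm; have [hc [El [Er [[hl hr] lE rE lD rD]]]] := counitP G.
have e : mu \o El = tens_char (Cm2 G) (@counit R G) mu.
  apply: tens_char_eq => //; first exact: (char_comp hl hm).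
  by move=> a b /=; rewrite lE charZ.
by apply/funext => a; rewrite /cprod -e /= lD.
Qed.

Lemma cprod1r G (mu : Cm G -> C) : character mu -> cprod mu (@counit R G) = mu.
Proof.
move=> hm; have [hc [El [Er [[hl hr] lE rE lD rD]]]] := counitP G.
have e : mu \o Er = tens_char (Cm2 G) mu (@counit R G).
  apply: tens_char_eq => //; first exact: (char_comp hr hm).
  by move=> a b /=; rewrite rE charZ // mulrC.
by apply/funext => a; rewrite /cprod -e /= rD.
Qed.

(** Cancel [chi] in [chi chi = chi = chi eps]. This is the handle by which the counit is
    recognised. *)
Lemma cprod_idem G (chi : Cm G -> C) : character chi -> cprod chi chi = chi ->
  chi = @counit R G.
Proof.
move=> hc e; apply: (cprod_inj hc hc (counit_char G)).
by rewrite e cprod1r.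
Qed.

Lemma cprod_hom G G' (f : Cm G -> Cm G') (F : Cm2 G -> Cm2 G') (chi mu : Cm G' -> C) :
  star_hom f -> tensor_hom f f F -> (forall a, Delta (f a) = F (Delta a)) ->
  character chi -> character mu ->
  cprod chi mu \o f = cprod (chi \o f) (mu \o f).
Proof.
move=> hf [hF FE] fD hc hm.
have e : tens_char (Cm2 G') chi mu \o F = tens_char (Cm2 G) (chi \o f) (mu \o f).
  apply: tens_char_eq; try exact: char_comp.
    by apply: (char_comp hF _); exact: tens_char_char.
  by move=> a b /=; rewrite FE tens_charE.
by apply/funext => a; rewrite /cprod /= fD -e.
Qed.

(** The pullback of the counit is an idempotent character, so [cprod_idem] identifies it. *)
Lemma counit_hom G G' (f : Cm G -> Cm G') (F : Cm2 G -> Cm2 G') :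
  star_hom f -> tensor_hom f f F -> (forall a, Delta (f a) = F (Delta a)) ->
  @counit R G' \o f = @counit R G.
Proof.
move=> hf hF fD; have he := counit_char G'.
apply: cprod_idem; first exact: char_comp.
by rewrite -(cprod_hom hf hF fD) // cprod1l.
Qed.

(** At a group-like [v] the identity [(eps (x) id) Delta = id] reads [eps v *: v = v]. *)
Lemma counit_grouplike G (v : Cm G) : Delta v = tens (Cm2 G) v v -> v != 0 ->
  @counit R G v = 1.
Proof.
move=> vD v0; have [_ [El [Er [_ lE _ lD _]]]] := counitP G.
have h := lD v; rewrite vD lE in h.
have : (@counit R G v - 1) *: v == 0 by rewrite scalerBl h scale1r subrr.
by rewrite scaler_eq0 (negbTE v0) orbF subr_eq0 => /eqP.
Qed.

(** Joint continuity of the product: product characters are contractive, so convergence on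
    elementary tensors suffices. *)
Lemma cprod_cvg G I (F : set_system I) {FF : ProperFilter F}
    (f g : I -> Cm G -> C) (chi mu : Cm G -> C) :
  (forall i, character (f i)) -> (forall i, character (g i)) ->
  character chi -> character mu ->
  (forall a, tends F (fun i => f i a : C^o) (chi a)) ->
  (forall a, tends F (fun i => g i a : C^o) (mu a)) ->
  forall a, tends F (fun i => cprod (f i) (g i) a : C^o) (cprod chi mu a).
Proof.
move=> hf hg hc hm fc gm a.
have ht i := tens_char_char (Cm2 G) (hf i) (hg i).
have h0 := tens_char_char (Cm2 G) hc hm.
suff h z : tends F (fun i => tens_char (Cm2 G) (f i) (g i) z : C^o)
    (tens_char (Cm2 G) chi mu z) by exact: (h (Delta a)).
move: z; apply: (@tends_dense_lin R I F FF (Cm2 G) C^o _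
  (fun i => tens_char (Cm2 G) (f i) (g i)) (tens_char (Cm2 G) chi mu) 1 (tens_dense (Cm2 G))).
- by move=> i; apply: char_lin.
- exact: char_lin.
- by move=> i x; rewrite mul1r; apply: char_nm.
- by move=> x; rewrite mul1r; apply: char_nm.
- move=> _ [x [y ->]]; rewrite tens_charE //.
  by apply: (tends_eq (tends_mulC (fc x) (gm y))) => i; rewrite tens_charE.
Qed.

Section Inverse.
Variables (G : compact_quantum_group R) (chi : Cm G -> C).
Hypothesis hc : character chi.

Fixpoint cpow n : Cm G -> C := if n is n'.+1 then cprod (cpow n') chi else @counit R G.

Lemma cpow_char n : character (cpow n).
Proof. by elim: n => [|n IH]; [exact: counit_char|exact: cprod_char]. Qed.

Lemma cpowD m n : cpow (m + n) = cprod (cpow m) (cpow n).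
Proof.
elim: n => [|n IH]; first by rewrite addn0 cprod1r //; exact: cpow_char.
by rewrite addnS /= IH cprodA //; exact: cpow_char.
Qed.

(* With [e m] a limit point of [chi^(n-m)] as n grows, a limit point [e] of the [e m] satisfies
   [e rho = rho] for a limit point [rho] of the powers, so [e] is the counit. *)
Lemma char_inverse : exists2 ka, character ka & cprod chi ka = @counit R G.
Proof.
have [U [UU oU]] := ultraFilterLemma eventually_filter.
have [rho [hr rhoE]] := char_ultralim UU cpow_char.
(* Subtraction is truncated: for [n < m] the term is the counit, which the limit along [U]
   ignores. *)
have ex m : exists g : Cm G -> C, character g /\
    forall a, tends U (fun n => cpow (n - m) a : C^o) (g a).
  by apply: char_ultralim => n; apply: cpow_char.
have [e he] := choice ex.
have hec m : character (e m) by have [] := he m.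
have heE m := proj2 (he m).
have [e0 [he0 e0E]] := char_ultralim UU hec.
(* The identity [chi^(n-m) chi^m = chi^n], in the limit over [n]. *)
have e_rho m : cprod (e m) (cpow m) = rho.
  apply/funext => a; apply: (@tends_uniq R _ U _ C^o _ _ _ _ (rhoE a)).
  pose proof (cprod_cvg (fun n => cpow_char (n - m)) (fun n => cpow_char m) (hec m)
    (cpow_char m) (heE m) (fun a => tends_cst (cpow m a : C^o)) a) as h.
  move: h; apply: tends_near; apply: oU; exists m => // n /= mn.
  by rewrite -cpowD subnK.
(* Letting [m] grow in [e_rho] gives [e0 rho = rho], and [rho] cancels. *)
have e0_counit : e0 = @counit R G.
  apply: (cprod_injr hr he0 (counit_char G)); rewrite cprod1l //.
  apply/funext => a; pose proof (cprod_cvg hec cpow_char he0 hr e0E rhoE a) as h.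
  apply: (tends_uniq h); apply: (tends_eq (tends_cst _)) => m.
  by rewrite e_rho.
(* Since [chi] times [e m.+1] is [e m], a limit [ka] of the shifted sequence satisfies
   [chi ka = e0]. *)
have [ka [hka kaE]] := char_ultralim UU (fun m => hec m.+1).
exists ka => //; rewrite -e0_counit; apply/funext => a.
pose proof (cprod_cvg (fun=> hc) (fun m => hec m.+1) hc hka
  (fun a => tends_cst (chi a : C^o)) kaE a) as h.
apply: (tends_uniq h); apply: (tends_eq (e0E a)) => m; congr (_ a).
have hx := hec m; apply/funext => b; apply: (tends_uniq (heE m b)).
pose proof (cprod_cvg (fun=> hc) (fun n => cpow_char (n - m.+1)) hc (hec m.+1)
   (fun a => tends_cst (chi a : C^o)) (heE m.+1) b) as h'.
move: h'; apply: tends_near; apply: oU; exists m.+1 => // n /= mn.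
have -> : (n - m = 1 + (n - m.+1))%N by rewrite add1n subnS prednK // subn_gt0.
by rewrite cpowD /= cprod1l.
Qed.

End Inverse.

End CharProd.

Section Sequences.

Lemma infinite_inj (T : Type) (X : set T) : infinite_set X ->
  exists f : nat -> T, (forall n, X (f n)) /\ injective f.
Proof.
move=> /infiniteP /card_leP[f].
pose inN n : [set: nat] := SigSub (mem_set (I : [set: nat] n)).
exists (fun n => val (f (inN n))); split=> [n|m n h].
  exact: set_valP.
have := @inj _ _ _ f (inN m) (inN n); rewrite !inE => /(_ I I (val_inj h)).
by move=> /(congr1 val).
Qed.

Lemma countable_enum (T : Type) (X : set T) (x0 : T) : countable X ->
  exists f : nat -> T, X `<=` range f.
Proof.
move=> /countable_injP[g gi].
have h n : exists x, (exists y, X y /\ g y = n) -> X x /\ g x = n.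
  have [[y hy]|hN] := pselect (exists y, X y /\ g y = n); first by exists y.
  by exists x0 => /hN.
have [f hf] := choice h; exists f => x Xx.
have [Xf gf] : X (f (g x)) /\ g (f (g x)) = g x by apply: hf; exists x.
by exists (g x) => //; apply: gi; rewrite ?inE.
Qed.

Variable R : realType.
Local Notation C := R[i].

Lemma separable_seq (A : cstarAlgType R) : separable A ->
  exists d : nat -> A, forall x (e : R), 0 < e -> exists k, nm (x - d k) < e.
Proof.
move=> [D [cD dD]]; have [d hd] := countable_enum 0 cD; exists d => x e e0.
have [y [/hd[k _ <-] xy]] := dense_nm dD x e0.
by exists k.
Qed.

Lemma tends_on_seq (A : cstarAlgType R) (d : nat -> A) I (F : set_system I)
    (FF : Filter F) (f : I -> A -> C) (g : A -> C) :
  (forall x (e : R), 0 < e -> exists k, nm (x - d k) < e) ->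
  (forall i, character (f i)) -> character g ->
  (forall k, tends F (fun i => f i (d k) : C^o) (g (d k))) ->
  forall a, tends F (fun i => f i a : C^o) (g a).
Proof.
move=> hd hf hg h a e e0; have e3 : 0 < e / 3 by rewrite divr_gt0.
have [k ak] := hd a _ e3; apply: filterS (h k _ e3) => i hi.
have h1 : nm (f i a - f i (d k) : C^o) < e / 3 := le_lt_trans (char_dist (hf i) _ _) ak.
have h2 : nm (g (d k) - g a : C^o) < e / 3.
  by rewrite nmC; exact: le_lt_trans (char_dist hg _ _) ak.
have := @nm_tri R C^o (f i (d k)) (f i a) (g a).
have := @nm_tri R C^o (g (d k)) (f i (d k)) (g a); lra.
Qed.

Variables (Gam : groupType) (G : compact_quantum_group R) (al : Gam -> Cm G -> Cm G).
Hypothesis hal : quantum_action al.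

Lemma al_hom g : star_hom (al g). Proof. by have [/(_ g)[]] := hal. Qed.
Lemma al_bij g : bijective (al g). Proof. by have [/(_ g)[]] := hal. Qed.
Lemma alM g h a : al (g * h)%g a = al g (al h a).
Proof. by have [_ ->] := hal. Qed.
Lemma al1 a : al 1%g a = a.
Proof. by have [f fK _] := al_bij 1%g; apply: (can_inj fK); rewrite -alM mulg1. Qed.
Lemma alKV g a : al g (al g^-1%g a) = a.
Proof. by rewrite -alM mulgV al1. Qed.
Lemma al_nm g a : nm (al g a) = nm a.
Proof. exact: (iso_nm a (al_hom g) (al_bij g)). Qed.
Lemma counit_al g a : counit (al g a) = @counit R G a.
Proof.
have [/(_ g)[h _ [F [hF FD]]] _] := hal.
exact: (congr1 (fun f => f a) (counit_hom h hF FD)).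
Qed.

Lemma fixed_characters_cprod chi mu : fixed_characters al chi -> fixed_characters al mu ->
  fixed_characters al (cprod chi mu).
Proof.
move=> [hc cf] [hm mf]; split; first exact: cprod_char.
move=> g a; have [/(_ g)[h _ [F [hF FD]]] _] := hal.
have := congr1 (fun f => f a) (cprod_hom h hF FD hc hm); rewrite /= => ->.
by congr (cprod _ _ a); apply/funext => b /=.
Qed.

(** [char_inverse] gives a right inverse [ka]. Cancelling [chi] shows that it is invariant;
    cancelling [ka] on the right in [(ka chi) ka = ka (chi ka) = ka] makes it a left inverse. *)
Lemma fixed_characters_inverse chi : fixed_characters al chi -> exists2 ka,
  fixed_characters al ka & cprod ka chi = @counit R G.
Proof.
move=> [hc cf]; have [ka hka e] := char_inverse hc.
exists ka; first split=> // g a.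
  have [/(_ g)[h _ [F [hF FD]]] _] := hal.
  suff ee : ka \o al g = ka by exact: (congr1 (fun f => f a) ee).
  apply: (cprod_inj hc) => //; first exact: (char_comp h).
  have ce : chi \o al g = chi by apply/funext => b; apply: cf.
  rewrite -{1}ce -(cprod_hom h hF FD) // e.
  by apply/funext => b /=; rewrite counit_al.
apply: (cprod_injr hka); [exact: cprod_char|exact: counit_char|].
by rewrite -cprodA // e cprod1r // cprod1l.
Qed.

Lemma characters_cluster_counit : infinite_set (fixed_characters al) ->
  exists psi : nat -> Cm G -> C, (forall k, fixed_characters al (psi k)) /\
    (forall k, psi k <> @counit R G) /\
    forall a, tends \oo (fun k => psi k a : C^o) (@counit R G a).
Proof.
move=> /infinite_inj[chi [chiX chiI]].
have chic n : character (chi n) by have [] := chiX n.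
have [U [UU oU]] := ultraFilterLemma eventually_filter.
have [c0 [hc0 c0E]] := char_ultralim UU chic.
have c0X : fixed_characters al c0.
  split=> // g a; apply: (tends_uniq (c0E (al g a))).
  by apply: (tends_eq (c0E a)) => n; have [_ ->] := chiX n.
have [ka kaX kae] := fixed_characters_inverse c0X; have hka : character ka by case: kaX.
have lim a : tends U (fun n => cprod ka (chi n) a : C^o) (@counit R G a).
  rewrite -kae.
  exact: (cprod_cvg (fun=> hka) chic hka hc0 (fun a => tends_cst (ka a : C^o)) c0E a).
(* The [chi n] are distinct and multiplication by [ka] is injective, so at most one index gives the
   counit. *)
have [N hN] : exists N, forall n, (N <= n)%N -> cprod ka (chi n) <> @counit R G.
  have [[m hm]|hN] := pselect (exists m, cprod ka (chi m) = @counit R G); last first.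
    by exists 0%N => n _ hn; apply: hN; exists n.
  exists m.+1 => n mn hn; have := cprod_inj hka (chic m) (chic n).
  by rewrite hm hn => /(_ erefl)/chiI mE; rewrite mE ltnn in mn.
have [d hd] := separable_seq (Cm_separable G).
(* Diagonal choice: the [k]th character is within [1/(k+1)] of the counit on the first [k] members
   of a dense sequence, which turns the limit along [U] into one along [\oo]. *)
have ex k : exists n, (N <= n)%N /\ forall j : nat, (j < k)%N ->
    nm (cprod ka (chi n) (d j) - counit (d j) : C^o) < k.+1%:R^-1.
  have h l : \forall n \near U, forall j : nat, (j < l)%N ->
      nm (cprod ka (chi n) (d j) - counit (d j) : C^o) < k.+1%:R^-1.
    have k0 : (0 : R) < k.+1%:R^-1 by rewrite invr_gt0.
    elim: l => [|l IH]; first by apply: nearW.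
    apply: filterS2 IH (lim (d l) _ k0) => n h1 h2 j.
    by rewrite ltnS leq_eqVlt => /predU1P[->//|]; apply: h1.
  by have [n [h1 h2]] := near_ex2 _ (h k) (oU _ (near_ge N)); exists n.
have [f hf] := choice ex.
exists (fun k => cprod ka (chi (f k))); split; last split.
- by move=> k; apply: fixed_characters_cprod.
- by move=> k; apply: hN; have [] := hf k.
- apply: (tends_on_seq _ hd (f := fun k => cprod ka (chi (f k)))).
  + by move=> k; apply: cprod_char.
  + exact: counit_char.
  move=> j e e0; have [M _ hM] := @near_infty_natSinv_lt R (PosNum e0).
  exists (maxn M j.+1) => // k /=; rewrite geq_max => /andP[Mk jk].
  have [_ h] := hf k; exact: lt_trans (h j jk) (hM k Mk).
Qed.

End Sequences.

(** * Hilbert spaces from sesquilinear forms *)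

Section HilbertBuilder.
Variable R : realType.
Local Notation C := R[i].

Section SemiNorm.
Variables (V : lmodType C) (B : form V).

Definition fnorm (x : V) : R := Num.sqrt (complex.Re (B x x)).

Lemma fnorm_ge0 x : 0 <= fnorm x. Proof. exact: sqrtr_ge0. Qed.
Lemma fnorm_sqr x : fnorm x ^+ 2 = complex.Re (B x x).
Proof. by rewrite sqr_sqrtr // fm_ge0. Qed.
Lemma fnorm_CS x y : cabs (B x y) <= fnorm x * fnorm y.
Proof.
rewrite -ler_sqr ?nnegrE ?cabs_ge0 ?mulr_ge0 ?fnorm_ge0 // exprMn !fnorm_sqr.
exact: form_CS.
Qed.
Lemma fnormD x y : fnorm (x + y) <= fnorm x + fnorm y.
Proof.
rewrite -ler_sqr ?nnegrE ?addr_ge0 ?fnorm_ge0 // sqrrD !fnorm_sqr fmD !fmDr !ReD.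
rewrite (fmC B x y) Reconj mulr2n.
have := le_trans (Re_le (B x y)) (fnorm_CS x y); lra.
Qed.
Lemma fnormZ c x : fnorm (c *: x) = cabs c * fnorm x.
Proof.
rewrite /fnorm fmZ fmZr mulrA mulconj Re_rc sqrtrM ?sqr_ge0 // sqrtr_sqr.
by rewrite ger0_norm // cabs_ge0.
Qed.
Lemma fnorm0 : fnorm 0 = 0. Proof. by rewrite /fnorm fm0l sqrtr0. Qed.
Lemma fnormN x : fnorm (- x) = fnorm x.
Proof. by rewrite -scaleN1r fnormZ cabsN cabs1 mul1r. Qed.
Lemma fnorm_tri z x y : fnorm (x - y) <= fnorm (x - z) + fnorm (z - y).
Proof. by rewrite (_ : x - y = (x - z) + (z - y)) ?fnormD // addrA subrK. Qed.
Lemma fnorm_distC x y : fnorm (x - y) = fnorm (y - x).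
Proof. by rewrite -fnormN opprB. Qed.
Lemma fnorm_subl x y : fnorm x - fnorm y <= fnorm (x - y).
Proof. by rewrite lerBlDr -{1}(subrK y x) fnormD. Qed.

Definition fcauchy (u : nat -> V) := forall e : R, 0 < e ->
  exists N, forall m n, (N <= m)%N -> (N <= n)%N -> fnorm (u m - u n) < e.

Definition fcvg (u : nat -> V) (l : V) := forall e : R, 0 < e ->
  \forall n \near \oo, fnorm (u n - l) < e.
End SemiNorm.

(** Completeness is asked of sequences only; [hd_cauchy_cvg] upgrades it to Cauchy filters. The
    alias [hd_type] carries the structures. *)
Record hilbert_data := HilbertData {
  hd_lmod :> lmodType C;
  hd_form : form hd_lmod;
  hd_def : forall x, complex.Re (hd_form x x) = 0 -> x = 0;
  hd_complete : forall u, fcauchy hd_form u -> exists l, fcvg hd_form u l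
}.

Definition hd_type (d : hilbert_data) : Type := hd_lmod d.
HB.instance Definition _ d := GRing.Lmodule.copy (hd_type d) (hd_lmod d).

Section Instances.
Variable d : hilbert_data.
Local Notation T := (hd_type d).
Local Notation B := (hd_form d).

Definition hd_norm (x : T) : C := rc (fnorm B x).

Lemma hd_normD x y : hd_norm (x + y) <= hd_norm x + hd_norm y.
Proof. by rewrite /hd_norm -rcD le_rc fnormD. Qed.
Lemma hd_normZ (c : C) (x : T) : hd_norm (c *: x) = `|c| * hd_norm x.
Proof. by rewrite /hd_norm fnormZ rcM -cabsE. Qed.
Lemma hd_norm_eq0 (x : T) : hd_norm x = 0 -> x = 0.
Proof.
move=> /(@rcI R _ 0) h; apply: (@hd_def d).
by rewrite -fnorm_sqr h expr0n.
Qed.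
End Instances.

HB.instance Definition _ d := @Lmodule_isNormed.Build C (hd_type d) _
  (@hd_normD d) (@hd_normZ d) (@hd_norm_eq0 d).

Lemma hd_nm d (x : hd_type d) : nm x = fnorm (hd_form d) x.
Proof. by []. Qed.

(** A Cauchy filter has centres [u n] of precision [1/(n+1)]; they form a Cauchy sequence, and its
    limit is the limit of the filter. *)
Lemma hd_cauchy_cvg d (F : set_system (hd_type d)) : ProperFilter F -> cauchy F -> cvg F.
Proof.
move=> FF /cauchy_ballP Fc.
have h n : exists x : hd_type d, F [set y | nm (x - y) < n.+1%:R^-1].
  have n0 : 0 < rc (n.+1%:R^-1 : R) by rewrite lt_rc invr_gt0.
  have [[P Q] [FP FQ] PQ] := Fc _ n0.
  have [x Px] := @filter_ex _ F FF _ FP.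
  exists x; apply: filterS FQ => y Qy.
  by have := PQ (x, y) (conj Px Qy); rewrite /= -ball_normE /= nmE lt_rc.
have [u hu] := choice h.
have uc : fcauchy (hd_form d) u.
  move=> e e0; have e2 : 0 < e / 2 by rewrite divr_gt0.
  have [N _ hN] := @near_infty_natSinv_lt R (PosNum e2).
  exists N => m n Nm Nn.
  have [y [h1 h2]] := near_ex2 FF (hu m) (hu n).
  rewrite -[fnorm _ _]/(nm (u m - u n : hd_type d)).
  apply: le_lt_trans (nm_tri y _ _) _; rewrite [X in _ < X](splitr e) ltrD //.
    exact: lt_trans h1 (hN _ Nm).
  by rewrite nmC; exact: lt_trans h2 (hN _ Nn).
have [l hl] := hd_complete uc; apply/cvg_ex; exists (l : hd_type d).
apply/cvgrPdist_lt => e e0.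
have e0' : 0 < complex.Re e by rewrite -lt_rc ge0_ReK ?ltW.
have e2 : 0 < complex.Re e / 2 by rewrite divr_gt0.
have [N _ hN] := @near_infty_natSinv_lt R (PosNum e2).
have [n [h1 h2]] := near_ex2 _ (hl _ e2) (near_ge N).
apply: filterS (hu n) => y hy; rewrite nmE -(ge0_ReK (ltW e0)) lt_rc.
apply: le_lt_trans (nm_tri (u n) _ _) _; rewrite [X in _ < X](splitr (complex.Re e)) ltrD //.
  by rewrite nmC.
exact: lt_trans hy (hN _ h2).
Qed.

HB.instance Definition _ d := Uniform_isComplete.Build (hd_type d) (@hd_cauchy_cvg d).

Lemma hd_dot_norm d (x : hd_type d) : hd_form d x x = `|x| ^+ 2.
Proof. by rewrite nmE -rcX hd_nm fnorm_sqr fm_self. Qed.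

HB.instance Definition _ d := @isHilbert.Build R (hd_type d) (hd_form d)
  (@fmD _ _ (hd_form d)) (@fmZ _ _ (hd_form d)) (@fmC _ _ (hd_form d)) (@hd_dot_norm d).

Definition hd_hilbert (d : hilbert_data) : hilbertType R := hd_type d.

End HilbertBuilder.

(** * Subspaces as types, closed subspaces, completions *)

Section Subspace.
Variable R : realType.
Local Notation C := R[i].

Record subspace (V : lmodType C) := Subspace {
  sp_set :> set V;
  sp0 : sp_set 0;
  sp_lin : forall c x y, sp_set x -> sp_set y -> sp_set (c *: x + y)
}.

Definition sp_pred (V : lmodType C) (S : subspace V) : {pred V} := fun x => `[< sp_set S x >].

Lemma sp_submod (V : lmodType C) (S : subspace V) : submod_closed (sp_pred S).
Proof.
split=> [|c x y]; rewrite /in_mem /= /sp_pred; first by apply/asboolP; exact: sp0.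
by move=> /asboolP Sx /asboolP Sy; apply/asboolP; exact: sp_lin.
Qed.

HB.instance Definition _ (V : lmodType C) (S : subspace V) :=
  GRing.isSubmodClosed.Build C V (sp_pred S) (sp_submod S).

Record sp_type (V : lmodType C) (S : subspace V) := SpType {
  sp_val : V; _ : sp_val \in sp_pred S }.

HB.instance Definition _ V S := [isSub for @sp_val V S].
HB.instance Definition _ V S := [Choice of @sp_type V S by <:].
HB.instance Definition _ V S := [SubChoice_isSubLmodule of @sp_type V S by <:].

Section Val.
Variables (V : lmodType C) (S : subspace V).
Lemma sp_valP (x : sp_type S) : sp_set S (sp_val x).
Proof. by have := valP x; rewrite /in_mem /= => /asboolP. Qed.
Lemma sp_val_lin : linear (@sp_val V S).
Proof. by move=> c x y; exact: (linearP (val : {linear sp_type S -> V})). Qed.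
Lemma sp_ext (x y : sp_type S) : sp_val x = sp_val y -> x = y.
Proof. exact: val_inj. Qed.
(** Vectors outside [S] are sent to 0, hence the membership hypothesis of [sp_mkE]. *)
Definition sp_mk (v : V) : sp_type S := insubd 0 v.
Lemma sp_mkE v : sp_set S v -> sp_val (sp_mk v) = v.
Proof. by move=> Sv; rewrite -/(val _) insubdK // unfold_in; apply/asboolP. Qed.
End Val.

Section ClosedSubspace.
Variables (H : hilbertType R) (S : subspace H).
Hypothesis Scl : forall (u : nat -> H) l,
  (forall n, sp_set S (u n)) -> tends \oo u l -> sp_set S l.

Let cs_dot (x y : sp_type S) : C := hdot (sp_val x) (sp_val y).

Lemma cs_dotD x y z : cs_dot (x + y) z = cs_dot x z + cs_dot y z.
Proof. by rewrite /cs_dot (linD (@sp_val_lin _ S)) hdotDl. Qed.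
Lemma cs_dotZ c x y : cs_dot (c *: x) y = c * cs_dot x y.
Proof. by rewrite /cs_dot (linZ (@sp_val_lin _ S)) hdotZl. Qed.
Lemma cs_dotC x y : cs_dot y x = (cs_dot x y)^*.
Proof. exact: hdotC. Qed.
Lemma cs_dot_ge0 x : 0 <= complex.Re (cs_dot x x).
Proof. exact: hdot_re_ge0. Qed.

Definition cs_form := Form cs_dotD cs_dotZ cs_dotC cs_dot_ge0.

Lemma cs_fnorm x : fnorm cs_form x = nm (sp_val x).
Proof. by rewrite /fnorm /= /cs_dot hdot_nm /= sqrtr_sqr ger0_norm // nm_ge0. Qed.

Lemma cs_def x : complex.Re (cs_form x x) = 0 -> x = 0.
Proof.
rewrite /= /cs_dot hdot_nm /= => /eqP; rewrite sqrf_eq0 => /eqP /nm_eq0 h.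
by apply: sp_ext; rewrite h (lin0 (@sp_val_lin _ S)).
Qed.

Lemma cs_complete u : fcauchy cs_form u -> exists l, fcvg cs_form u l.
Proof.
move=> uc; have [l hl] : exists l, tends \oo (fun n => sp_val (u n)) l.
  apply: complete_cauchy => e /uc[N hN]; exists N => m n Nm Nn.
  by rewrite -(linB (@sp_val_lin _ S)) -cs_fnorm hN.
have Sl := Scl (fun n => sp_valP (u n)) hl.
exists (sp_mk S l) => e /hl; apply: filterS => n.
by rewrite cs_fnorm (linB (@sp_val_lin _ S)) sp_mkE.
Qed.

Definition closed_subspace : hilbertType R := hd_hilbert (HilbertData cs_def cs_complete).

End ClosedSubspace.

(** * Completion of a semidefinite form *)

Section Completion.
Variables (V : lmodType C) (B : form V).

(* A vector of the completion is encoded as the functional [lim B (x n) _] of a Cauchy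
   sequence [x]. *)
Definition crep (x : nat -> V) (f : V -> C^o) :=
  fcauchy B x /\ forall v, tends \oo (fun n => B (x n) v : C^o) (f v).

Lemma crep0 : crep (fun=> 0) 0.
Proof.
split=> [e e0|v]; first by exists 0%N => m n _ _; rewrite subrr fnorm0.
by apply: (tends_eq (tends_cst _)) => n; rewrite fm0l.
Qed.

Lemma crep_lin c x y f g : crep x f -> crep y g ->
  crep (fun n => c *: x n + y n) (c *: f + g).
Proof.
move=> [xc xf] [yc yg]; split=> [e e0|v]; last first.
  by apply: (tends_eq (tendsD (tendsZ c (xf v)) (yg v))) => n; rewrite fmD fmZ.
have c0 : 0 < cabs c + 1 by rewrite ltr_wpDl ?cabs_ge0.
have e2 : 0 < e / 2 by rewrite divr_gt0.
have [N hN] := xc _ (divr_gt0 e2 c0); have [M hM] := yc _ e2.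
exists (maxn N M) => m n; rewrite !geq_max => /andP[Nm Mm] /andP[Nn Mn].
rewrite opprD addrACA -scalerBr; apply: le_lt_trans (fnormD _ _ _) _.
rewrite [X in _ < X](splitr e) ltr_leD //; last by rewrite ltW // hM.
rewrite fnormZ; apply: le_lt_trans (_ : (cabs c + 1) * fnorm B (x m - x n) < _).
  by rewrite ler_wpM2r ?fnorm_ge0 // lerDl.
by rewrite mulrC -ltr_pdivlMr // hN.
Qed.

Lemma fcauchy_bounded x : fcauchy B x -> exists M, \forall n \near \oo, fnorm B (x n) <= M.
Proof.
move=> xc; have [N hN] := xc _ ltr01; exists (fnorm B (x N) + 1).
exists N => // n Nn; have := fnorm_subl B (x n) (x N).
by have := hN n N Nn (leqnn _); lra.
Qed.

Definition fnull (z : nat -> V) := forall e : R, 0 < e -> \forall n \near \oo, fnorm B (z n) < e.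

Lemma fnull_dot z y M : fnull z -> (\forall n \near \oo, fnorm B (y n) <= M) ->
  tends \oo (fun n => B (z n) (y n) : C^o) 0.
Proof.
move=> hz hy e e0; have M0 : 0 < `|M| + 1 by rewrite ltr_pwDr.
apply: filterS2 (hz _ (divr_gt0 e0 M0)) hy => n h1 h2; rewrite subr0.
apply: le_lt_trans (fnorm_CS B _ _) _.
apply: le_lt_trans (_ : fnorm B (z n) * (`|M| + 1) < _); last by rewrite -ltr_pdivlMr.
rewrite ler_wpM2l ?fnorm_ge0 // (le_trans h2) // (le_trans (ler_norm _)) //.
by rewrite lerDl.
Qed.

(** Split [B (z n) (z n)] as [B (z n) (z n - z N) + B (z n) (z N)]: the Cauchy property controls the
    first term, weak convergence the second. Thus a functional determines its Cauchy sequence up to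
    null sequences. *)
Lemma fnull_of_weak z : fcauchy B z ->
  (forall v, tends \oo (fun n => B (z n) v : C^o) 0) -> fnull z.
Proof.
move=> zc zw e e0; have [M hM] := fcauchy_bounded zc.
have e2 : 0 < e ^+ 2 / 2 by rewrite divr_gt0 ?exprn_gt0.
have M0 : 0 < `|M| + 1 by rewrite ltr_pwDr.
have [N hN] := zc _ (divr_gt0 e2 M0).
apply: filterS3 hM (zw (z N) _ e2) (near_ge N) => n h1 h2 h3.
rewrite -ltr_sqr ?nnegrE ?fnorm_ge0 ?ltW // fnorm_sqr.
have -> : B (z n) (z n) = B (z n) (z n - z N) + B (z n) (z N) by rewrite fmBr subrK.
rewrite ReD [X in _ < X](splitr (e ^+ 2)) ltrD //; apply: le_lt_trans (Re_le _) _.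
  apply: le_lt_trans (fnorm_CS B _ _) _.
  apply: le_lt_trans (_ : (`|M| + 1) * fnorm B (z n - z N) < _).
    rewrite ler_wpM2r ?fnorm_ge0 // (le_trans h1) // (le_trans (ler_norm _)) //.
    by rewrite lerDl.
  by rewrite mulrC -ltr_pdivlMr // hN.
by move: h2; rewrite subr0.
Qed.

Lemma crep_dot_cauchy x y : fcauchy B x -> fcauchy B y ->
  exists l, tends \oo (fun n => B (x n) (y n) : C^o) l.
Proof.
move=> xc yc; apply: complex_cauchy => e e0.
have [M [K1 _ hM]] := fcauchy_bounded xc; have [L [K2 _ hL]] := fcauchy_bounded yc.
have M0 : 0 < `|M| + 1 by rewrite ltr_pwDr.
have L0 : 0 < `|L| + 1 by rewrite ltr_pwDr.
have e2 : 0 < e / 2 by rewrite divr_gt0.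
have [N1 h1] := xc _ (divr_gt0 e2 L0); have [N2 h2] := yc _ (divr_gt0 e2 M0).
exists (maxn (maxn K1 K2) (maxn N1 N2)) => m n.
rewrite !geq_max => /andP[/andP[a1 a2] /andP[a3 a4]] /andP[/andP[b1 b2] /andP[b3 b4]].
have -> : B (x m) (y m) - B (x n) (y n) = B (x m - x n) (y m) + B (x n) (y m - y n).
  by rewrite fmBl fmBr addrA subrK.
rewrite [X in _ < X](splitr e); apply: le_lt_trans (nmD _ _) _; rewrite ltrD //.
  apply: le_lt_trans (fnorm_CS B _ _) _.
  apply: le_lt_trans (_ : fnorm B (x m - x n) * (`|L| + 1) < _).
    rewrite ler_wpM2l ?fnorm_ge0 // (le_trans (hL _ a2)) // (le_trans (ler_norm _)) //.
    by rewrite lerDl.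
  by rewrite -ltr_pdivlMr // h1.
apply: le_lt_trans (fnorm_CS B _ _) _.
apply: le_lt_trans (_ : (`|M| + 1) * fnorm B (y m - y n) < _).
  rewrite ler_wpM2r ?fnorm_ge0 // (le_trans (hM _ b1)) // (le_trans (ler_norm _)) //.
  by rewrite lerDl.
by rewrite mulrC -ltr_pdivlMr // h2.
Qed.

Lemma crep_diff x x' f : crep x f -> crep x' f -> fnull (fun n => x' n - x n).
Proof.
move=> hx hx'; have := crep_lin (-1) hx hx'; rewrite scaleN1r addNr => -[zc zw].
have e : (fun n => -1 *: x n + x' n) = (fun n => x' n - x n).
  by apply/funext => n; rewrite scaleN1r addrC.
apply: fnull_of_weak => [|v]; first by rewrite -e.
by apply: (tends_eq (zw v)) => n; rewrite scaleN1r addrC.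
Qed.

(** Representatives of the same functional differ by a null sequence, and the other argument is
    bounded; this frees [cdot] from the choice of representatives. *)
Lemma crep_dot_uniq x y x' y' f g l : crep x f -> crep y g -> crep x' f -> crep y' g ->
  tends \oo (fun n => B (x n) (y n) : C^o) l ->
  tends \oo (fun n => B (x' n) (y' n) : C^o) l.
Proof.
move=> xf yg xf' yg' h.
have [M hM] := fcauchy_bounded (proj1 yg'); have [L hL] := fcauchy_bounded (proj1 xf).
pose proof (fnull_dot (crep_diff xf xf') hM) as h1.
pose proof (tends_conjC (fnull_dot (crep_diff yg yg') hL)) as h2.
rewrite rmorph0 in h2.
pose proof (tendsD (tendsD h h1) h2) as h3; rewrite !addr0 in h3.
apply: (tends_eq h3) => n; rewrite -fmC fmBl fmBr.
ring.
Qed.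

Lemma cset_lin c f g : (exists x, crep x f) -> (exists y, crep y g) ->
  exists z, crep z (c *: f + g).
Proof. by move=> [x xf] [y yg]; exists (fun n => c *: x n + y n); apply: crep_lin. Qed.

Definition cset : subspace (V -> C^o) :=
  Subspace (ex_intro (fun x => crep x 0) _ crep0 : [set f | exists x, crep x f] 0) cset_lin.

Local Notation T := (sp_type cset).

Definition crepr (f : T) : nat -> V := projT1 (cid (sp_valP f)).
Lemma creprP f : crep (crepr f) (sp_val f).
Proof. by rewrite /crepr; case: cid. Qed.

Lemma cdot_ex f g : exists l, tends \oo (fun n => B (crepr f n) (crepr g n) : C^o) l.
Proof. by apply: crep_dot_cauchy; apply: (proj1 (creprP _)). Qed.

Definition cdot (f g : T) : C := projT1 (cid (cdot_ex f g)).

Lemma cdotE x y f g : crep x (sp_val f) -> crep y (sp_val g) ->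
  tends \oo (fun n => B (x n) (y n) : C^o) (cdot f g).
Proof.
move=> xf yg; apply: crep_dot_uniq (creprP f) (creprP g) xf yg _.
by rewrite /cdot; case: cid.
Qed.

Lemma crep_linT c x y (f g : T) : crep x (sp_val f) -> crep y (sp_val g) ->
  crep (fun n => c *: x n + y n) (sp_val (c *: f + g)).
Proof. by rewrite sp_val_lin; apply: crep_lin. Qed.

Lemma cdotD f g h : cdot (f + g) h = cdot f h + cdot g h.
Proof.
have := crep_linT 1 (creprP f) (creprP g); rewrite scale1r => fg.
apply: (tends_uniq (cdotE fg (creprP h))).
apply: (tends_eq (tendsD (cdotE (creprP f) (creprP h)) (cdotE (creprP g) (creprP h)))) => n.
by rewrite fmD fmZ mul1r.
Qed.

Lemma cdotZ c f h : cdot (c *: f) h = c * cdot f h.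
Proof.
have h0 : crep (fun=> 0) (sp_val (0 : T)) by rewrite (lin0 (@sp_val_lin _ cset)); exact: crep0.
have := crep_linT c (creprP f) h0; rewrite addr0 => fg.
apply: (tends_uniq (cdotE fg (creprP h))).
apply: (tends_eq (tendsZ c (cdotE (creprP f) (creprP h)))) => n.
by rewrite fmD fmZ fm0l addr0.
Qed.

Lemma cdotC f g : cdot g f = (cdot f g)^*.
Proof.
apply: (tends_uniq (cdotE (creprP g) (creprP f))).
apply: (tends_eq (tends_conjC (cdotE (creprP f) (creprP g)))) => n.
by rewrite -fmC.
Qed.

Lemma cdot_ge0 f : 0 <= complex.Re (cdot f f).
Proof.
apply: (tends_Re_ge _ (cdotE (creprP f) (creprP f))).
by apply: nearW => n; apply: fm_ge0.
Qed.

Definition cform := Form cdotD cdotZ cdotC cdot_ge0.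

Lemma crep_fnorm x f : crep x (sp_val f) -> forall M, 0 <= M ->
  (\forall n \near \oo, fnorm B (x n) <= M) -> fnorm cform f <= M.
Proof.
move=> xf M M0 h; rewrite -ler_sqr ?nnegrE ?fnorm_ge0 // fnorm_sqr.
apply: (tends_Re_le _ (cdotE xf xf)); apply: filterS h => n hn.
by rewrite -fnorm_sqr ler_sqr ?nnegrE ?fnorm_ge0.
Qed.

Lemma cdef f : complex.Re (cform f f) = 0 -> f = 0.
Proof.
move=> f0; apply: sp_ext; rewrite (lin0 (@sp_val_lin _ cset)); apply/funext => v.
have [fc fE] := creprP f.
have hn : fnull (crepr f).
  move=> e e0; have := cdotE (creprP f) (creprP f).
  have e2 : 0 < e ^+ 2 by rewrite exprn_gt0.
  move=> /(_ _ e2); apply: filterS => n h.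
  rewrite -ltr_sqr ?nnegrE ?fnorm_ge0 ?ltW // fnorm_sqr.
  have := Re_le (B (crepr f n) (crepr f n) - cdot f f).
  rewrite ReB [complex.Re (cdot f f)]f0 subr0.
  by move=> /le_lt_trans; apply.
apply: (tends_uniq (fE v)); apply: (fnull_dot hn (M := fnorm B v)).
exact: nearW.
Qed.

Lemma crep_cst (v : V) : crep (fun=> v) (fun w => B v w).
Proof.
split=> [e e0|w]; last exact: tends_cst.
by exists 0%N => m n _ _; rewrite subrr fnorm0.
Qed.

Definition cinj (v : V) : T := sp_mk cset (fun w => B v w : C^o).

Lemma cinjE v : sp_val (cinj v) = (fun w => B v w).
Proof. by rewrite sp_mkE //; exists (fun=> v); apply: crep_cst. Qed.

Lemma crep_cinj v : crep (fun=> v) (sp_val (cinj v)).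
Proof. by rewrite cinjE; exact: crep_cst. Qed.

Lemma cinj_lin : linear cinj.
Proof.
move=> c x y; apply: sp_ext; rewrite sp_val_lin !cinjE; apply/funext => w.
by rewrite fmD fmZ.
Qed.

Lemma cdot_cinj v w : cdot (cinj v) (cinj w) = B v w.
Proof. by apply: (tends_uniq (cdotE (crep_cinj v) (crep_cinj w))); exact: tends_cst. Qed.

Lemma cdot_cinjr f v : cdot f (cinj v) = sp_val f v.
Proof.
apply: (tends_uniq (cdotE (creprP f) (crep_cinj v))).
exact: (proj2 (creprP f)).
Qed.

Lemma cinj_fnorm v : fnorm cform (cinj v) = fnorm B v.
Proof. by rewrite /fnorm /= cdot_cinj. Qed.

Lemma crep_cvg x f : crep x (sp_val f) -> fcvg cform (fun n => cinj (x n)) f.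
Proof.
move=> xf e e0; have e2 : 0 < e / 2 by rewrite divr_gt0.
have [N hN] := (proj1 xf) _ e2; exists N => // n Nn.
apply: le_lt_trans (_ : e / 2 < e); last by rewrite gtr_pMr // invf_lt1 // ltr1n.
have h := crep_linT (-1) xf (crep_cinj (x n)); rewrite scaleN1r addrC in h.
apply: (crep_fnorm h (ltW e2)); exists N => // m Nm.
by rewrite scaleN1r addrC ltW // hN.
Qed.

(** Each [u n] is approximated within [1/(n+1)] by a vector of [V]; these vectors form a Cauchy
    sequence, whose functional is the limit. *)
Lemma ccomplete u : fcauchy cform u -> exists l, fcvg cform u l.
Proof.
move=> uc.
have ex n : exists v, fnorm cform (cinj v - u n) < n.+1%:R^-1.
  have n0 : (0 : R) < n.+1%:R^-1 by rewrite invr_gt0.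
  have [N _ hN] := crep_cvg (creprP (u n)) n0.
  by exists (crepr (u n) N); apply: hN => /=.
have [x hx] := choice ex.
have xc : fcauchy B x.
  move=> e e0; have e3 : 0 < e / 3 by rewrite divr_gt0.
  have [N hN] := uc _ e3; have [M _ hM] := @near_infty_natSinv_lt R (PosNum e3).
  exists (maxn N M) => m n; rewrite !geq_max => /andP[Nm Mm] /andP[Nn Mn].
  rewrite -cinj_fnorm (linB cinj_lin).
  have e3E : e = e / 3 + (e / 3 + e / 3) by field.
  apply: le_lt_trans (fnorm_tri cform (u m) _ _) _; rewrite [X in _ < X]e3E ltrD //.
    exact: lt_trans (hx m) (hM m Mm).
  apply: le_lt_trans (fnorm_tri cform (u n) _ _) _; apply: ltrD; first exact: hN.
  rewrite fnorm_distC; exact: lt_trans (hx n) (hM n Mn).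
have exf v : exists l, tends \oo (fun n => B (x n) v : C^o) l.
  by apply: (crep_dot_cauchy xc) => e e0; exists 0%N => m n _ _; rewrite subrr fnorm0.
have [f hf] := choice exf.
have cf : crep x f by [].
exists (sp_mk cset f); set F := sp_mk cset f.
have cF : crep x (sp_val F) by rewrite sp_mkE //; exists x.
move=> e e0; have e2 : 0 < e / 2 by rewrite divr_gt0.
have [M _ hM] := @near_infty_natSinv_lt R (PosNum e2).
apply: filterS2 (crep_cvg cF e2) (near_ge M) => n h1 h2.
apply: le_lt_trans (fnorm_tri cform (cinj (x n)) _ _) _; rewrite [X in _ < X](splitr e).
apply: ltrD => //; rewrite fnorm_distC; exact: lt_trans (hx n) (hM n h2).
Qed.

Definition completion : hilbertType R := hd_hilbert (HilbertData cdef ccomplete).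

Lemma sp_val_conj (f : T) c v w : sp_val f (c *: v + w) = c^* * sp_val f v + sp_val f w.
Proof.
have [_ fE] := creprP f; apply: (tends_uniq (fE _)).
apply: (tends_eq (tendsD (tendsZ c^* (fE v)) (fE w))) => n.
by rewrite fmDr fmZr.
Qed.

Section Lift.
Variables (t t' : V -> V) (k : R).
Hypotheses (tl : linear t) (tadj : forall x y, B (t x) y = B x (t' y)).
Hypothesis tk : forall x, fnorm B (t x) <= k * fnorm B x.

(* The continuous extension of [t], expressed through the adjoint [t']. *)
Definition clift (f : T) : T := sp_mk cset (fun v => sp_val f (t' v)).

Lemma crep_lift x (f : T) : crep x (sp_val f) ->
  crep (fun n => t (x n)) (fun v => sp_val f (t' v)).
Proof.
move=> [xc xf]; split=> [e e0|v]; last by apply: (tends_eq (xf (t' v))) => n; rewrite tadj.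
have k0 : 0 < `|k| + 1 by rewrite ltr_pwDr.
have [N hN] := xc _ (divr_gt0 e0 k0); exists N => m n Nm Nn.
rewrite -(linB tl); apply: le_lt_trans (tk _) _.
apply: le_lt_trans (_ : (`|k| + 1) * fnorm B (x m - x n) < _).
  by rewrite ler_wpM2r ?fnorm_ge0 // (le_trans (ler_norm _)) // lerDl.
by rewrite mulrC -ltr_pdivlMr // hN.
Qed.

Lemma cliftE f v : sp_val (clift f) v = sp_val f (t' v).
Proof. by rewrite sp_mkE //; exists (fun n => t (crepr f n)); apply: crep_lift (creprP f). Qed.

Lemma crep_clift x f : crep x (sp_val f) -> crep (fun n => t (x n)) (sp_val (clift f)).
Proof.
move=> xf; have -> : sp_val (clift f) = (fun v => sp_val f (t' v)).
  by apply/funext => v; rewrite cliftE.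
exact: crep_lift.
Qed.

Lemma clift_lin : linear clift.
Proof.
move=> c f g; apply: sp_ext; apply/funext => v.
rewrite cliftE (sp_val_lin c f g) (sp_val_lin c (clift f) (clift g)).
by rewrite -[RHS]/(c *: sp_val (clift f) v + sp_val (clift g) v) !cliftE.
Qed.

Lemma clift_cinj v : clift (cinj v) = cinj (t v).
Proof.
apply: sp_ext; apply/funext => w; rewrite cliftE !cinjE.
by rewrite tadj.
Qed.

Lemma clift_fnorm f : 0 <= k -> fnorm cform (clift f) <= k * fnorm cform f.
Proof.
move=> k0; apply/ler_addgt0Pr => e e0.
have k1 : 0 < k + 1 by rewrite ltr_wpDl.
apply: (crep_fnorm (crep_clift (creprP f))).
  by apply: addr_ge0; [apply: mulr_ge0 => //; exact: fnorm_ge0|exact: ltW].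
apply: filterS (crep_cvg (creprP f) (divr_gt0 e0 k1)) => n.
rewrite ltr_pdivlMr // => h; apply: le_trans (tk _) _.
have := fnorm_subl cform (cinj (crepr f n)) f; rewrite cinj_fnorm.
set a := fnorm B _; set b := fnorm cform f; set c := fnorm cform (_ - _) in h * => h1.
have c0 : 0 <= c by exact: fnorm_ge0.
nra.
Qed.

End Lift.

Lemma clift_adj (t t' : V -> V) k (f g : T) :
  linear t -> linear t' -> (forall x y, B (t x) y = B x (t' y)) ->
  (forall x, fnorm B (t x) <= k * fnorm B x) -> (forall x, fnorm B (t' x) <= k * fnorm B x) ->
  cdot (clift t' f) g = cdot f (clift t g).
Proof.
move=> tl tl' tadj tk tk'.
have tadj' x y : B (t' x) y = B x (t y) by rewrite fmC -tadj -fmC.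
have h1 := crep_clift tl tadj tk (creprP f).
have h2 := crep_clift tl' tadj' tk' (creprP g).
apply: (tends_uniq (cdotE h1 (creprP g))).
by apply: (tends_eq (cdotE (creprP f) h2)) => n; rewrite tadj.
Qed.

End Completion.
End Subspace.

(** * The GNS construction for a sequence of states *)

Section GNS.
Variable R : realType.
Local Notation C := R[i].
Variable A : cstarAlgType R.

(** The second clause makes [psi (star a ** a)] real, so positivity is put on its real part;
    boundedness is a consequence, [state_nm]. *)
Definition state (psi : A -> C) :=
  [/\ linear (psi : A -> C^o), forall a, psi (star a) = (psi a)^*,
      forall a, 0 <= complex.Re (psi (star a ** a)) & psi cone = 1].

Section OneState.
Variable psi : A -> C.
Hypothesis hpsi : state psi.

Lemma state_lin : linear (psi : A -> C^o). Proof. by have [] := hpsi. Qed.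
Lemma stateD a b : psi (a + b) = psi a + psi b. Proof. exact: (linD state_lin). Qed.
Lemma stateB a b : psi (a - b) = psi a - psi b. Proof. exact: (linB state_lin). Qed.
Lemma stateZ c a : psi (c *: a) = c * psi a. Proof. exact: (linZ state_lin). Qed.
Lemma state0 : psi 0 = 0. Proof. exact: (lin0 state_lin). Qed.
Lemma state1 : psi cone = 1. Proof. by have [] := hpsi. Qed.
Lemma state_pos a : 0 <= complex.Re (psi (star a ** a)). Proof. by have [] := hpsi. Qed.
Lemma state_star a : psi (star a) = (psi a)^*. Proof. by have [] := hpsi. Qed.

Let sdot (a b : A) : C := psi (star b ** a).
Let sdotD a b c : sdot (a + b) c = sdot a c + sdot b c.
Proof. by rewrite /sdot cmulDr stateD. Qed.
Let sdotZ c a b : sdot (c *: a) b = c * sdot a b.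
Proof. by rewrite /sdot cmulZr stateZ. Qed.
Let sdotC a b : sdot b a = (sdot a b)^*.
Proof. by rewrite /sdot -state_star starM starK. Qed.
Definition state_form := Form sdotD sdotZ sdotC state_pos.

(** For [nm b <= 1] take [w] with [w ** w = cone - star b ** b]: the gap between the two sides is
    the value of [psi] at [star (w ** x) ** (w ** x)]. This bounds left multiplication on the GNS
    space. *)
Lemma state_mul_le a x : complex.Re (psi (star (a ** x) ** (a ** x))) <=
  nm a ^+ 2 * complex.Re (psi (star x ** x)).
Proof.
have key b : nm b <= 1 ->
    complex.Re (psi (star (b ** x) ** (b ** x))) <= complex.Re (psi (star x ** x)).
  move=> b1; have [] := @cstar_sqrt R A (star b ** b).
  - by rewrite starM starK.
  - by rewrite nm_starM expr_le1 // nm_ge0.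
  move=> w [ws ww _ _]; have := state_pos (w ** x).
  rewrite !starM ws -cmulA (cmulA w) ww cmulBl cmul1l cmulBr stateB ReB.
  by rewrite !cmulA; lra.
have [->|a0] := eqVneq a 0.
  by rewrite cmul0l cmul0r state0 nm0 expr0n mul0r.
have [b [b1 ->]] := unit_scale a0.
rewrite nmZr ?nm_ge0 // b1 mulr1 cmulZl starZ conj_rc cmulZl cmulZr !stateZ !Re_rc.
rewrite mulrA -expr2 ler_wpM2l ?sqr_ge0 //; apply: key; by rewrite b1.
Qed.

Lemma state_CS a : cabs (psi a) ^+ 2 <= complex.Re (psi (star a ** a)).
Proof.
have := form_CS state_form a cone; rewrite /= /sdot star1 !cmul1l state1 /=.
by rewrite mulr1.
Qed.

Lemma state_nm a : cabs (psi a) <= nm a.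
Proof.
rewrite -ler_sqr ?nnegrE ?cabs_ge0 ?nm_ge0 //; apply: le_trans (state_CS a) _.
by have := state_mul_le a cone; rewrite star1 !cmul1r state1 /= mulr1.
Qed.
End OneState.

Lemma char_state chi : character chi -> state chi.
Proof.
move=> hc; split; [exact: char_lin|exact: char_star| |exact: char1].
by move=> a; rewrite charM // char_star // mulrC mulconj /= sqr_ge0.
Qed.

Lemma wsp0 : exists N, forall n, (N <= n)%N -> (0 : nat -> A) n = 0.
Proof. by exists 0%N. Qed.
Lemma wsp_lin (c : C) (x y : nat -> A) : (exists N, forall n, (N <= n)%N -> x n = 0) ->
  (exists N, forall n, (N <= n)%N -> y n = 0) ->
  exists N, forall n, (N <= n)%N -> (c *: x + y) n = 0.
Proof.
move=> [N hN] [M hM]; exists (maxn N M) => n; rewrite geq_max => /andP[h1 h2].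
have e : (c *: x + y) n = c *: x n + y n by [].
by rewrite e (hN n h1) (hM n h2) scaler0 addr0.
Qed.

(* Finitely supported sequences in [A]; they carry the pre-inner product of the direct sum of
   the GNS spaces of the [psi n]. *)
Definition wsp : subspace (nat -> A) :=
  Subspace (wsp0 : [set x | exists N, forall n, (N <= n)%N -> x n = 0] 0) wsp_lin.
Local Notation W := (sp_type wsp).

Definition wbound (w : W) : nat := projT1 (cid (sp_valP w)).
Lemma wboundP (w : W) n : (wbound w <= n)%N -> sp_val w n = 0.
Proof. by rewrite /wbound; case: cid => N /= h; apply: h. Qed.

Lemma w_linE (c : C) (x y : W) n : sp_val (c *: x + y) n = c *: sp_val x n + sp_val y n.
Proof. by rewrite sp_val_lin. Qed.

Lemma sum_tail (t : nat -> C) N M : (forall n, (N <= n)%N -> t n = 0) -> (N <= M)%N ->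
  \sum_(i < M) t i = \sum_(i < N) t i.
Proof.
move=> h; elim: M => [|M IH]; first by rewrite leqn0 => /eqP ->.
rewrite leq_eqVlt => /predU1P[->//|]; rewrite ltnS => NM.
by rewrite big_ord_recr /= IH // h // addr0.
Qed.

Section Sum.
Variable psi : nat -> A -> C.
Hypothesis hpsi : forall n, state (psi n).

(** [wbound] is an arbitrary bound on the support; [wdotE] shows that any other gives the same
    sum. *)
Definition wdot (w w' : W) : C :=
  \sum_(n < wbound w) psi n (star (sp_val w' n) ** sp_val w n).

Lemma wdotE (w w' : W) N : (forall n, (N <= n)%N -> sp_val w n = 0) ->
  wdot w w' = \sum_(n < N) psi n (star (sp_val w' n) ** sp_val w n).
Proof.
move=> h; pose t n := psi n (star (sp_val w' n) ** sp_val w n).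
have t0 n : sp_val w n = 0 -> t n = 0 by move=> e; rewrite /t e cmul0r state0.
have h1 : forall n, (wbound w <= n)%N -> t n = 0 by move=> n /wboundP /t0.
have h2 : forall n, (N <= n)%N -> t n = 0 by move=> n /h /t0.
rewrite /wdot -/(\sum_(n < wbound w) t n) -/(\sum_(n < N) t n).
by rewrite -(sum_tail h1 (leq_maxl _ N)) -(sum_tail h2 (leq_maxr (wbound w) _)).
Qed.

Lemma wdotD (x y z : W) : wdot (x + y) z = wdot x z + wdot y z.
Proof.
pose N := maxn (wbound x) (wbound y).
have hx n : (N <= n)%N -> sp_val x n = 0.
  by rewrite geq_max => /andP[h _]; exact: wboundP.
have hy n : (N <= n)%N -> sp_val y n = 0.
  by rewrite geq_max => /andP[_ h]; exact: wboundP.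
have E n : sp_val (x + y) n = sp_val x n + sp_val y n.
  by have := w_linE 1 x y n; rewrite !scale1r.
have hxy n : (N <= n)%N -> sp_val (x + y) n = 0.
  by move=> h; rewrite E hx // hy // addr0.
rewrite (wdotE _ hxy) (wdotE _ hx) (wdotE _ hy) -big_split.
by apply: eq_bigr => n _; rewrite E cmulDr stateD.
Qed.

Lemma wdotZ c (x y : W) : wdot (c *: x) y = c * wdot x y.
Proof.
have E n : sp_val (c *: x) n = c *: sp_val x n.
  by rewrite (linZ (@sp_val_lin _ _ wsp)).
have h n : (wbound x <= n)%N -> sp_val (c *: x) n = 0.
  by move=> /wboundP xn; rewrite E xn scaler0.
rewrite (wdotE _ h) /wdot mulr_sumr; apply: eq_bigr => n _.
by rewrite E cmulZr stateZ.
Qed.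

Lemma wdotC (x y : W) : wdot y x = (wdot x y)^*.
Proof.
pose N := maxn (wbound x) (wbound y).
have hx n : (N <= n)%N -> sp_val x n = 0.
  by rewrite geq_max => /andP[h _]; exact: wboundP.
have hy n : (N <= n)%N -> sp_val y n = 0.
  by rewrite geq_max => /andP[_ h]; exact: wboundP.
rewrite (wdotE _ hx) (wdotE _ hy) rmorph_sum; apply: eq_bigr => n _.
rewrite (_ : star (sp_val x n) ** _ = star (star (sp_val y n) ** sp_val x n)).
  exact: state_star.
by rewrite starM starK.
Qed.

Lemma Re_sum n (t : 'I_n -> C) : complex.Re (\sum_(i < n) t i) = \sum_(i < n) complex.Re (t i).
Proof.
by elim: n t => [|n IH] t; rewrite ?big_ord0 // !big_ord_recl ReD IH.
Qed.

Lemma wdot_ge0 (x : W) : 0 <= complex.Re (wdot x x).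
Proof. by rewrite /wdot Re_sum sumr_ge0 // => n _; apply: state_pos. Qed.

Definition wform := Form wdotD wdotZ wdotC wdot_ge0.

Definition wmap (phi : A -> A) (w : W) : W := sp_mk wsp (fun n => phi (sp_val w n)).

Lemma wmapE phi w n : phi 0 = 0 -> sp_val (wmap phi w) n = phi (sp_val w n).
Proof.
move=> phi0; rewrite sp_mkE //; exists (wbound w) => m /wboundP ->.
exact: phi0.
Qed.

Lemma wext (x y : W) : (forall n, sp_val x n = sp_val y n) -> x = y.
Proof. by move=> h; apply: sp_ext; apply/funext. Qed.

Lemma wmap_lin phi : linear phi -> linear (wmap phi).
Proof.
move=> pl c x y; apply: wext => n.
by rewrite w_linE !wmapE ?(lin0 pl) // w_linE pl.
Qed.

Lemma wdot_map phi x y : linear phi ->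
  wdot (wmap phi x) y = \sum_(n < wbound x) psi n (star (sp_val y n) ** phi (sp_val x n)).
Proof.
move=> pl; have h n : (wbound x <= n)%N -> sp_val (wmap phi x) n = 0.
  by move=> /wboundP xn; rewrite wmapE ?(lin0 pl) // xn (lin0 pl).
rewrite (wdotE _ h); apply: eq_bigr => n _.
by rewrite wmapE // (lin0 pl).
Qed.

Definition lmulw a := wmap (cmul a).

Lemma lmulw_lin a : linear (lmulw a).
Proof. exact: wmap_lin (cmul_linr a). Qed.

Lemma lmulwE a w n : sp_val (lmulw a w) n = a ** sp_val w n.
Proof. by rewrite wmapE // cmul0r. Qed.

Lemma lmulw_adj a x y : wdot (lmulw a x) y = wdot x (lmulw (star a) y).
Proof.
rewrite wdot_map; last exact: cmul_linr.
by apply: eq_bigr => n _; rewrite lmulwE starM starK cmulA.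
Qed.

Lemma lmulw_norm a x : fnorm wform (lmulw a x) <= nm a * fnorm wform x.
Proof.
rewrite -ler_sqr ?nnegrE ?mulr_ge0 ?fnorm_ge0 ?nm_ge0 // exprMn !fnorm_sqr /=.
rewrite wdot_map; last exact: cmul_linr.
rewrite !Re_sum mulr_sumr ler_sum // => n _; rewrite lmulwE.
exact: state_mul_le.
Qed.

Local Notation H := (completion wform).

(** [clift] is given the adjoint, so left multiplication by [a] appears through [star a]; likewise
    [galw g] is built from [g^-1]. *)
Definition gns (a : A) : H -> H := clift (B := wform) (lmulw (star a)).

Lemma gnsE a (f : H) v : sp_val (gns a f : sp_type _) v =
  sp_val (f : sp_type (cset wform)) (lmulw (star a) v).
Proof. exact: (cliftE (B := wform) (@lmulw_lin a) (@lmulw_adj a) (@lmulw_norm a)). Qed.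

Lemma gns_ext (f g : H) : (forall v, sp_val (f : sp_type (cset wform)) v =
   sp_val (g : sp_type (cset wform)) v) -> f = g.
Proof. by move=> h; apply: sp_ext; apply/funext. Qed.

Lemma gns_lin a : linear (gns a).
Proof. exact: (clift_lin (B := wform) (@lmulw_lin a) (@lmulw_adj a) (@lmulw_norm a)). Qed.

Lemma gns_nm a (f : H) : nm (gns a f) <= nm a * nm f.
Proof. by apply: (clift_fnorm (B := wform) (@lmulw_lin a) (@lmulw_adj a) (@lmulw_norm a)); apply: nm_ge0. Qed.

Lemma lip_continuous (V : normedModType C) (f : V -> V) k : linear f ->
  (forall x, nm (f x) <= k * nm x) -> continuous f.
Proof.
move=> fl fk x; apply/tendsE => e e0.
have k0 : 0 < `|k| + 1 by rewrite ltr_pwDr.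
have e0' : 0 < (rc (e / (`|k| + 1)) : C) by rewrite lt_rc divr_gt0.
have := @nbhsx_ballx _ V x _ e0'; apply: filterS => y; rewrite -ball_normE /= nmE lt_rc nmC.
rewrite ltr_pdivlMr // -(linB fl) => h; apply: le_lt_trans (fk _) _; apply: le_lt_trans h.
by rewrite mulrC ler_wpM2l ?nm_ge0 // (le_trans (ler_norm _)) // lerDl.
Qed.

Lemma gns_rep : representation gns.
Proof.
split=> [a _|c a b _ _ x|a b _ _ x|x|a _ x y].
- by split; [exact: gns_lin|exact: (lip_continuous (gns_lin a) (gns_nm a))].
- apply: gns_ext => v; rewrite gnsE.
  have -> : sp_val (c *: gns a x + gns b x : sp_type (cset wform)) v =
     c * sp_val (gns a x : sp_type (cset wform)) v + sp_val (gns b x : sp_type (cset wform)) v.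
    by rewrite (sp_val_lin c (gns a x : sp_type (cset wform)) (gns b x : sp_type _)).
  rewrite !gnsE.
  have -> : lmulw (star (c *: a + b)) v = c^* *: lmulw (star a) v + lmulw (star b) v.
    by apply: wext => n; rewrite w_linE !lmulwE starD starZ cmulDl cmulZl.
  by rewrite sp_val_conj conjCK.
- apply: gns_ext => v; rewrite !gnsE; congr (sp_val _ _).
  by apply: wext => n; rewrite !lmulwE starM cmulA.
- apply: gns_ext => v; rewrite !gnsE; congr (sp_val _ _).
  by apply: wext => n; rewrite lmulwE star1 cmul1l.
- have h := @clift_adj _ _ wform (lmulw a) (lmulw (star a)) (nm a) x y (@lmulw_lin a) (@lmulw_lin (star a)).
  rewrite /gns starK; apply: h.
  + exact: lmulw_adj.
  + exact: lmulw_norm.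
  + by move=> v; have := lmulw_norm (star a) v; rewrite nm_star.
Qed.

Definition wdelta n a : W := sp_mk wsp (fun m => if m == n then a else 0).
Lemma wdeltaE n a m : sp_val (wdelta n a) m = if m == n then a else 0.
Proof.
rewrite sp_mkE //; exists n.+1 => k nk.
by case: eqP => // kn; rewrite kn ltnn in nk.
Qed.

Definition gvec n : H := cinj wform (wdelta n cone).

Lemma gns_gvec a n : gns a (gvec n) = cinj wform (wdelta n a).
Proof.
rewrite /gns /gvec (clift_cinj (B := wform) (@lmulw_lin a) (@lmulw_adj a) (@lmulw_norm a)); congr cinj.
apply: wext => m; rewrite lmulwE !wdeltaE.
by case: eqP => _; rewrite ?cmul1r ?cmul0r.
Qed.

Lemma wdot_delta n a w : wdot (wdelta n a) w = psi n (star (sp_val w n) ** a).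
Proof.
have h m : (n.+1 <= m)%N -> sp_val (wdelta n a) m = 0.
  by rewrite wdeltaE; case: eqP => // ->; rewrite ltnn.
rewrite (wdotE _ h) big_ord_recr /= big1 ?add0r => [|i _].
  by rewrite wdeltaE eqxx.
by rewrite wdeltaE ltn_eqF // cmul0r state0.
Qed.

Lemma gns_dot a n : hdot (gns a (gvec n)) (gvec n) = psi n a.
Proof.
rewrite gns_gvec; transitivity (wdot (wdelta n a) (wdelta n cone)).
  exact: (cdot_cinj wform).
by rewrite wdot_delta wdeltaE eqxx star1 cmul1l.
Qed.

Lemma gvec_nm n : nm (gvec n) = 1.
Proof.
have := gns_dot cone n; rewrite (rep1 gns_rep) hdot_nm state1 // => /(@rcI R _ 1) h.
by apply/eqP; rewrite -(@eqrXn2 _ 2) ?nm_ge0 // h expr1n.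
Qed.

Lemma w_decomp (w : W) N : (forall n, (N <= n)%N -> sp_val w n = 0) ->
  w = \sum_(i < N) wdelta i (sp_val w i).
Proof.
move=> h; apply: wext => m.
have E k (v : 'I_k -> W) : sp_val (\sum_(i < k) v i) m = \sum_(i < k) sp_val (v i) m.
  elim: k v => [|k IH] v; first by rewrite !big_ord0 (lin0 (@sp_val_lin _ _ wsp)).
  by rewrite !big_ord_recl (linD (@sp_val_lin _ _ wsp)) -IH.
rewrite E; under eq_bigr do rewrite wdeltaE.
have [mN|Nm] := ltnP m N.
  rewrite (bigD1 (Ordinal mN)) //= eqxx big1 ?addr0 // => i im.
  by case: eqP => // mi; case/eqP: im; apply: val_inj.
rewrite h // big1 // => i _; case: eqP => // mi.
by have := ltn_ord i; rewrite -mi ltnNge Nm.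
Qed.

(** The functional [f] at [wdelta n a] is its inner product with [gns a (gvec n)], and every
    finitely supported sequence is a sum of such [wdelta]. *)
Lemma gns_total (f : H) : (forall n a, hdot f (gns a (gvec n)) = 0) -> f = 0.
Proof.
move=> h; apply: gns_ext => v; rewrite (lin0 (@sp_val_lin _ _ (cset wform))).
have hd n a : sp_val (f : sp_type (cset wform)) (wdelta n a) = 0.
  by rewrite -cdot_cinjr -gns_gvec; apply: h.
have hN k (u : 'I_k -> W) : (forall i, sp_val (f : sp_type (cset wform)) (u i) = 0) ->
    sp_val (f : sp_type (cset wform)) (\sum_(i < k) u i) = 0.
  elim: k u => [|k IH] u hu.
    by rewrite big_ord0 -cdot_cinjr (lin0 (cinj_lin wform)); exact: (fm0r (cform wform)).
  by rewrite big_ord_recl -(scale1r (u ord0)) sp_val_conj hu mulr0 add0r IH.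
rewrite (w_decomp (@wboundP v)); apply: hN => i; exact: hd.
Qed.

Section Action.
Variables (Gam : groupType) (al : Gam -> A -> A).
Hypotheses (hal : forall g, star_hom (al g)) (alM : forall g h a, al (g * h)%g a = al g (al h a)).
Hypotheses (al1 : forall a, al 1%g a = a) (psi_al : forall n g a, psi n (al g a) = psi n a).

Let all g : linear (al g). Proof. exact: hom_lin. Qed.
Let al0 g : al g 0 = 0. Proof. exact: (lin0 (@all g)). Qed.

(** Invariance of the states makes the entrywise action preserve the form, so its adjoint is the
    action of the inverse. *)
Lemma alw_adj g x y : wdot (wmap (al g) x) y = wdot x (wmap (al g^-1%g) y).
Proof.
rewrite wdot_map //; apply: eq_bigr => n _; rewrite wmapE //.
by rewrite -[RHS](psi_al n g) homM // hom_star // -alM mulgV al1.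
Qed.

Lemma alw_norm g x : fnorm wform (wmap (al g) x) <= 1 * fnorm wform x.
Proof.
rewrite mul1r /fnorm /= alw_adj (_ : wmap _ _ = x) //.
by apply: wext => n; rewrite !wmapE // -alM mulVg al1.
Qed.

Definition galw (g : Gam) : H -> H := clift (B := wform) (wmap (al g^-1%g)).

Lemma galwE g (f : H) v : sp_val (galw g f : sp_type (cset wform)) v =
  sp_val (f : sp_type (cset wform)) (wmap (al g^-1%g) v).
Proof. exact: (cliftE (B := wform) (wmap_lin (@all g)) (@alw_adj g) (@alw_norm g)). Qed.

Lemma galw_rep : unitary_rep galw.
Proof.
have M g h x : galw (g * h)%g x = galw g (galw h x).
  apply: gns_ext => v; rewrite !galwE; congr (sp_val _ _).
  by apply: wext => n; rewrite !wmapE // invgM alM.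
have one x : galw 1%g x = x.
  apply: gns_ext => v; rewrite !galwE; congr (sp_val _ _).
  by apply: wext => n; rewrite wmapE // invg1 al1.
split=> // g; first exact: (clift_lin (B := wform) (wmap_lin (@all g)) (@alw_adj g) (@alw_norm g)).
move=> x y.
have h := @clift_adj _ _ wform (wmap (al g)) (wmap (al g^-1%g)) 1 x (galw g y)
  (wmap_lin (@all g)) (wmap_lin (@all g^-1%g)) (@alw_adj g) (@alw_norm g) (@alw_norm _).
rewrite [LHS]h -[RHS]/(cdot _ _); congr cdot.
have := M g^-1%g g y; rewrite mulVg one => e.
by rewrite [RHS]e /galw invgK.
Qed.

Lemma galw_cov g a x : galw g (gns a x) = gns (al g a) (galw g x).
Proof.
apply: gns_ext => v.
rewrite (galwE g (gns a x)) (gnsE a x) (gnsE (al g a) (galw g x)) (galwE g x).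
congr (sp_val _ _); apply: wext => n; rewrite lmulwE !wmapE ?cmul0r // (homM (hal _)) (hom_star (hal _)).
by rewrite -alM mulVg al1.
Qed.

Lemma galw_gvec g n : galw g (gvec n) = gvec n.
Proof.
rewrite /galw /gvec (clift_cinj (B := wform) (wmap_lin (@all g)) (@alw_adj g) (@alw_norm g)); congr cinj.
apply: wext => m; rewrite wmapE // !wdeltaE.
by case: eqP => _ //; rewrite hom1.
Qed.

End Action.

(** Property (T) needs the vectors of all [psi n] in one representation. The totality clause makes a
    nonzero fixed vector visible from some [xi n]; the action clause keeps the [xi n] exactly fixed
    by the group. *)
Lemma gns_sum : exists (K : hilbertType R) (pi : A -> K -> K) (xi : nat -> K),
  [/\ representation pi, forall n, nm (xi n) = 1,
      forall n a, hdot (pi a (xi n)) (xi n) = psi n a,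
      forall f, (forall n a, hdot f (pi a (xi n)) = 0) -> f = 0
    & forall (Gam : groupType) (al : Gam -> A -> A),
        (forall g, star_hom (al g)) -> (forall g h a, al (g * h)%g a = al g (al h a)) ->
        (forall a, al 1%g a = a) -> (forall n g a, psi n (al g a) = psi n a) ->
        exists U, [/\ unitary_rep U, forall g a x, U g (pi a x) = pi (al g a) (U g x)
          & forall g n, U g (xi n) = xi n]].
Proof.
exists H, gns, gvec; split.
- exact: gns_rep.
- exact: gvec_nm.
- by move=> n a; apply: gns_dot.
- exact: gns_total.
- move=> Gam al h1 h2 h3 h4; exists (galw al); split.
  + exact: galw_rep.
  + by move=> g a x; apply: galw_cov.
  + by move=> g n; apply: galw_gvec.
Qed.
End Sum.

End GNS.

(** * Property (T) and states *)

Section States.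
Variable R : realType.
Local Notation C := R[i].

Lemma almost_fixedP (I : Type) (H : hilbertType R) (S : I -> H -> H) (chi : I -> C) :
  almost_fixed S chi <-> exists xi : nat -> H, (forall n, nm (xi n) = 1) /\
    forall i, tends \oo (fun n => S i (xi n) - chi i *: xi n) 0.
Proof.
split=> -[xi [h1 h2]]; exists xi; split=> n; try exact/nm_eq1.
  by apply/tendsE; exact: h2.
by apply/tendsE; exact: h2.
Qed.

Lemma almost_fixed_near (I : Type) (H : hilbertType R) (S : I -> H -> H) (chi : I -> C)
    (v : nat -> H) (d : R) : 0 < d -> (forall i, linear (S i)) ->
  (forall n, d <= nm (v n)) ->
  (forall i, tends \oo (fun n => S i (v n) - chi i *: v n) 0) -> almost_fixed S chi.
Proof.
move=> d0 Sl vd h; apply/almost_fixedP; exists (fun n => rc (nm (v n))^-1 *: v n).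
have v0 n : 0 < nm (v n) := lt_le_trans d0 (vd n).
split=> [n|i]; first by rewrite nmZr ?invr_ge0 ?nm_ge0 // mulVf // gt_eqF.
apply: (tends_squeeze (k := d^-1)) (h i); apply: nearW => n.
rewrite (linZ (Sl i)) scalerA mulrC -scalerA -scalerBr nmZr ?invr_ge0 ?nm_ge0 //.
by rewrite ler_wpM2r ?nm_ge0 // lef_pV2 ?posrE.
Qed.

(** The squared defect of [xi n] at [a] is [psi n (star b ** b)] with [b = a - eps a *: cone], and
    [eps] vanishes at [star b ** b]. *)
Lemma rep_almost (A : cstarAlgType R) (eps : A -> C) (H : hilbertType R) (pi : A -> H -> H)
    (psi : nat -> A -> C) (xi : nat -> H) :
  character eps -> representation pi ->
  (forall n a, hdot (pi a (xi n)) (xi n) = psi n a) ->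
  (forall a, tends \oo (fun n => psi n a : C^o) (eps a)) ->
  forall a, tends \oo (fun n => pi a (xi n) - eps a *: xi n) 0.
Proof.
move=> he hpi hdE hlim a e e0; pose b := a - eps a *: cone.
have eb : eps (star b ** b) = 0.
  by rewrite charM // /b charB // charZ // char1 // mulr1 subrr mulr0.
have e2 : 0 < e ^+ 2 by rewrite exprn_gt0.
have := hlim (star b ** b) _ e2; apply: filterS => n; rewrite eb !subr0.
have -> : pi a (xi n) - eps a *: xi n = pi b (xi n).
  by rewrite /b (linB (rep_linA hpi _)) (linZ (rep_linA hpi _)) rep1.
rewrite -hdE rep_sqr // => h.
have {h} : cabs (rc (nm (pi b (xi n)) ^+ 2)) < e ^+ 2 by [].
by rewrite cabsR ger0_norm ?sqr_ge0 // ltr_sqr ?nnegrE ?nm_ge0 ?ltW.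
Qed.

(** By totality a fixed [eta] is not orthogonal to some [xi n]. As [hdot (pi a (xi n)) eta = eps a *
    hdot (xi n) eta], Cauchy-Schwarz gives the bound, with [c] the squared quotient of
    [cabs (hdot (xi n) eta)] by [nm eta]. *)
Lemma fixed_state (A : cstarAlgType R) (eps : A -> C) (H : hilbertType R) (pi : A -> H -> H)
    (psi : nat -> A -> C) (xi : nat -> H) :
  character eps -> representation pi ->
  (forall n a, hdot (pi a (xi n)) (xi n) = psi n a) ->
  (forall f, (forall n a, hdot f (pi a (xi n)) = 0) -> f = 0) ->
  has_fixed pi eps ->
  exists n c, 0 < c /\ forall a, c * cabs (eps a) ^+ 2 <= complex.Re (psi n (star a ** a)).
Proof.
move=> he hpi hdE htot [eta eta0 hfix].
have key n a : hdot (pi a (xi n)) eta = eps a * hdot (xi n) eta.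
  by rewrite rep_adj // hfix hdotZr char_star // conjCK.
have [n hn] : exists n, hdot (xi n) eta != 0.
  apply: contrapT => hN; case/eqP: eta0; apply: htot => n a.
  have h0 : hdot (xi n) eta = 0.
    by apply/eqP; case: eqP => // /eqP h; case: hN; exists n.
  by rewrite hdotC key h0 mulr0 rmorph0.
have ne := nm_gt0 eta0.
have nx : 0 < cabs (hdot (xi n) eta).
  rewrite lt0r cabs_ge0 andbT; apply: contra_neq hn => h; exact: cabs0_eq0.
exists n, (cabs (hdot (xi n) eta) ^+ 2 / nm eta ^+ 2); split.
  by rewrite divr_gt0 // exprn_gt0.
move=> a; rewrite -hdE rep_sqr // [complex.Re _]/= mulrAC ler_pdivrMr ?exprn_gt0 //.
rewrite -!exprMn ler_sqr ?nnegrE ?mulr_ge0 ?cabs_ge0 ?nm_ge0 // mulrC -cabsM -key.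
exact: hdot_CS.
Qed.

Lemma dual_T_states (G : compact_quantum_group R) (psi : nat -> Cm G -> C) :
  dual_property_T G -> (forall n, state (psi n)) ->
  (forall a, tends \oo (fun n => psi n a : C^o) (@counit R G a)) ->
  exists n c, 0 < c /\
    forall a, c * cabs (@counit R G a) ^+ 2 <= complex.Re (psi n (star a ** a)).
Proof.
move=> hT hs hlim; have [H [pi [xi [h1 h2 h3 h4 _]]]] := gns_sum hs.
apply: (fixed_state (counit_char G) h1 h3 h4); apply: hT => //; apply/almost_fixedP.
exists xi; split=> // a; exact: (rep_almost (counit_char G) h1 h3 hlim).
Qed.

(** * Consequences of property (T) of the crossed product *)

Section Crossed.
Variables (Gam : groupType) (G : compact_quantum_group R) (al : Gam -> Cm G -> Cm G).
Hypothesis hal : quantum_action al.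
Variable GG : compact_quantum_group R.
Variables (iota : Cm G -> Cm GG) (u : Gam -> Cm GG).
Hypothesis hfull : full_crossed_product al iota u.
Hypothesis hu : forall g, Delta (u g) = tens (Cm2 GG) (u g) (u g).
Hypothesis hiota : exists F : Cm2 G -> Cm2 GG,
  tensor_hom iota iota F /\ forall a, Delta (iota a) = F (Delta a).

Lemma iota_hom : star_hom iota. Proof. by have [[]] := hfull. Qed.

Lemma u_unitary g : star (u g) ** u g = cone. Proof. by have [_ [h _ _ _] _ _ _] := hfull. Qed.

Lemma counit_u g : @counit R GG (u g) = 1.
Proof.
apply: counit_grouplike => //; apply/eqP => u0.
by have := u_unitary g; rewrite u0 cmul0r => /esym/eqP; rewrite (negbTE (@cone_neq0 R _)).
Qed.

Lemma counit_iota a : @counit R GG (iota a) = @counit R G a.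
Proof.
have [F [hF FD]] := hiota.
exact: (congr1 (fun f => f a) (counit_hom iota_hom hF FD)).
Qed.

Lemma crossed_dense : dense (linear_span [set z | exists g a, z = u g ** iota a]).
Proof. by have [_ _ _ h _] := hfull. Qed.

Lemma crossed_fixed (H : hilbertType R) (sg : Cm GG -> H -> H) (eta : H) :
  representation sg -> (forall a, sg (iota a) eta = @counit R G a *: eta) ->
  (forall g, sg (u g) eta = eta) -> forall b, sg b eta = @counit R GG b *: eta.
Proof.
move=> hs h1 h2.
apply: (@lin_ext R (Cm GG) H _ (fun b => sg b eta) (fun b => @counit R GG b *: eta)
  (nm eta) (nm eta) crossed_dense).
- exact: rep_linA.
- by move=> c x y; rewrite charD ?charZ ?scalerDl ?scalerA //; exact: counit_char.
- by move=> x; rewrite mulrC; exact: rep_nm.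
- move=> x; rewrite nmZ mulrC ler_wpM2l ?nm_ge0 //.
  exact: (char_nm (counit_char GG)).
- move=> _ [g [a ->]]; rewrite repM // h1 (linZ (rep_lin hs _)) h2.
  rewrite charM ?counit_u ?counit_iota ?mul1r //; exact: counit_char.
Qed.

Lemma crossed_almost (H : hilbertType R) (sg : Cm GG -> H -> H) (xi : nat -> H) :
  representation sg -> (forall n, nm (xi n) = 1) ->
  (forall a, tends \oo (fun n => sg (iota a) (xi n) - @counit R G a *: xi n) 0) ->
  (forall g, tends \oo (fun n => sg (u g) (xi n) - xi n) 0) ->
  forall b, tends \oo (fun n => sg b (xi n) - @counit R GG b *: xi n) 0.
Proof.
move=> hs x1 h1 h2.
have hc := counit_char GG.
apply: (@tends_dense_lin R nat \oo _ (Cm GG) H _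
  (fun n b => sg b (xi n) - @counit R GG b *: xi n) (fun=> 0) 2 crossed_dense).
- move=> n c x y; rewrite (rep_linA hs) charD // charZ // scalerDl opprD addrACA.
  by rewrite -scalerA scalerBr.
- by move=> c x y; rewrite scaler0 addr0.
- move=> n x; apply: le_trans (nmB _ _) _; rewrite nmZ x1 mulr1.
  have := rep_nm hs x (xi n); have := char_nm hc x; rewrite x1; lra.
- by move=> x; rewrite nm0 mulr_ge0 ?nm_ge0.
- move=> _ [g [a ->]].
  pose proof (tendsD (tends_rep hs (u g) (h1 a)) (tendsZ (@counit R G a) (h2 g))) as h3.
  rewrite (lin0 (rep_lin hs _)) scaler0 addr0 in h3.
  apply: (tends_eq h3) => n.
  rewrite (linB (rep_lin hs _)) (linZ (rep_lin hs _)) repM // scalerBr addrA subrK.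
  by rewrite charM // counit_u counit_iota mul1r.
Qed.

(** Invariant states give a covariant pair on their GNS space, hence a representation of the crossed
    product whose unitaries fix the [xi n]; almost invariance is then only a matter of [C_m(G)]. *)
Lemma crossed_T_states (psi : nat -> Cm G -> C) :
  dual_property_T GG -> (forall n, state (psi n)) ->
  (forall n g a, psi n (al g a) = psi n a) ->
  (forall a, tends \oo (fun n => psi n a : C^o) (@counit R G a)) ->
  exists n c, 0 < c /\
    forall a, c * cabs (@counit R G a) ^+ 2 <= complex.Re (psi n (star a ** a)).
Proof.
move=> hT hs hinv hlim; have [H [pi [xi [h1 h2 h3 h4 h5]]]] := gns_sum hs.
have [U [hU Ucov Uxi]] := h5 Gam al (al_hom hal) (alM hal) (al1 hal) hinv.
have [_ _ _ _ huniv] := hfull.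
have [sg [hsg sgi sgu]] := huniv H pi U h1 hU Ucov.
apply: (fixed_state (counit_char G) h1 h3 h4).
have [|eta eta0 heta] := hT H sg hsg.
  apply/almost_fixedP; exists xi; split=> //.
  apply: crossed_almost => // [a|g].
    by rewrite sgi; exact: (rep_almost (counit_char G) h1 h3 hlim).
  by apply: (tends_eq (tends_cst 0)) => n; rewrite sgu Uxi subrr.
by exists eta => // a; rewrite -sgi heta counit_iota.
Qed.

Lemma crossed_T_group : dual_property_T GG -> property_T R Gam.
Proof.
move=> hT H U hU /almost_fixedP[xi [x1 hxi]].
have hc := counit_char G.
pose pi (a : Cm G) (x : H) := @counit R G a *: x.
have hpi : representation pi.
  split=> [a _|c a b _ _ x|a b _ _ x|x|a _ x y].
  - have pl : linear (pi a).
      by move=> c x y; rewrite /pi scalerDr !scalerA mulrC.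
    split=> //; apply: (lip_continuous (k := cabs (@counit R G a)) pl) => x.
    by rewrite nmZ.
  - by rewrite /pi charD // charZ // scalerDl scalerA.
  - by rewrite /pi charM // scalerA.
  - by rewrite /pi char1 // scale1r.
  - by rewrite /pi hdotZl hdotZr char_star // conjCK.
have [Ul _ _ _] := hU.
have [_ _ _ _ huniv] := hfull.
have [|sg [hsg sgi sgu]] := huniv H pi U hpi hU.
  by move=> g a x; rewrite /pi (linZ (Ul g)) counit_al.
have [|eta eta0 heta] := hT H sg hsg.
  apply/almost_fixedP; exists xi; split=> //.
  apply: crossed_almost => // [a|g].
    by apply: (tends_eq (tends_cst 0)) => n; rewrite sgi /pi subrr.
  by apply: (tends_eq (hxi g)) => n; rewrite sgu scale1r.
by exists eta => // g; rewrite -sgu heta counit_u.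
Qed.

Lemma crossed_T_finite : dual_property_T GG -> finite_set (fixed_characters al).
Proof.
move=> hT; apply: contrapT => /(characters_cluster_counit hal)[psi [psiX [psiN psiE]]].
have hc k : character (psi k) by have [] := psiX k.
have [|n [c [c0 hn]]] := crossed_T_states hT (fun k => char_state (hc k)) _ psiE.
  by move=> n g a; have [_ ->] := psiX n.
apply: (psiN n); apply/funext => b.
(* A test element killed by [psi n], at which the counit takes the value [counit b - psi n b]. *)
have := hn (b - psi n b *: cone).
rewrite charM // !charB ?charZ ?char1 //; try exact: counit_char.
rewrite !mulr1 subrr mulr0 /= => h.
have : cabs (counit b - psi n b) ^+ 2 <= 0 by rewrite -(pmulr_rle0 _ c0).
rewrite le_eqVlt ltNge sqr_ge0 orbF sqrf_eq0 => /eqP/cabs0_eq0/eqP.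
by rewrite subr_eq0 => /eqP.
Qed.

End Crossed.
End States.

(** * The spectral gap element *)

Section GeometricSums.
Variable R : realType.
Local Notation C := R[i].

(* [sum_(k < n) 2^-(k+1) x_k + 2^-n x_n], a convex combination. *)
Fixpoint gsum (V : lmodType C) (x : nat -> V) n : V :=
  if n is n'.+1 then rc 2^-1 *: (x 0%N + gsum (x \o S) n') else x 0%N.

Fixpoint rsum (t : nat -> R) n : R :=
  if n is n'.+1 then 2^-1 * (t 0%N + rsum (t \o S) n') else t 0%N.

Lemma half_half (V : lmodType C) (v : V) : rc 2^-1 *: (v + v) = v.
Proof.
rewrite scalerDr -scalerDl -rcD (_ : rc _ = 1) ?scale1r //.
by apply: Cext => /=; lra.
Qed.

Lemma gsum_map (V W : lmodType C) (f : V -> W) x n :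
  (forall a b, f (rc 2^-1 *: (a + b)) = rc 2^-1 *: (f a + f b)) ->
  f (gsum x n) = gsum (f \o x) n.
Proof. by move=> fl; elim: n x => [//|n IH] x /=; rewrite fl IH. Qed.

Lemma gsum_lin (V W : lmodType C) (f : V -> W) x n : linear f ->
  f (gsum x n) = gsum (f \o x) n.
Proof. by move=> fl; apply: gsum_map => a b; rewrite (linZ fl) (linD fl). Qed.

Lemma gsumD (V : lmodType C) (c : C) (x y : nat -> V) n :
  gsum (fun k => c *: x k + y k) n = c *: gsum x n + gsum y n.
Proof.
elim: n x y => [//|n IH] x y /=.
have -> : (fun k => c *: x k + y k) \o S = fun k => c *: (x \o S) k + (y \o S) k by [].
by rewrite IH addrACA -scalerDr (scalerDr (rc _)) !scalerA (mulrC c).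
Qed.

Lemma gsum_closed (V : lmodType C) (P : V -> Prop) (x : nat -> V) n :
  (forall a b, P a -> P b -> P (rc 2^-1 *: (a + b))) -> (forall k, P (x k)) -> P (gsum x n).
Proof.
move=> hP; elim: n x => [|n IH] x hx /=; first exact: hx.
by apply: hP; [exact: hx|apply: IH => k; exact: hx].
Qed.

Lemma gsum_Re (x : nat -> C^o) n : complex.Re (gsum x n) = rsum (fun k => complex.Re (x k)) n.
Proof. by elim: n x => [//|n IH] x; rewrite [gsum _ _]/= Re_rc ReD IH. Qed.

Lemma gsum_cst (V : lmodType C) (v : V) n : gsum (fun=> v) n = v.
Proof.
elim: n => [//|n IH] /=.
have -> : (fun=> v) \o S = (fun=> v) by [].
by rewrite IH half_half.
Qed.

Lemma rsumB s t n : rsum (fun k => s - t k) n = s - rsum t n.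
Proof.
elim: n t => [//|n IH] t /=.
have -> : (fun k => s - t k) \o S = fun k => s - (t \o S) k by [].
by rewrite IH; lra.
Qed.

Lemma rsum_le t M n : (forall k, t k <= M) -> rsum t n <= M.
Proof.
elim: n t => [|n IH] t h /=; first exact: h.
have := h 0%N; have := IH (t \o S) (fun k => h k.+1); lra.
Qed.

(** The [k]th term has weight [2^-(k+1)] for every [n > k], so a vanishing limit average of
    nonnegative terms forces each of them to vanish. *)
Lemma rsum_ge t k : (forall k, 0 <= t k) -> exists2 c, 0 < c &
  forall n, (k < n)%N -> c * t k <= rsum t n.
Proof.
have ge0 t' n : (forall k, 0 <= t' k) -> 0 <= rsum t' n.
  elim: n t' => [|n IH] t' h /=; first exact: h.
  have := h 0%N; have := IH (t' \o S) (fun k => h k.+1); lra.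
elim: k t => [|k IH] t h.
  exists 2^-1; first by rewrite invr_gt0.
  case=> // n _ /=; rewrite ler_pM2l ?invr_gt0 // lerDl.
  by apply: ge0 => j; apply: h.
have [c c0 hc] := IH (t \o S) (fun j => h j.+1).
exists (2^-1 * c); first by rewrite mulr_gt0 ?invr_gt0.
case=> // n kn /=; rewrite -mulrA ler_pM2l ?invr_gt0 //.
by apply: le_trans (hc _ kn) _; rewrite lerDr.
Qed.

Lemma gsum_nm (V : normedModType C) (x : nat -> V) M n : (forall k, nm (x k) <= M) ->
  nm (gsum x n) <= M.
Proof.
elim: n x => [|n IH] x h /=; first exact: h.
rewrite nmZr ?invr_ge0 //.
have := nmD (x 0%N) (gsum (x \o S) n); have := h 0%N; have := IH (x \o S) (fun k => h k.+1).
lra.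
Qed.

Lemma gsum_dist (V : normedModType C) (x : nat -> V) M m n : (forall k, nm (x k) <= M) ->
  (n <= m)%N -> nm (gsum x m - gsum x n) <= 2^-1 ^+ n * (2 * M).
Proof.
elim: n m x => [|n IH] m x h.
  move=> _; rewrite expr0 mul1r; have := nmB (gsum x m) (gsum x 0).
  have := gsum_nm m h; have := gsum_nm 0 h; lra.
case: m => // m nm /=; rewrite -scalerBr opprD addrACA subrr add0r nmZr ?invr_ge0 //.
rewrite exprS -mulrA ler_pM2l ?invr_gt0 //; exact: (IH _ (x \o S) (fun k => h k.+1) nm).
Qed.

Lemma gsum_lim (V : completeNormedModType C) (x : nat -> V) M : (forall k, nm (x k) <= M) ->
  exists y, tends \oo (gsum x) y.
Proof.
move=> h; apply: complete_cauchy => e e0.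
have M0 : 0 <= M := le_trans (nm_ge0 (x 0%N)) (h 0%N).
have k0 : 0 < 2 * M + 1 by lra.
have [N _ hN] := @near_infty_natSinv_lt R (PosNum (divr_gt0 e0 k0)).
exists N => m n Nm Nn.
wlog mn : m n Nm Nn / (n <= m)%N.
  move=> hw; case/orP: (leq_total n m) => mn; first exact: hw.
  by rewrite nmC hw.
apply: le_lt_trans (gsum_dist h mn) _.
have h1 : 2^-1 ^+ n <= n.+1%:R^-1 :> R.
  by rewrite exprVn ?lef_pV2 ?posrE ?exprn_gt0 // -natrX ler_nat ltn_expl.
have := hN n Nn; rewrite /= ltr_pdivlMr // => h2.
apply: le_lt_trans h2; apply: ler_pM => //; rewrite ?exprn_ge0 ?invr_ge0 //; lra.
Qed.

End GeometricSums.

Section Kazhdan.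
Variable R : realType.
Local Notation C := R[i].
Variables (A : cstarAlgType R) (eps : A -> C).
Hypothesis (heps : character eps) (hsep : separable A).

(** Shift a dense sequence into the kernel of [eps] and symmetrise it to [r k + star (r k)];
    dividing by [nm (p k) + 1] gives contractions and never divides by 0. *)
Lemma kernel_seq : exists s : nat -> A,
  [/\ forall k, star (s k) = s k, forall k, nm (s k) <= 1, forall k, eps (s k) = 0
    & forall (H : hilbertType R) (pi : A -> H -> H) z, representation pi ->
        (forall k, pi (s k) z = 0) -> forall a, pi a z = eps a *: z].
Proof.
have [d hd] := separable_seq hsep.
pose r k := d k - eps (d k) *: cone; pose p k := r k + star (r k).
have er k : eps (r k) = 0 by rewrite /r charB // charZ // char1 // mulr1 subrr.
have np k : 0 < nm (p k) + 1 by rewrite ltr_wpDl ?nm_ge0.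
have ps k : star (p k) = p k by rewrite /p starD starK addrC.
exists (fun k => rc (nm (p k) + 1)^-1 *: p k); split=> [k|k|k|H pi z hpi hz].
- by rewrite starZ conj_rc ps.
- rewrite nmZr; last by rewrite invr_ge0 ltW.
  by rewrite mulrC ler_pdivrMr // mul1r lerDl.
- by rewrite charZ // charD // char_star // er rmorph0 addr0 mulr0.
have pz k : pi (p k) z = 0.
  have := hz k; rewrite (linZ (rep_linA hpi z)) => /(congr1 (fun v => rc (nm (p k) + 1) *: v)).
  by rewrite scalerA -rcM mulfV ?gt_eqF // scale1r scaler0.
have key b : eps b = 0 -> pi (b + star b) z = 0.
  move=> eb; apply: nm_small => e e0.
  (* Passing from [d k] to [r k] doubles the distance to [b], and adding the adjoint doubles it
     again: hence the 4. *)
  have k0 : 0 < 4 * (nm z + 1) by have := nm_ge0 z; lra.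
  have [k hk] := hd b _ (divr_gt0 e0 k0); rewrite ltr_pdivlMr // in hk.
  have br : nm (b - r k) <= 2 * nm (b - d k).
    have -> : b - r k = (b - d k) - eps (b - d k) *: cone.
      by rewrite /r charB // eb sub0r scaleNr !opprB opprK addrA addrAC.
    apply: le_trans (nmB _ _) _; rewrite nmZ nm1 mulr1.
    by have := char_nm heps (b - d k); lra.
  rewrite -[pi _ z]subr0 -(pz k) -(linB (rep_linA hpi z)).
  apply: le_trans (rep_nm hpi _ _) _.
  have -> : b + star b - p k = (b - r k) + star (b - r k).
    by rewrite /p starB opprD addrACA.
  have := nmD (b - r k) (star (b - r k)); rewrite nm_star.
  set x := nm (_ + _); set y := nm (b - r k) in br *; have := nm_ge0 z.
  have x0 : 0 <= x by exact: nm_ge0.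
  have := nm_ge0 (b - d k); nra.
move=> a; pose b := a - eps a *: cone.
have eb : eps b = 0 by rewrite /b charB // charZ // char1 // mulr1 subrr.
(* [key] at [b] and at ['i *: b] shows that [b + star b] and [b - star b] kill [z]. *)
have bz : pi b z = 0.
  have iconj : ('i%C : C)^* = - 'i%C by apply: Cext => //=; rewrite oppr0.
  have eib : eps ('i%C *: b) = 0 by rewrite charZ // eb mulr0.
  have := key _ eib; rewrite starZ iconj scaleNr -scalerBr (linZ (rep_linA hpi z)) => h1.
  have h2 : pi (b - star b) z = 0.
    have /(congr1 (fun v => (- 'i%C : C) *: v)) := h1; rewrite scalerA scaler0.
    by rewrite mulNr -expr2 sqr_i opprK scale1r.
  have := key _ eb; rewrite (linD (rep_linA hpi z)) => h3.
  move: h2; rewrite (linB (rep_linA hpi z)) => /eqP; rewrite subr_eq0 => /eqP h4.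
  by rewrite -[LHS]half_half {2}h4 h3 scaler0.
by have := bz; rewrite (linB (rep_linA hpi z)) (linZ (rep_linA hpi z)) rep1 // => /eqP;
  rewrite subr_eq0 => /eqP.
Qed.

(* [f = 1 - h] with [h] half a geometric average of the squares of a sequence which is total
   in the kernel of [eps]. *)
Lemma kazhdan_element : exists f : A, [/\ star f = f, nm f <= 1, eps f = 1
  & forall (H : hilbertType R) (pi : A -> H -> H) z, representation pi ->
      pi (f ** f) z = z -> forall a, pi a z = eps a *: z].
Proof.
have [s [ss s1 es hs]] := kernel_seq.
pose x k := s k ** s k.
have x1 k : nm (x k) <= 1 by rewrite nm_selfsq // expr_le1 // nm_ge0.
have [y hy] := gsum_lim x1.
have ys : star y = y.
  apply: (tends_uniq (tends_star hy)); apply: (tends_eq hy) => n.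
  symmetry; apply: (gsum_closed (P := fun a => star a = a)) => [a b ea eb|k].
    by rewrite starZ conj_rc starD ea eb.
  by rewrite starM ss.
(* Positivity of [1 - s_k^2], as the square of a self-adjoint contraction, survives averaging. *)
have y1 : nm (cone - y) <= 1.
  pose proof (tendsB (tends_cst (cone : A)) hy) as h.
  apply: (tends_le _ h); apply: nearW => n.
  have -> : cone - gsum x n = gsum (fun k => cone - x k) n.
    elim: n (x) => [//|n IH] x' /=; rewrite -IH -{1}(half_half cone) -scalerBr.
    by rewrite opprD addrACA.
  apply: gsum_nm => k; have [w [ws ww _ w1 _]] := sa_unitary (ss k) (s1 k).
  by rewrite -ww nm_selfsq // expr_le1 // nm_ge0.
have ey : eps y = 0.
  apply: (tends_uniq (tends_char heps hy)); apply: (tends_eq (tends_cst _)) => n.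
  symmetry; apply: (gsum_closed (P := fun a => eps a = 0)) => [a b ea eb|k].
    by rewrite charZ // charD // ea eb addr0 mulr0.
  by rewrite charM // es mulr0.
(* [hdot (pi y z) z] is a limit of averages of the [nm (pi (s k) z) ^+ 2], in which each term keeps
   a fixed positive weight. *)
have yz (H : hilbertType R) (pi : A -> H -> H) z : representation pi -> pi y z = 0 ->
    forall k, pi (s k) z = 0.
  move=> hpi yz k.
  pose t k := nm (pi (s k) z) ^+ 2.
  have [c c0 hc] := @rsum_ge R t k (fun j => sqr_ge0 _).
  have lf : linear (fun a => hdot (pi a z) z : C^o).
    by move=> a b b'; rewrite (rep_linA hpi) hdotDl hdotZl.
  have hx n : complex.Re (hdot (pi (gsum x n) z) z) = rsum t n.
    rewrite (gsum_lin x n lf) gsum_Re; congr rsum; apply/funext => j /=.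
    by rewrite /x -{1}(ss j) rep_sqr.
  have hz : tends \oo (fun n => hdot (pi (gsum x n) z) z : C^o) (hdot (pi y z) z).
    apply: (tends_lip (f := fun a => hdot (pi a z) z : C^o) (k := nm z * nm z)) hy => a b.
    rewrite -(linB lf) mulrC mulrA; apply: le_trans (hdot_CS _ _) _.
    by rewrite ler_wpM2r ?nm_ge0 // rep_nm.
  have : c * t k <= 0.
    have -> : (0 : R) = complex.Re (hdot (pi y z) z) by rewrite yz hdot0l.
    apply: (tends_Re_ge _ hz); exists k.+1 => // n /= kn; rewrite hx; exact: hc.
  rewrite pmulr_rle0 // /t le_eqVlt ltNge sqr_ge0 orbF sqrf_eq0 => /eqP.
  exact: nm_eq0.
exists (cone - rc 2^-1 *: y); split.
- by rewrite starB star1 starZ conj_rc ys.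
- have -> : cone - rc 2^-1 *: y = rc 2^-1 *: (cone + (cone - y)).
    by rewrite addrA scalerBr half_half.
  by rewrite nmZr ?invr_ge0 //; have := nmD cone (cone - y); rewrite nm1; lra.
- by rewrite charB // charZ // ey mulr0 subr0 char1.
move=> H pi z hpi hz; apply: hs => //; apply: yz => //.
set h := rc 2^-1 *: y in hz; set w := pi h z.
have yh : nm h <= 1.
  rewrite /h nmZr ?invr_ge0 // (_ : y = cone - (cone - y)); last by rewrite opprB addrC subrK.
  by have := nmB cone (cone - y); rewrite nm1; lra.
(* [(1 - h)^2 z = z] says [2 h z = h^2 z]; as [nm h <= 1], the vector [w = h z] satisfies
   [2 * nm w <= nm w]. *)
have w2 : w + w = pi h w.
  move: hz; rewrite cmulBl !cmulBr !cmul1l cmul1r !(linB (rep_linA hpi z)) rep1 // repM //.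
  rewrite -/w => hz; apply/esym/eqP; rewrite -subr_eq0 -(subrr z) -[X in _ == X - _]hz opprB.
  rewrite (addrC (z - w)) -!addrA (addrA z) (addrC z) -addrA subrr addr0.
  by rewrite opprD.
have w0 : w = 0.
  have n2 : nm (w + w) = 2 * nm w.
    have -> : w + w = rc 2 *: w.
      by rewrite -[2]/(1 + 1) rcD scalerDl scale1r.
    by rewrite nmZr.
  apply: nm_eq0; have := rep_nm hpi h w; rewrite -w2 n2; have := nm_ge0 w; nra.
have : pi (h + h) z = 0 by rewrite (linD (rep_linA hpi z)) -/w w0 addr0.
by rewrite /h -scalerDr half_half.
Qed.

End Kazhdan.

Section Powers.
Variable R : realType.
Local Notation C := R[i].

Section PowerConv.
Variables (A : cstarAlgType R) (H : hilbertType R) (pi : A -> H -> H) (f : A) (x : H).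
Hypotheses (hpi : representation pi) (fs : star f = f) (f1 : nm f <= 1).

Let v m := iter m (pi f) x.

Lemma power_dot m k n : hdot (v (m + k)) (v n) = hdot (v m) (v (n + k)).
Proof.
elim: k n => [|k IH] n; first by rewrite !addn0.
by rewrite addnS [v _]/= rep_adj // fs -[pi f (v n)]/(v n.+1) IH addSnnS.
Qed.

Lemma power_nm m : nm (v m.+1) <= nm (v m).
Proof.
rewrite [v _.+1]/=; apply: le_trans (rep_nm hpi _ _) _.
by rewrite ler_piMl ?nm_ge0.
Qed.

Lemma power_even k : iter k (pi (f ** f)) x = v k.*2.
Proof. by elim: k => [//|k IH]; rewrite doubleS /= IH repM. Qed.

(** By [power_dot] the mixed inner product is [nm (v (k + l)) ^+ 2]. The right-hand side is a
    difference of two decrements of the decreasing sequence [nm (v m) ^+ 2], hence small for large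
    [k] and [l]. *)
Lemma power_dist k l : (k <= l)%N ->
  nm (v k.*2 - v l.*2) ^+ 2 = (nm (v k.*2) ^+ 2 - nm (v (k + l)) ^+ 2) -
    (nm (v (k + l)) ^+ 2 - nm (v l.*2) ^+ 2).
Proof.
move=> kl; apply: rcI.
have e1 : hdot (v k.*2) (v l.*2) = rc (nm (v (k + l)) ^+ 2).
  have -> : l.*2 = ((k + l) + (l - k))%N by lia.
  by rewrite -power_dot (_ : (k.*2 + (l - k) = k + l)%N) ?hdot_nm //; lia.
rewrite -hdot_nm hdotBl !hdotBr !hdot_nm e1 (hdotC (v k.*2)) e1 conj_rc.
by rewrite !(rcD, rcN).
Qed.

(** Squaring removes a possible eigenvalue -1 of [f]; the even powers are then Cauchy by
    monotonicity of norms alone, without a spectral decomposition. *)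
Lemma power_conv : exists z, tends \oo (fun k => iter k (pi (f ** f)) x) z /\ pi (f ** f) z = z.
Proof.
have [z hz] : exists z, tends \oo (fun k => iter k (pi (f ** f)) x) z.
  apply: complete_cauchy => e e0.
  have e2 : 0 < e ^+ 2 by rewrite exprn_gt0.
  have mono n : - nm (v n) ^+ 2 <= - nm (v n.+1) ^+ 2.
    by rewrite lerN2 ler_sqr ?nnegrE ?nm_ge0 // power_nm.
  have ub n : - nm (v n) ^+ 2 <= 0 by rewrite oppr_le0 sqr_ge0.
  have [N hN] := mono_cauchy mono ub e2.
  exists N => m n; wlog mn : m n / (m <= n)%N.
    move=> hw Nm Nn; case/orP: (leq_total m n) => mn; first exact: hw.
    by rewrite nmC hw.
  move=> Nm Nn; rewrite !power_even -ltr_sqr ?nnegrE ?nm_ge0 ?(ltW e0) // power_dist //.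
  have h1 : `|- nm (v (m + n)) ^+ 2 - - nm (v m.*2) ^+ 2| < e ^+ 2 by apply: hN; lia.
  have h2 : nm (v n.*2) ^+ 2 <= nm (v (m + n)) ^+ 2.
    have hm : {homo (fun k => - nm (v k) ^+ 2) : p q / (p <= q)%N >-> p <= q}.
      by apply: homo_leq => //; apply: le_trans.
    by rewrite -lerN2; apply: hm; lia.
  move: h1; rewrite ltr_norml; lra.
exists z; split=> //.
have hS : tends \oo (fun k => iter k.+1 (pi (f ** f)) x) z.
  by move=> e /hz [N _ hN]; exists N => // n Nn; apply: hN; rewrite /= ltnW.
by apply: (tends_uniq (tends_rep hpi (f ** f) hz)).
Qed.
End PowerConv.

Fixpoint cexp (A : cstarAlgType R) (a : A) n : A := if n is n'.+1 then a ** cexp a n' else cone.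

Lemma rep_cexp (A : cstarAlgType R) (H : hilbertType R) (pi : A -> H -> H) a n x :
  representation pi -> pi (cexp a n) x = iter n (pi a) x.
Proof. by move=> hpi; elim: n => [|n IH] /=; rewrite ?rep1 // repM // IH. Qed.

Lemma char_cexp (A : cstarAlgType R) (chi : A -> C) a n :
  character chi -> chi a = 1 -> chi (cexp a n) = 1.
Proof.
by move=> hc e; elim: n => [|n IH] /=; rewrite ?char1 // charM // e IH mulr1.
Qed.

Lemma vector_state (A : cstarAlgType R) (H : hilbertType R) (pi : A -> H -> H) v :
  representation pi -> v != 0 ->
  state (fun a => rc (nm v ^+ 2)^-1 * hdot (pi a v) v).
Proof.
move=> hpi v0; have n0 : nm v ^+ 2 != 0 by rewrite sqrf_eq0 gt_eqF // nm_gt0.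
split=> [c a b|a|a|].
- rewrite (rep_linA hpi) hdotDl hdotZl.
  by rewrite mulrDr mulrCA.
- by rewrite conjM conj_rc -hdotC rep_adj // starK.
- rewrite rep_sqr // -rcM /= mulr_ge0 ?sqr_ge0 // invr_ge0 sqr_ge0 //.
- by rewrite rep1 // hdot_nm -rcM mulVf.
Qed.

(** * From property (T) of [G] and of the group to the crossed product *)

Section Converse.
Variables (Gam : groupType) (G : compact_quantum_group R) (al : Gam -> Cm G -> Cm G).
Hypothesis hal : quantum_action al.
Variable GG : compact_quantum_group R.
Variables (iota : Cm G -> Cm GG) (u : Gam -> Cm GG).
Hypothesis hfull : full_crossed_product al iota u.
Hypothesis hu : forall g, Delta (u g) = tens (Cm2 GG) (u g) (u g).
Hypothesis hiota : exists F : Cm2 G -> Cm2 GG,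
  tensor_hom iota iota F /\ forall a, Delta (iota a) = F (Delta a).

Section Rep.
Variables (H : hilbertType R) (sg : Cm GG -> H -> H).
Hypothesis hsg : representation sg.

Let pi a := sg (iota a).
Let hpi : representation pi. Proof. exact: (rep_comp (iota_hom hfull)). Qed.
Let U g := sg (u g).

Lemma crossed_unitary : unitary_rep U.
Proof.
have [_ [uu _ u1 uM] _ _ _] := hfull; split.
- by move=> g; apply: rep_lin.
- by move=> g x y; rewrite /U rep_adj // -repM // uu rep1.
- by move=> x; rewrite /U u1 rep1.
- by move=> g h x; rewrite /U uM repM.
Qed.

Lemma crossed_cov g a x : U g (pi a x) = pi (al g a) (U g x).
Proof.
have [_ [uu _ _ _] hc _ _] := hfull.
by rewrite /U /pi -hc !repM // -(repM hsg (star (u g))) uu rep1.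
Qed.

Lemma fixed_space0 : forall a, pi a 0 = @counit R G a *: (0 : H).
Proof. by move=> a; rewrite (lin0 (rep_lin hpi a)) scaler0. Qed.

Lemma fixed_space_lin (c : C) (x y : H) : (forall a, pi a x = @counit R G a *: x) ->
  (forall a, pi a y = @counit R G a *: y) ->
  forall a, pi a (c *: x + y) = @counit R G a *: (c *: x + y).
Proof.
move=> hx hy a; rewrite (rep_lin hpi) hx hy scalerDr !scalerA.
by rewrite (mulrC c).
Qed.

Definition fixed_space : subspace H :=
  Subspace (fixed_space0 : [set x | forall a, pi a x = @counit R G a *: x] 0) fixed_space_lin.

Lemma fixed_space_closed (w : nat -> H) l : (forall n, sp_set fixed_space (w n)) ->
  tends \oo w l -> sp_set fixed_space l.
Proof.
move=> hw hl a; apply: (tends_uniq (tends_rep hpi a hl)).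
by apply: (tends_eq (tendsZ (@counit R G a) hl)) => n; rewrite hw.
Qed.

(** Write [a] as [al g (al g^-1 a)] and pull [U g] out by covariance; the action does not change the
    counit. *)
Lemma fixed_space_U g x : sp_set fixed_space x -> sp_set fixed_space (U g x).
Proof.
move=> hx a; rewrite -{1}(alKV hal g a) -crossed_cov hx.
have [Ul _ _ _] := crossed_unitary.
by rewrite (linZ (Ul g)) counit_al.
Qed.

Let K : hilbertType R := closed_subspace fixed_space_closed.
Let UK (g : Gam) (x : K) : K := sp_mk fixed_space (U g (sp_val (x : sp_type fixed_space))).

Let UKE g (x : K) : sp_val (UK g x : sp_type fixed_space) = U g (sp_val (x : sp_type fixed_space)).
Proof. by rewrite sp_mkE //; apply: fixed_space_U; apply: sp_valP. Qed.

Lemma fixed_space_rep : unitary_rep UK.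
Proof.
have [Ul Ud U1 UM] := crossed_unitary; split.
- move=> g c x y; apply: sp_ext; rewrite UKE.
  rewrite (sp_val_lin c (x : sp_type fixed_space) (y : sp_type fixed_space)) Ul.
  by rewrite (sp_val_lin c (UK g x : sp_type fixed_space) (UK g y : sp_type fixed_space)) !UKE.
- by move=> g x y; rewrite -[LHS]/(hdot (sp_val _) (sp_val _)) !UKE Ud.
- by move=> x; apply: sp_ext; rewrite UKE U1.
- by move=> g h x; apply: sp_ext; rewrite !UKE UM.
Qed.

Lemma fixed_space_T (z : nat -> H) (d : R) : property_T R Gam -> 0 < d ->
  (forall n, sp_set fixed_space (z n)) -> (forall n, d <= nm (z n)) ->
  (forall g, tends \oo (fun n => U g (z n) - z n) 0) ->
  exists eta, [/\ eta != 0, sp_set fixed_space eta & forall g, U g eta = eta].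
Proof.
move=> hT d0 hz zd hU; have [UKl _ _ _] := fixed_space_rep.
pose w n : K := sp_mk fixed_space (z n).
have wE n : sp_val (w n : sp_type fixed_space) = z n by rewrite sp_mkE.
have nmK (x : K) : nm x = nm (sp_val (x : sp_type fixed_space)).
  by rewrite -[LHS]/(fnorm (cs_form fixed_space) x) cs_fnorm.
have hal1 : almost_fixed UK (fun=> 1).
  apply: (almost_fixed_near (v := w) d0 UKl) => [n|g]; first by rewrite nmK wE.
  apply: (tends_squeeze (k := 1)) (hU g); apply: nearW => n.
  rewrite mul1r scale1r nmK (linB (@sp_val_lin _ _ fixed_space)) UKE wE //.
have [eta eta0 he] := hT K UK fixed_space_rep hal1.
exists (sp_val (eta : sp_type fixed_space)); split.
- apply: contra_neq eta0 => h; apply: sp_ext.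
  by rewrite h (lin0 (@sp_val_lin _ _ fixed_space)).
- exact: sp_valP.
- by move=> g; rewrite -UKE he scale1r.
Qed.

End Rep.

Lemma crossed_T_conv : dual_property_T G -> property_T R Gam -> dual_property_T GG.
Proof.
move=> hTG hTGam H sg hsg /almost_fixedP[xi [x1 hxi]].
pose pi a := sg (iota a).
have hpi : representation pi := rep_comp (iota_hom hfull) hsg.
have pixi a : tends \oo (fun n => pi a (xi n) - @counit R G a *: xi n) 0.
  by apply: (tends_eq (hxi (iota a))) => n; rewrite (counit_iota hfull hiota).
have [f [fs f1 ef hf]] := kazhdan_element (counit_char G) (Cm_separable G).
have ex n := power_conv (xi n) hpi fs f1.
have [z hz] := choice ex.
have zfix n a : pi a (z n) = @counit R G a *: z n.
  by have [_ h] := hz n; apply: hf.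
(* Otherwise a subsequence [v] of the differences stays above some [d]. Its vector states still
   converge to the counit, so property (T) of [G] bounds one of them below on all powers of
   [f ** f], whereas these powers send [v n] to 0. *)
have vlim : tends \oo (fun n => xi n - z n) 0.
  apply: contrapT => hN.
  have [d [d0 hd]] : exists d : R, 0 < d /\
      forall N, exists n, (N <= n)%N /\ d <= nm (xi n - z n).
    apply: contrapT => hN'; apply: hN => e e0; apply: contrapT => hN2.
    apply: hN'; exists e; split=> // N; apply: contrapT => hN3; apply: hN2.
    exists N => // n /= Nn; rewrite subr0 ltNge; apply/negP => h.
    by apply: hN3; exists n.
  have [k hk] := choice hd.
  pose v n := xi (k n) - z (k n).
  have dv n : d <= nm (v n) by have [] := hk n.
  have v0 n : v n != 0.
    by apply: contraTneq (dv n) => ->; rewrite nm0 -ltNge.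
  have kk : k @ \oo --> \oo.
    move=> P [N _ hP]; exists N => // n /= Nn; apply: hP => /=.
    by apply: leq_trans Nn _; have [] := hk n.
  pose psi n a := rc (nm (v n) ^+ 2)^-1 * hdot (pi a (v n)) (v n).
  have hs n : state (psi n) by apply: vector_state.
  have psilim a : tends \oo (fun n => psi n a : C^o) (@counit R G a).
    apply/tends_sub0; have h := tends_comp kk (pixi a).
    apply: (tends_squeeze (k := d^-1)) h; apply: nearW => n.
    have nv : 0 < nm (v n) by apply: lt_le_trans (dv n).
    (* Subtracting the fixed vector [z (k n)] does not change the defect. *)
    have e1 : pi a (xi (k n)) - @counit R G a *: xi (k n) = pi a (v n) - @counit R G a *: v n.
      by rewrite /v (linB (rep_lin hpi a)) zfix scalerBr opprB addrA subrK.
    rewrite /= e1.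
    have -> : psi n a - counit a =
        rc (nm (v n) ^+ 2)^-1 * hdot (pi a (v n) - counit a *: v n) (v n).
      rewrite hdotBl hdotZl mulrBr hdot_nm mulrCA -rcM mulVf ?mulr1 //.
      by rewrite sqrf_eq0 gt_eqF.
    rewrite -[nm _]/(cabs _) cabsM cabsR ger0_norm ?invr_ge0 ?sqr_ge0 //.
    apply: (@le_trans _ _ ((nm (v n) ^+ 2)^-1 *
        (nm (pi a (v n) - counit a *: v n) * nm (v n)))).
      by rewrite ler_wpM2l ?invr_ge0 ?sqr_ge0 // hdot_CS.
    rewrite mulrC expr2 invfM -!mulrA mulVKf ?gt_eqF // mulrC ler_wpM2r ?nm_ge0 //.
    by rewrite lef_pV2 ?posrE.
  have [n [c [c0 hc]]] := dual_T_states hTG hs psilim.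
  have lim0 : tends \oo (fun j => pi (cexp (f ** f) j) (v n)) 0.
    have [h1 _] := hz (k n).
    rewrite -(subrr (z (k n))); apply: (tends_eq (tendsB h1 (tends_cst (z (k n))))) => j.
    rewrite /v (linB (rep_lin hpi _)) rep_cexp // zfix char_cexp ?scale1r //.
      exact: counit_char.
    by rewrite charM ?ef ?mulr1 //; exact: counit_char.
  have nv : 0 < nm (v n) by apply: lt_le_trans (dv n).
  have e0 : 0 < Num.sqrt c * nm (v n) by rewrite mulr_gt0 // sqrtr_gt0.
  have [j [hj _]] := near_ex2 _ (lim0 _ e0) (near_ge 0).
  move: hj; rewrite subr0 ltNge => /negP; apply.
  rewrite -ler_sqr ?nnegrE ?mulr_ge0 ?sqrtr_ge0 ?nm_ge0 // exprMn sqr_sqrtr ?(ltW c0) //.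
  have := hc (cexp (f ** f) j); rewrite char_cexp ?cabs1 ?expr1n ?mulr1; first last.
  - by rewrite charM ?ef ?mulr1 //; exact: counit_char.
  - exact: counit_char.
  rewrite /psi rep_sqr // -rcM /= mulrC ler_pdivlMr ?exprn_gt0 //.
have h20 : (0 : R) < 2^-1 by rewrite invr_gt0.
have [N _ hN] := vlim _ h20.
(* Past [N] the fixed vectors are within [1/2] of unit vectors, so their norms are bounded below. *)
pose w n := z (n + N)%N.
have w2 n : 2^-1 <= nm (w n).
  have := hN (n + N)%N (leq_addl _ _); rewrite /= subr0 -/(w n).
  have := nm_subl (xi (n + N)%N) (w n); rewrite x1; lra.
(* [U z - z = (U xi - xi) + (xi - z) - U (xi - z)], where every term tends to 0. *)
have hUl g : tends \oo (fun n => sg (u g) (z n) - z n) 0.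
  have h1 := hxi (u g).
  have h1' : tends \oo (fun n => sg (u g) (xi n) - xi n) 0.
    by apply: (tends_eq h1) => n; rewrite (counit_u hfull hu) scale1r.
  pose proof (tendsB (tendsD h1' vlim) (tends_rep hsg (u g) vlim)) as h2.
  rewrite (lin0 (rep_lin hsg _)) addr0 subr0 in h2.
  apply: (tends_eq h2) => n; rewrite (linB (rep_lin hsg _)).
  by rewrite addrA subrK opprB (addrC (sg (u g) (xi n) - z n)) addrA subrK.
have [||||eta [eta0 etaK etaU]] := @fixed_space_T H sg hsg w 2^-1 hTGam.
- by rewrite invr_gt0.
- by move=> n; rewrite /= => a; exact: zfix.
- exact: w2.
- move=> g e /(hUl g) [M _ hM]; exists M => // n /= Mn; apply: hM => /=.
  by rewrite (leq_trans Mn) // leq_addr.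
exists eta => // b; exact: (crossed_fixed hfull hu hiota hsg etaK etaU).
Qed.

End Converse.
End Powers.

(** * Invariant states of compact actions *)

Section Compact.
Variable R : realType.
Local Notation C := R[i].

Lemma state_limit I (F : set_system I) (FF : ProperFilter F) (A : cstarAlgType R)
    (f : I -> A -> C) (g : A -> C) : (forall i, state (f i)) ->
  (forall a, tends F (fun i => f i a : C^o) (g a)) -> state g.
Proof.
move=> hf hg; split=> [c a b|a|a|].
- apply: tends_uniq (hg _) _.
  by apply: (tends_eq (tendsD (tendsZ c (hg a)) (hg b))) => i; rewrite stateD // stateZ.
- by apply: tends_uniq (hg _) _; apply: (tends_eq (tends_conjC (hg a))) => i; rewrite state_star.
- by apply: (tends_Re_ge _ (hg _)); apply: nearW => i; apply: state_pos.
- by apply: tends_uniq (hg _) _; apply: (tends_eq (tends_cst _)) => i; rewrite state1.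
Qed.

Lemma tends_state I (F : set_system I) {FF : ProperFilter F} (A : cstarAlgType R) (psi : A -> C)
    (w : I -> A) l : state psi ->
  tends F w l -> tends F (fun i => psi (w i) : C^o) (psi l).
Proof.
move=> hs; apply: (tends_lip (f := psi : A -> C^o) (k := 1)) => x y.
by rewrite mul1r -(linB (state_lin hs)); exact: state_nm.
Qed.

Section Orbits.
Variables (Gam : groupType) (G : compact_quantum_group R) (al : Gam -> Cm G -> Cm G).
Hypotheses (hal : quantum_action al) (hcomp : compact_action al).

(** This is how compactness enters: any sequence of group elements has a limit automorphism for
    pointwise norm convergence. Lying in [Aut], it is compatible with [Delta] and therefore
    preserves the counit. *)
Lemma orbit_ultralim (U : set_system nat) (UU : UltraFilter U) (g : nat -> Gam) :
  exists x : Cm G -> Cm G, [/\ star_hom x, bijective x, forall a, counit (x a) = @counit R G a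
    & forall a, tends U (fun n => al (g n) a) (x a)].
Proof.
move: hcomp; rewrite /compact_action compact_ultra.
pose w n : {ptws Cm G -> Cm G} := al (g n).
move=> /(_ _ (ultra_fmap w UU)) []; first apply: nearW => n /=.
  split; last by have [h _] := hal; apply: h.
  by apply: subset_closure; exists (g n).
move=> x [[_ [xh xb [F [hF FD]]]] wx]; exists x; split=> //.
  by move=> a; exact: (congr1 (fun f => f a) (counit_hom xh hF FD)).
move=> a; apply/tendsE.
have := @proj_continuous (Cm G) (fun=> Cm G) a x.
by move=> /(_ _) h; apply: cvg_trans (h); apply: cvg_app wx.
Qed.

Variable g : nat -> Gam.
Hypothesis gsurj : forall h, exists k, g k = h.

Lemma average_ex : exists M : Cm G -> Cm G,
  forall a, tends \oo (gsum (fun k => al (g k) a)) (M a).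
Proof.
have ex a : exists y, tends \oo (gsum (fun k => al (g k) a)) y.
  by apply: (gsum_lim (M := nm a)) => k; rewrite al_nm.
by have [M hM] := choice ex; exists M.
Qed.

Section Average.
Variable M : Cm G -> Cm G.
Hypothesis hM : forall a, tends \oo (gsum (fun k => al (g k) a)) (M a).

Lemma average_Re_le phi s a : state phi -> (forall k, complex.Re (phi (al (g k) a)) <= s) ->
  complex.Re (phi (M a)) <= s.
Proof.
move=> hp h; apply: (tends_Re_le _ (tends_state hp (hM a))); apply: nearW => n.
by rewrite (gsum_lin _ _ (state_lin hp)) gsum_Re; apply: rsum_le.
Qed.

Lemma average_state phi : state phi -> state (phi \o M).
Proof.
move=> hp; split=> [c a b|a|a|] /=.
- have -> : M (c *: a + b) = c *: M a + M b.
    apply: (tends_uniq (hM _)).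
    apply: (tends_eq (tendsD (tendsZ c (hM a)) (hM b))) => n.
    rewrite -gsumD; congr gsum; apply/funext => k.
    by rewrite (hom_lin (al_hom hal (g k))).
  by rewrite stateD // stateZ.
- have -> : M (star a) = star (M a).
    apply: (tends_uniq (hM _)); apply: (tends_eq (tends_star (hM a))) => n.
    rewrite (gsum_map (f := @star R (Cm G))) => [|x y]; last by rewrite starZ conj_rc starD.
    by congr gsum; apply/funext => k /=; rewrite (hom_star (al_hom hal (g k))).
  by rewrite state_star.
(* Positivity is the upper bound 0 for the negative of [star a ** a], so that [average_Re_le]
   applies. *)
- rewrite -oppr_le0 -ReN -[- phi _]mulN1r -stateZ //.
  have -> : -1 *: M (star a ** a) = M (-1 *: (star a ** a)).
    apply: (tends_uniq (tendsZ (-1) (hM _))); apply: (tends_eq (hM _)) => n.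
    rewrite (gsum_map (f := fun x : Cm G => -1 *: x)) => [|x y].
      by congr gsum; apply/funext => k /=; rewrite (linZ (hom_lin (al_hom hal (g k)))).
    by rewrite -scalerDr !scalerA mulrC.
  apply: average_Re_le => // k.
  have hk := al_hom hal (g k).
  rewrite (linZ (hom_lin hk)) stateZ // mulN1r ReN oppr_le0 homM // hom_star //.
  exact: state_pos.
- have -> : M cone = cone.
    apply: (tends_uniq (hM _)); apply: (tends_eq (tends_cst _)) => n.
    rewrite -[LHS](gsum_cst (cone : Cm G) n); congr gsum; apply/funext => k.
    by rewrite (hom1 (al_hom hal (g k))).
  exact: state1.
Qed.

(* Maximum principle: the orbit function [h => Re (psi (al h a))] is a convex average of its
   translates and attains its supremum on the compact orbit closure. *)
Lemma stationary_invariant psi : state psi -> (forall a, psi (M a) = psi a) ->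
  forall h a, psi (al h a) = psi a.
Proof.
move=> hs hstat.
have [U [UU oU]] := ultraFilterLemma eventually_filter.
have hRe a h : complex.Re (psi (al h a)) = complex.Re (psi a).
  suff [m hm] : exists m, forall h, complex.Re (psi (al h a)) = m.
    by rewrite hm -(hm 1%g) al1.
  pose X := range (fun h => complex.Re (psi (al h a))).
  have ub h' : complex.Re (psi (al h' a)) <= nm a.
    by apply: le_trans (Re_le _) _; apply: le_trans (state_nm hs _) _; rewrite al_nm.
  have supX : has_sup X.
    split; first by exists (complex.Re (psi (al 1%g a))), 1%g.
    by exists (nm a) => _ [h' _ <-].
  exists (sup X).
  have leS h' : complex.Re (psi (al h' a)) <= sup X.
    by apply: sup_upper_bound => //; exists h'.
  have ex n : exists h', sup X - n.+1%:R^-1 < complex.Re (psi (al h' a)).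
    have n0 : (0 : R) < n.+1%:R^-1 by rewrite invr_gt0.
    by have [_ [h' _ <-] hh] := sup_adherent n0 supX; exists h'.
  have [gn hgn] := choice ex.
  have [x [_ _ _ hx]] := orbit_ultralim UU gn.
  have geb : sup X <= complex.Re (psi (x a)).
    apply/ler_addgt0Pr => e e0; rewrite -lerBlDr.
    apply: (tends_Re_ge _ (tends_state hs (hx a))).
    have [N _ hN] := @near_infty_natSinv_lt R (PosNum e0).
    apply: filterS (oU _ (near_ge N)) => n Nn.
    by apply: le_trans (ltW (hgn n)); rewrite lerD2l lerN2; apply: ltW; exact: hN.
  have leb h' : complex.Re (psi (al h' (x a))) <= sup X.
    have hl : tends U (fun n => al h' (al (gn n) a)) (al h' (x a)).
      apply: (tends_lip (f := al h') (k := 1)) (hx a) => p q.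
      by rewrite mul1r (hom_dist (al_hom hal h')).
    apply: (tends_Re_le _ (tends_state hs hl)); apply: nearW => n.
    by rewrite -alM.
  (* Stationarity makes the value at [x a], which is the supremum, an average of the values at its
     translates, none of them larger; the enumeration gives every group element a positive weight,
     so all are equal. *)
  have eqb h' : complex.Re (psi (al h' (x a))) = sup X.
    apply/eqP; rewrite eq_le leb /=; have [k <-] := gsurj h'.
    pose t j := sup X - complex.Re (psi (al (g j) (x a))).
    have t0 j : 0 <= t j by rewrite /t subr_ge0.
    have [c c0 hc] := rsum_ge k t0.
    have lim : tends \oo (fun n => rc (sup X) - psi (gsum (fun k => al (g k) (x a)) n) : C^o)
        (rc (sup X) - psi (M (x a))).
      exact: (tendsB (tends_cst (rc (sup X) : C^o)) (tends_state hs (hM (x a)))).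
    have h0 : c * t k <= 0.
      apply: (@le_trans _ _ (complex.Re (rc (sup X) - psi (M (x a))))); last first.
        by rewrite hstat ReB /= subr_le0.
      apply: (tends_Re_ge _ lim); exists k.+1 => // n /= kn.
      apply: le_trans (hc n kn) _.
      rewrite (gsum_lin _ _ (state_lin hs)) ReB /= gsum_Re.
      by rewrite rsumB.
    by move: h0; rewrite pmulr_rle0 // /t subr_le0.
  (* Back from [x a] to [a]: the action is isometric, so [al h' a], rewritten as a translate of
     [al (gn n) a], is close to the same translate of [x a]. *)
  move=> h'; apply/eqP; rewrite eq_le leS /=.
  apply/ler_addgt0Pr => e e0.
  have [n [hn _]] := near_ex2 _ (hx a _ e0) (oU _ (near_ge 0)).
  rewrite -(eqb (h' * (gn n)^-1)%g).
  have -> : al h' a = al (h' * (gn n)^-1)%g (al (gn n) a) by rewrite -alM // mulgVK.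
  rewrite -lerBlDl -ReB -stateB // -(linB (hom_lin (al_hom hal _))).
  apply: le_trans (Re_le _) _; apply: le_trans (state_nm hs _) _.
  by rewrite al_nm // nmC ltW.
(* Up to sign, the imaginary part at [a] is the real part at ['i *: a]. *)
move=> h a; apply: Cext; first exact: hRe.
have := hRe ('i%C *: a) h; rewrite (linZ (hom_lin (al_hom hal h))) !stateZ //.
by rewrite !ReM /=; lra.
Qed.

End Average.
End Orbits.
End Compact.

Section Invariant.
Variable R : realType.
Local Notation C := R[i].

Lemma sum_telescope (V : zmodType) (t : nat -> V) n :
  \sum_(j < n) t j.+1 - \sum_(j < n) t j = t n - t 0%N.
Proof.
elim: n => [|n IH]; first by rewrite !big_ord0 !subrr.
by rewrite !big_ord_recr /= opprD addrACA IH addrC addrA subrK.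
Qed.

Lemma mean_state (A : cstarAlgType R) (phi : nat -> A -> C) n : (forall j, state (phi j)) ->
  state (fun a => rc n.+1%:R^-1 * \sum_(j < n.+1) phi j a).
Proof.
move=> hp; split=> [c a b|a|a|].
- rewrite (eq_bigr (fun j : 'I_n.+1 => c * phi j a + phi j b)).
    by rewrite big_split /= -mulr_sumr mulrDr mulrCA.
  by move=> j _; rewrite stateD // stateZ.
- rewrite conjM conj_rc rmorph_sum; congr (_ * _); apply: eq_bigr => j _.
  exact: state_star.
- rewrite Re_rc Re_sum mulr_ge0 ?invr_ge0 // sumr_ge0 // => j _.
  exact: state_pos.
- rewrite (eq_bigr (fun=> 1)) => [|j _]; last exact: state1.
  rewrite sumr_const card_ord; apply: Cext; rewrite ?Re_rc.
    have -> : complex.Re (1 *+ n.+1 : C) = n.+1%:R.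
      by elim: n.+1 => [//|m IH]; rewrite !mulrS ReD IH.
    by rewrite mulVf.
  have im : complex.Im (1 *+ n.+1 : C) = 0.
    by elim: n.+1 => [//|m IH]; rewrite mulrS ImD IH addr0.
  by rewrite ImM im /= mulr0 mul0r addr0.
Qed.

Section Exist.
Variables (Gam : groupType) (G : compact_quantum_group R) (al : Gam -> Cm G -> Cm G).
Hypotheses (hal : quantum_action al) (hcomp : compact_action al).
Hypothesis hGam : countable [set: Gam].

(* A limit point of the Cesaro means of [phi \o M^j] is fixed by the averaging operator [M]. *)
Lemma invariant_state (phi : Cm G -> C) : state phi -> exists psi : Cm G -> C,
  [/\ state psi, forall g a, psi (al g a) = psi a
    & forall a s, (forall g, complex.Re (phi (al g a)) <= s) -> complex.Re (psi a) <= s].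
Proof.
move=> hphi; have [g gE] := countable_enum (1%g : Gam) hGam.
have gsurj h : exists k, g k = h by have [k _ <-] := gE h I; exists k.
have [M hM] := average_ex hal g.
pose phij j := iter j (fun f : Cm G -> C => f \o M) phi.
have hj j : state (phij j) by elim: j => [//|j IH]; exact: (average_state hal hM IH).
pose mean n a := rc n.+1%:R^-1 * \sum_(j < n.+1) phij j a.
have hmean n : state (mean n) by apply: mean_state.
have [U [UU oU]] := ultraFilterLemma eventually_filter.
have [psi hpsi] := ultra_functional UU (fun n => state_nm (hmean n)).
have hs : state psi by exact: (state_limit _ hmean hpsi).
have hstat a : psi (M a) = psi a.
  (* [phij j (M a)] is [phij j.+1 a], so the difference of means telescopes and is at most
     [2 * nm a / (n + 1)]. *)
  have hz : tends U (fun n => mean n (M a) - mean n a : C^o) 0.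
    apply: (tends_sub oU) => e e0.
    have k0 : 0 < 2 * nm a + 1 by have := nm_ge0 a; lra.
    have [N _ hN] := @near_infty_natSinv_lt R (PosNum (divr_gt0 e0 k0)).
    exists N => // n Nn; rewrite subr0 -[nm _]/(cabs _) /mean -mulrBr.
    rewrite (sum_telescope (fun j => phij j a)) cabsM cabsR ger0_norm ?invr_ge0 //.
    have := hN n Nn; rewrite /= ltr_pdivlMr // => h.
    apply: le_lt_trans h; rewrite ler_wpM2l ?invr_ge0 //.
    apply: le_trans (cabsD _ _) _; rewrite cabsN.
    by have := state_nm (hj n.+1) a; have := state_nm (hj 0%N) a; lra.
  apply/eqP; rewrite -subr_eq0; apply/eqP.
  exact: (tends_uniq (tendsB (hpsi (M a)) (hpsi a)) hz).
exists psi; split=> //; first exact: (stationary_invariant hal hcomp gsurj hM hs hstat).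
move=> a s hle.
(* The bound is carried for all translates at once, which is what makes it stable under
   averaging. *)
have hle' j : forall b, (forall g, complex.Re (phi (al g b)) <= s) ->
    forall g, complex.Re (phij j (al g b)) <= s.
  elim: j => [//|j IH] b hb h.
  have hk k : complex.Re (phij j (al (g k) (al h b))) <= s by rewrite -alM //; apply: IH.
  exact: (average_Re_le hM (hj j) hk).
apply: (tends_Re_le _ (hpsi a)); apply: nearW => n.
rewrite /mean Re_rc Re_sum mulrC ler_pdivrMr //.
apply: (@le_trans _ _ (\sum_(j < n.+1) s)).
  by apply: ler_sum => j _; rewrite -(al1 hal a); apply: hle'.
by rewrite sumr_const card_ord mulr_natr.
Qed.

End Exist.

Lemma iter_rep_le (A : cstarAlgType R) (H : hilbertType R) (pi : A -> H -> H) a x j k :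
  representation pi -> nm a <= 1 -> (j <= k)%N ->
  nm (iter k (pi a) x) <= nm (iter j (pi a) x).
Proof.
move=> hpi a1; elim: k => [|k IH]; first by rewrite leqn0 => /eqP ->.
rewrite leq_eqVlt => /predU1P[->//|]; rewrite ltnS => /IH h.
apply: le_trans h; rewrite iterS; apply: le_trans (rep_nm hpi _ _) _.
by rewrite ler_piMl ?nm_ge0.
Qed.

(** * Compact actions: property (T) descends to [G] *)

Section CompactCase.
Variables (Gam : groupType) (G : compact_quantum_group R) (al : Gam -> Cm G -> Cm G).
Hypotheses (hal : quantum_action al) (hcomp : compact_action al).
Hypothesis hGam : countable [set: Gam].
Variable GG : compact_quantum_group R.
Variables (iota : Cm G -> Cm GG) (u : Gam -> Cm GG).
Hypothesis hfull : full_crossed_product al iota u.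
Hypothesis hu : forall g, Delta (u g) = tens (Cm2 GG) (u g) (u g).
Hypothesis hiota : exists F : Cm2 G -> Cm2 GG,
  tensor_hom iota iota F /\ forall a, Delta (iota a) = F (Delta a).

(** Otherwise some [g k] violate the bound at indices going to infinity. A limit [x] of the
    [al (g k)] preserves the counit, so [x b] stays in its kernel and [pi (x b)] tends to 0 on the
    [xi n]. *)
Lemma uniform_almost_fixed (H : hilbertType R) (pi : Cm G -> H -> H) (xi : nat -> H)
    (b : Cm G) (e : R) : representation pi -> (forall n, nm (xi n) = 1) ->
  (forall a, tends \oo (fun n => pi a (xi n) - @counit R G a *: xi n) 0) ->
  counit b = 0 -> 0 < e ->
  \forall n \near \oo, forall g, nm (pi (al g b) (xi n)) <= e.
Proof.
move=> hpi x1 hxi eb e0; apply: contrapT => hN.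
have ex N : exists n, (N <= n)%N /\ exists g, e < nm (pi (al g b) (xi n)).
  apply: contrapT => hN'; apply: hN; exists N => // n /= Nn g.
  by rewrite leNgt; apply/negP => h; apply: hN'; exists n; split=> //; exists g.
have [k hk] := choice ex.
have exg N : exists g, e < nm (pi (al g b) (xi (k N))) by have [] := hk N.
have [g hg] := choice exg.
have [U [UU oU]] := ultraFilterLemma eventually_filter.
have [x [_ _ xc hx]] := orbit_ultralim hal hcomp UU g.
have kk : k @ \oo --> \oo.
  move=> P [N _ hP]; exists N => // n /= Nn; apply: hP => /=.
  by apply: leq_trans Nn _; have [] := hk n.
have h1 := tends_sub oU (tends_comp kk (hxi (x b))).
have e2 : 0 < e / 2 by rewrite divr_gt0.
have [n [h2 h3]] := near_ex2 _ (hx b _ e2) (h1 _ e2).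
have := hg n; rewrite ltNge => /negP; apply.
rewrite /= subr0 xc eb scale0r subr0 in h3.
have -> : pi (al (g n) b) (xi (k n)) = pi (al (g n) b - x b) (xi (k n)) + pi (x b) (xi (k n)).
  by rewrite (linB (rep_linA hpi _)) subrK.
apply: le_trans (nmD _ _) _; rewrite [leRHS](splitr e); apply: lerD; last exact: ltW.
by apply: le_trans (rep_nm hpi _ _) _; rewrite x1 mulr1 ltW.
Qed.

Lemma crossed_T_compact : dual_property_T GG -> dual_property_T G.
Proof.
move=> hT H pi hpi /almost_fixedP[xi [x1 hxi]]; apply: contrapT => hN.
have hc := counit_char G.
have nofix z : (forall a, pi a z = @counit R G a *: z) -> z = 0.
  move=> hz; apply/eqP; case: eqP => // /eqP z0; case: hN.
  by exists z.
have xi0 n : xi n != 0.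
  by apply/eqP => h; have := x1 n; rewrite h nm0 => /eqP; rewrite eq_sym oner_eq0.
pose phi n a := hdot (pi a (xi n)) (xi n).
have hphi n : state (phi n).
  have := vector_state hpi (xi0 n); rewrite x1 expr1n invr1.
  by have -> : (fun a => rc 1 * hdot (pi a (xi n)) (xi n)) = phi n
    by apply/funext => a; rewrite mul1r.
have phiE n g a : complex.Re (phi n (al g (star a ** a))) = nm (pi (al g a) (xi n)) ^+ 2.
  by rewrite /phi (homM (al_hom hal g)) (hom_star (al_hom hal g)) rep_sqr.
have [psi hpsi] := choice (fun n => invariant_state hal hcomp hGam (hphi n)).
have hs n : state (psi n) by have [] := hpsi n.
have psiinv n g a : psi n (al g a) = psi n a by have [] := hpsi n.
have psilim a : tends \oo (fun n => psi n a : C^o) (@counit R G a).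
  pose b := a - @counit R G a *: cone.
  have eb : counit b = 0 by rewrite /b charB // charZ // char1 // mulr1 subrr.
  move=> e e0; have e2 : 0 < e / 2 by rewrite divr_gt0.
  apply: filterS (uniform_almost_fixed hpi x1 hxi eb e2) => n hn.
  (* The squared modulus of [psi n b] is at most [psi n (star b ** b)], which [invariant_state]
     bounds by the values of [phi n] on the orbit. *)
  have -> : psi n a - counit a = psi n b by rewrite /b stateB // stateZ // state1 // mulr1.
  rewrite -[nm _]/(cabs _); apply: (@le_lt_trans _ _ (e / 2)); last by lra.
  rewrite -ler_sqr ?nnegrE ?cabs_ge0 ?(ltW e2) //; apply: le_trans (state_CS (hs n) b) _.
  have [_ _ h] := hpsi n; apply: h => g; rewrite phiE.
  by rewrite ler_sqr ?nnegrE ?nm_ge0 ?(ltW e2).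
have [n [c [c0 hcn]]] := crossed_T_states hal hfull hu hiota hT hs psiinv psilim.
have [f [fs f1 ef hf]] := kazhdan_element hc (Cm_separable G).
have ff1 : nm (f ** f) <= 1 by rewrite nm_selfsq // expr_le1 // nm_ge0.
have eff : @counit R G (f ** f) = 1 by rewrite charM // ef mulr1.
(* Chosen with [d ^+ 2 < c]: if all orbit values were at most [d], the invariant state would be at
   most [c / 2], against its lower bound [c]. *)
pose d := Num.sqrt (c / 2).
have d0 : 0 < d by rewrite sqrtr_gt0 divr_gt0.
have ex k : exists g, d < nm (pi (al g (cexp (f ** f) k)) (xi n)).
  apply: contrapT => hg; have := hcn (cexp (f ** f) k).
  rewrite char_cexp // cabs1 expr1n mulr1 leNgt => /negP; apply.
  apply: (@le_lt_trans _ _ (c / 2)); last by lra.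
  have [_ _ h] := hpsi n; apply: h => g; rewrite phiE.
  have c2 : 0 <= c / 2 by rewrite divr_ge0 // ltW.
  rewrite -(sqr_sqrtr c2) ler_sqr ?nnegrE ?nm_ge0 ?sqrtr_ge0 //.
  by rewrite leNgt; apply/negP => hlt; apply: hg; exists g.
(* Dini: the powers of [al h (f ** f)] decrease, so the lower bound [d] survives at a limit
   automorphism [x], where they converge to a fixed vector. *)
have [g hg] := choice ex.
have [U [UU oU]] := ultraFilterLemma eventually_filter.
have [x [xh xb xc hx]] := orbit_ultralim hal hcomp UU g.
have pg h : representation (fun a => pi (al h a)) := rep_comp (al_hom hal h) hpi.
have px : representation (fun a => pi (x a)) := rep_comp xh hpi.
have low j : d <= nm (pi (x (cexp (f ** f) j)) (xi n)).
  have hl : tends U (fun k => pi (al (g k) (cexp (f ** f) j)) (xi n))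
      (pi (x (cexp (f ** f) j)) (xi n)).
    apply: (tends_lip (f := fun a => pi a (xi n)) (k := 1)) (hx _) => a b.
    by rewrite -(linB (rep_linA hpi _)) mul1r; have := rep_nm hpi (a - b) (xi n); rewrite x1 mulr1.
  apply: (tends_ge _ hl); apply: filterS (oU _ (near_ge j)) => k jk.
  apply: le_trans (ltW (hg k)) _.
  have E i : pi (al (g k) (cexp (f ** f) i)) (xi n) =
      iter i (pi (al (g k) (f ** f))) (xi n) := rep_cexp _ _ _ (pg (g k)).
  by rewrite !E; exact: (iter_rep_le (xi n) (pg (g k)) ff1 jk).
have [z [hz zfix]] := power_conv (xi n) px fs f1.
(* [z] is fixed for [pi] composed with [x]; as [x] is onto and preserves the counit, it is fixed for
   [pi] itself. *)
have z0 : z = 0.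
  apply: nofix => a; have [y yK xK] := xb.
  by have := hf _ _ _ px zfix (y a); rewrite xK -(xc (y a)) xK.
have : d <= nm z.
  by apply: (tends_ge _ hz); apply: nearW => j; rewrite -(rep_cexp _ _ _ px) low.
by rewrite z0 nm0 leNgt d0.
Qed.

End CompactCase.
End Invariant.

Theorem theorem6p14 (R : realType) (Gam : groupType)
  (hGam : countable [set: Gam])
  (G : compact_quantum_group R) (al : Gam -> Cm G -> Cm G)
  (hal : quantum_action al)
  (GG : compact_quantum_group R)
  (hGG : crossed_product_quantum_group al GG) :
  [/\ dual_property_T GG ->
        property_T R Gam /\ finite_set (fixed_characters al),
      dual_property_T GG -> compact_action al ->
        dual_property_T G /\ property_T R Gam
    & dual_property_T G -> property_T R Gam -> dual_property_T GG].
Proof.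
have [iota [u [hfull hu hiota]]] := hGG; split=> [hT|hT hcomp|hTG hTGam].
- split; first exact: (crossed_T_group hal hfull hu hiota hT).
  exact: (crossed_T_finite hal hfull hu hiota hT).
- split; first exact: (crossed_T_compact hal hcomp hGam hfull hu hiota hT).
  exact: (crossed_T_group hal hfull hu hiota hT).
- exact: (crossed_T_conv hal hfull hu hiota hTG hTGam).
Qed.
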